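(* Let $P$ be a hollow $4$-simplex of width two which does not project to a hollow $3$-polytope. Then $\operatorname{Vol}(P)\le 5184$.
   Context: Let $\Lambda\subset\mathbb{R}^4$ be a lattice of rank $4$ (e.g. $\mathbb{Z}^4$). A lattice polytope has vertices in $\Lambda$; it is hollow if it has no lattice points in its interior. $\operatorname{Vol}$ denotes normalized volume with respect to $\Lambda$, for which a unimodular simplex (vertices forming an affine $\mathbb{Z}$-basis of $\Lambda$) has volume $1$. The width of a convex body $K$ is the minimum length of the interval $f(K)$ over all $f\in\Lambda^*\setminus\{0\}$, where $\Lambda^*$ is the set of linear functionals taking integer values on $\Lambda$. $P$ projects to a hollow $3$-polytope if there is a surjective affine map $\pi:\mathbb{R}^4\to\mathbb{R}^3$ such that $\pi(\Lambda)$ is a lattice and $\pi(P)$ is hollow with respect to $\pi(\Lambda)$. *)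

(* Defs.v *)
From HB Require Import structures.
From mathcomp Require Import all_boot all_order all_algebra.
From mathcomp Require Import all_classical all_reals all_analysis.

Set Implicit Arguments.
Unset Strict Implicit.
Unset Printing Implicit Defensive.

Import Order.TTheory GRing.Theory Num.Theory.
Import numFieldNormedType.Exports.

Local Open Scope classical_set_scope.
Local Open Scope ring_scope.

(* Points of R^n are row vectors, and a family of m points is the m x n matrix
   whose rows are these points. *)

Definition zspan (R : realType) (r n : nat) (B : 'M[R]_(r, n)) : set 'rV[R]_n :=
  [set map_mx intr z *m B | z in [set: 'rV[int]_r]].

Definition lattice_of_rank (R : realType) (n r : nat) (L : set 'rV[R]_n) : Prop :=
  exists2 B : 'M[R]_(r, n), row_free B & L = zspan B.

Definition is_lattice (R : realType) (n : nat) (L : set 'rV[R]_n) : Prop :=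
  exists r : nat, lattice_of_rank r L.

Definition simplex (R : realType) (n : nat) (v : 'M[R]_(n.+1, n)) :
    set 'rV[R]_n :=
  [set w *m v | w in [set w : 'rV[R]_n.+1 |
                       (forall i, 0 <= w 0 i) /\ \sum_i w 0 i = 1]].

Definition edges (R : realType) (n : nat) (v : 'M[R]_(n.+1, n)) : 'M[R]_n :=
  \matrix_(i < n) (row (lift ord0 i) v - row ord0 v).

Definition affinely_independent (R : realType) (n : nat)
    (v : 'M[R]_(n.+1, n)) : Prop := row_free (edges v).

Definition lattice_simplex (R : realType) (n : nat) (L : set 'rV[R]_n)
    (v : 'M[R]_(n.+1, n)) : Prop :=
  affinely_independent v /\ forall i, L (row i v).

(* The rows of v form an affine Z-basis of L. *)
Definition unimodular (R : realType) (n : nat) (L : set 'rV[R]_n)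
    (v : 'M[R]_(n.+1, n)) : Prop :=
  affinely_independent v /\
  L = [set row ord0 v + y | y in zspan (edges v)].

Definition hollow (R : realType) (n : nat) (L K : set 'rV[R]_n) : Prop :=
  interior K `&` L = set0.

Definition dual_lattice (R : realType) (n : nat) (L : set 'rV[R]_n) :
    set {scalar 'rV[R]_n} :=
  [set f | forall x, L x -> f x \is a Num.int].

Definition nonzero_functional (R : realType) (n : nat)
    (f : {scalar 'rV[R]_n}) : Prop := exists x, f x != 0.

Definition length_along (R : realType) (n : nat) (f : {scalar 'rV[R]_n})
    (K : set 'rV[R]_n) : R :=
  sup (f @` K) - inf (f @` K).

(* The width is a minimum, so it must be attained. *)
Definition has_width (R : realType) (n : nat) (L K : set 'rV[R]_n) (w : R) :
    Prop :=
  (exists f : {scalar 'rV[R]_n},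
      [/\ dual_lattice L f, nonzero_functional f & length_along f K = w]) /\
  (forall f : {scalar 'rV[R]_n},
      dual_lattice L f -> nonzero_functional f -> w <= length_along f K).

Definition projects_to_hollow3 (R : realType) (L K : set 'rV[R]_4) : Prop :=
  exists (f : {linear 'rV[R]_4 -> 'rV[R]_3}) (b : 'rV[R]_3),
    let p := fun x : 'rV[R]_4 => f x + b in
    [/\ range p = [set: 'rV[R]_3],
        is_lattice (p @` L) &
        hollow (p @` L) (p @` K)].

(* The library has no Lebesgue measure on row vectors: here it is the product
   measure on R * R * R * R, transported along the coordinates. *)
Definition row4 (R : realType) (t : R * R * R * R) : 'rV[R]_4 :=
  \row_(i < 4) [:: t.1.1.1; t.1.1.2; t.1.2; t.2]`_i.

Definition lebesgue4 (R : realType) (K : set 'rV[R]_4) : \bar R :=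
  let mu := @lebesgue_measure R in
  (((mu \x mu) \x mu) \x mu)%E (@row4 R @^-1` K).

(* Lebesgue measure rescaled so that unimodular simplices of L have volume 1;
   [get] picks one of them, and they all have the same Lebesgue measure. *)
Definition Vol (R : realType) (L K : set 'rV[R]_4) : \bar R :=
  (lebesgue4 K *
   ((fine (lebesgue4 (simplex (get (@unimodular R 4 L)))))^-1)%:E)%E.

(* Main.v *)
From HB Require Import structures.
From Stdlib Require Import ZArith.
Require Import Defs.
From mathcomp Require Import all_boot all_order all_fingroup all_algebra.
From mathcomp Require Import all_classical all_reals all_analysis.
From mathcomp Require Import measurable_realfun ssrZ zify ring lra.

Set Implicit Arguments.
Unset Strict Implicit.
Unset Printing Implicit Defensive.

Import Order.TTheory GRing.Theory Num.Theory.
Import numFieldNormedType.Exports.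
Local Open Scope ring_scope.

(** Let f be a functional realising the width and normalise its values on the
    five vertices to -1, 0, 1. The middle slice Q, where f = 0, is a hollow
    three-dimensional polytope, and no integral projection of Q to the plane
    is hollow: a projection of the simplex that keeps f is not hollow, and a
    lattice point interior to the image can only lie at the level f = 0.
    Everything is expressed in barycentric coordinates w of the simplex; the
    normalised volume V is then the determinant [vol5] of the 5 x 5 matrix with
    rows (z i, x i, y i, f i, 1), and inverting this matrix turns lower bounds
    for V into statements about chords and triangles of Q.

    Choose the lattice direction z in which Q has an (almost) longest chord,
    of lattice length d; project along it and choose x in the same way in the
    plane, with chord length D; y is the remaining coordinate and W the length
    of the range of y on Q, half an integer. Three inequalities hold:
    D <= 2.1 d and W <= 2.1 D, because a chord of the projection lifts to a
    chord of comparable length ([chord_transfer]); 1/d + 1/D + 1/W >= 1,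
    because otherwise lattice points could be reached inside Q
    ([covering3]); and V <= 64 * 1.01^2 d D W, by Cramer's rule
    ([vol5_crude]). If V > 5184 they leave only W <= 3 and d >= 4 W
    ([wide_bound], [narrow_bound]).

    In that range the slices of Q at integral y, its rows, are studied. They
    are planar and contain no interior lattice point, but the absence of hollow
    projections provides a row j with an interior point whose x-coordinate is
    integral. The x-coordinates of vertices of a row have denominator at most
    4 W ([row_gap]), so this row extends by at least 1 / (4 W) to both sides of that
    point, and a planar covering argument bounds the z-chords of row j by
    1 + 4 W, hence those of every row r by some explicit B
    ([row_chord_bound]). A triangle contained in row r then has twice its area
    at most B^2 / (B - 1) ([triangle_area]). On the other hand, if the
    projection of three vertices k, l, m to the (y, f)-plane covers the point
    (r, 0), one can move the corresponding point of row r by explicit amounts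
    towards the two other vertices, and the resulting triangle has area
    proportional to V ([vol5_cross]). For each of the finitely many possible
    positions of the vertices in the (y, f)-plane some choice of k, l, m and r
    gives V <= 5184 ([configurations_checked]).

    Lebesgue measure enters only through the factor |det| by which an affine
    map scales it ([affine_stretches]): this identifies Vol with the
    determinant of the edges in a lattice basis. *)

(** * Covering arguments for convex sets of barycentric coordinates *)

Section ConvexSets.
Variable R : realType.
Implicit Types (w v u t r : 'rV[R]_5) (g z x y : 'I_5 -> int) (a b c d : R).

(** The value at the point with barycentric coordinates w of the affine
    function with vertex values g; for sum w = 0 it is the value of the linear
    part on a vector. *)
Definition ev w g : R := \sum_i w 0 i * (g i)%:~R.

Lemma evD w v g : ev (w + v) g = ev w g + ev v g.
Proof.
by rewrite -big_split; apply: eq_bigr => i _; rewrite mxE mulrDl.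
Qed.

Lemma evZ a w g : ev (a *: w) g = a * ev w g.
Proof.
by rewrite /ev mulr_sumr; apply: eq_bigr => i _; rewrite mxE mulrA.
Qed.

Lemma evB w v g : ev (w - v) g = ev w g - ev v g.
Proof. by rewrite -[- v]scaleN1r evD evZ mulN1r. Qed.

Definition evE := (evB, evD, evZ).

Definition positive w := forall i, 0 < w 0 i.

Definition convex_set (C : 'rV[R]_5 -> Prop) := forall a b w v,
  0 <= a -> 0 <= b -> a + b = 1 -> C w -> C v -> C (a *: w + b *: v).

Definition nonneg_set (C : 'rV[R]_5 -> Prop) := forall w i, C w -> 0 <= w 0 i.


Lemma positive_mix4 a b c d w v u t : positive w -> (forall i, 0 <= v 0 i) ->
  (forall i, 0 <= u 0 i) -> (forall i, 0 <= t 0 i) ->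
  0 < a -> 0 <= b -> 0 <= c -> 0 <= d ->
  positive (a *: w + b *: v + c *: u + d *: t).
Proof.
move=> w0 v0 u0 t0 a0 b0 c0 d0 i; rewrite !mxE -!addrA.
by rewrite ltr_wpDr ?mulr_gt0 ?addr_ge0 ?mulr_ge0.
Qed.

Lemma positive_mix3 a b c w v u : positive w -> (forall i, 0 <= v 0 i) ->
  (forall i, 0 <= u 0 i) -> 0 < a -> 0 <= b -> 0 <= c ->
  positive (a *: w + b *: v + c *: u).
Proof.
move=> w0 v0 u0 a0 b0 c0.
by rewrite -[X in positive X]addr0 -(scale0r u); apply: positive_mix4.
Qed.

Lemma positive_mix a b w v : positive w -> (forall i, 0 <= v 0 i) ->
  0 < a -> 0 <= b -> positive (a *: w + b *: v).
Proof.
move=> w0 v0 a0 b0.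
by rewrite -[X in positive X]addr0 -(scale0r v); apply: positive_mix3.
Qed.

Lemma integer_in_segment a b : 1 <= b ->
  exists2 t, 0 <= t <= 1 & a + t * b \is a Num.int.
Proof.
move=> b1; exists (((Num.ceil a)%:~R - a) / b); last first.
  by rewrite divfK ?subrKC ?intr_int //; apply/eqP; lra.
have := ceil_itv a; have bp : 0 < b by lra.
by rewrite ler_pdivlMr // ler_pdivrMr // mul0r mul1r rmorphB /=; lra.
Qed.

Lemma eq_int a b : a = b -> a \is a Num.int -> b \is a Num.int.
Proof. by move->. Qed.

Lemma convex3 C a b c w v u : convex_set C -> 0 <= a -> 0 <= b -> 0 <= c ->
  a + b + c = 1 -> C w -> C v -> C u -> C (a *: w + b *: v + c *: u).
Proof.
move=> hC a0 b0 c0 abc Cw Cv Cu.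
have [ab|ab] := eqVneq (a + b) 0.
  have -> : a = 0 by lra.
  have -> : b = 0 by lra.
  have -> : c = 1 by lra.
  by rewrite !scale0r !add0r scale1r.
have -> : a *: w + b *: v = (a + b) *: ((a / (a + b)) *: w + (b / (a + b)) *: v).
  by rewrite scalerDr !scalerA !mulrA ![(a + b) * _]mulrC !mulfK.
apply: (hC) => //; first by lra.
by apply: (hC); rewrite ?divr_ge0 ?addr_ge0 // -mulrDl divff.
Qed.

Lemma convex4 C a b c d w v u t : convex_set C ->
  0 <= a -> 0 <= b -> 0 <= c -> 0 <= d -> a + b + c + d = 1 ->
  C w -> C v -> C u -> C t -> C (a *: w + b *: v + c *: u + d *: t).
Proof.
move=> hC a0 b0 c0 d0 abc Cw Cv Cu Ct.
have [ab|ab] := eqVneq (a + b) 0.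
  have -> : a = 0 by lra.
  have -> : b = 0 by lra.
  by rewrite !scale0r !add0r; apply: (hC) => //; lra.
have -> : a *: w + b *: v = (a + b) *: ((a / (a + b)) *: w + (b / (a + b)) *: v).
  by rewrite scalerDr !scalerA !mulrA ![(a + b) * _]mulrC !mulfK.
apply: convex3 => //; first by lra.
by apply: (hC); rewrite ?divr_ge0 ?addr_ge0 // -mulrDl divff.
Qed.

(** Weights 1/m and 1/J spent on a z-chord of length m and on a segment that
    crosses x-range J leave room to move by a full lattice step in each
    coordinate. When they sum to less than 1, the remaining weight goes to a
    positive point, so that the lattice point found is interior. *)
Lemma covering2 C z x w v v' u u' m J : convex_set C -> nonneg_set C ->
  C w -> positive w -> C v -> C v' -> C u -> C u' ->
  0 < m -> ev v' z = ev v z + m -> ev v' x = ev v x ->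
  0 < J -> ev u' x = ev u x + J -> m + J < m * J ->
  exists t, [/\ C t, positive t, ev t z \is a Num.int & ev t x \is a Num.int].
Proof.
move=> hC hn Cw wp Cv Cv' Cu Cu' m0 vz vx J0 ux mJ.
pose e := (1 - m^-1 - J^-1) / 3.
have e0 : 0 < e.
  have mJ0 : 0 < m * J by apply: mulr_gt0.
  rewrite /e divr_gt0 // -(pmulr_lgt0 _ mJ0).
  have -> : (1 - m^-1 - J^-1) * (m * J) = m * J - J - m by field; rewrite !gt_eqF.
  lra.
have im0 : 0 < m^-1 by rewrite invr_gt0.
have iJ0 : 0 < J^-1 by rewrite invr_gt0.
pose a := m^-1 + e; pose b := J^-1 + e.
have am : 1 <= a * m by rewrite /a mulrDl mulVf ?gt_eqF // lerDl mulr_ge0 ?ltW.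
have bJ : 1 <= b * J by rewrite /b mulrDl mulVf ?gt_eqF // lerDl mulr_ge0 ?ltW.
have abe : e + a + b = 1 by rewrite /a /b /e; field; rewrite !gt_eqF.
have a0 : 0 < a by rewrite addr_gt0.
have b0 : 0 < b by rewrite addr_gt0.
have [t /andP[t0 t1] xt] := integer_in_segment
  (e * ev w x + a * ev v x + b * ev u x) bJ.
pose u0 := (1 - t) *: u + t *: u'.
have [s /andP[s0 s1] zs] := integer_in_segment
  (e * ev w z + a * ev v z + b * ev u0 z) am.
pose v0 := (1 - s) *: v + s *: v'.
have Cu0 : C u0 by apply: (hC); rewrite ?subr_ge0 ?subrK.
have Cv0 : C v0 by apply: (hC); rewrite ?subr_ge0 ?subrK.
exists (e *: w + a *: v0 + b *: u0); split.
- by apply: convex3 => //; apply: ltW.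
- by apply: positive_mix3; rewrite ?ltW // => i; apply: hn.
- by move: zs; apply: eq_int; rewrite /v0 ?evE vz; ring.
- by move: xt; apply: eq_int; rewrite /v0 /u0 ?evE ux vx; ring.
Qed.

(** The three-dimensional version of [covering2]: y is made integral with
    the segment r r', then x with u u', then z with v v', each step leaving the
    coordinates that are already integral unchanged. *)
Lemma covering3 C z x y w v v' u u' r r' d D W :
  convex_set C -> nonneg_set C ->
  C w -> positive w -> C v -> C v' -> C u -> C u' -> C r -> C r' ->
  0 < d -> ev v' z = ev v z + d -> ev v' x = ev v x -> ev v' y = ev v y ->
  0 < D -> ev u' x = ev u x + D -> ev u' y = ev u y ->
  0 < W -> ev r' y = ev r y + W ->
  D * W + d * W + d * D < d * D * W ->
  exists t, [/\ C t, positive t, ev t z \is a Num.int,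
                ev t x \is a Num.int & ev t y \is a Num.int].
Proof.
move=> hC hn Cw wp Cv Cv' Cu Cu' Cr Cr' d0 vz vx vy D0 ux uy W0 ry dDW.
pose e := (1 - d^-1 - D^-1 - W^-1) / 4.
have e0 : 0 < e.
  have p0 : 0 < d * D * W by rewrite !mulr_gt0.
  rewrite /e divr_gt0 // -(pmulr_lgt0 _ p0).
  have -> : (1 - d^-1 - D^-1 - W^-1) * (d * D * W) =
    d * D * W - D * W - d * W - d * D by field; rewrite !gt_eqF.
  lra.
have id0 : 0 < d^-1 by rewrite invr_gt0.
have iD0 : 0 < D^-1 by rewrite invr_gt0.
have iW0 : 0 < W^-1 by rewrite invr_gt0.
pose a := d^-1 + e; pose b := D^-1 + e; pose c := W^-1 + e.
have ad : 1 <= a * d by rewrite /a mulrDl mulVf ?gt_eqF // lerDl mulr_ge0 ?ltW.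
have bD : 1 <= b * D by rewrite /b mulrDl mulVf ?gt_eqF // lerDl mulr_ge0 ?ltW.
have cW : 1 <= c * W by rewrite /c mulrDl mulVf ?gt_eqF // lerDl mulr_ge0 ?ltW.
have abce : e + a + b + c = 1 by rewrite /a /b /c /e; field; rewrite !gt_eqF.
have a0 : 0 < a by rewrite addr_gt0.
have b0 : 0 < b by rewrite addr_gt0.
have c0 : 0 < c by rewrite addr_gt0.
have [t /andP[t0 t1] yt] := integer_in_segment
  (e * ev w y + a * ev v y + b * ev u y + c * ev r y) cW.
pose r0 := (1 - t) *: r + t *: r'.
have [q /andP[q0 q1] xq] := integer_in_segment
  (e * ev w x + a * ev v x + b * ev u x + c * ev r0 x) bD.
pose u0 := (1 - q) *: u + q *: u'.
have [s /andP[s0 s1] zs] := integer_in_segment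
  (e * ev w z + a * ev v z + b * ev u0 z + c * ev r0 z) ad.
pose v0 := (1 - s) *: v + s *: v'.
have Cr0 : C r0 by apply: (hC); rewrite ?subr_ge0 ?subrK.
have Cu0 : C u0 by apply: (hC); rewrite ?subr_ge0 ?subrK.
have Cv0 : C v0 by apply: (hC); rewrite ?subr_ge0 ?subrK.
exists (e *: w + a *: v0 + b *: u0 + c *: r0); split.
- by apply: convex4 => //; apply: ltW.
- by apply: positive_mix4; rewrite ?ltW // => i; apply: hn.
- by move: zs; apply: eq_int; rewrite /v0 ?evE vz; ring.
- by move: xq; apply: eq_int; rewrite /v0 /u0 ?evE ux vx; ring.
- by move: yt; apply: eq_int; rewrite /v0 /u0 /r0 ?evE ry uy vy; ring.
Qed.
End ConvexSets.

(** * Chords of convex sets and of planar rows *)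

Section Chords.
Variable R : realType.
Implicit Types (w v u t r l : 'rV[R]_5) (g z x y : 'I_5 -> int) (a b c d : R).

(** Lifting a chord of the projection along X. The segment w w' has direction
    (?, e1, e2), and adding the right multiple of the X-chord v v' makes its
    X-slope the nearest integer k; the price is the factor d / (d + s / 2). The
    lifted chord has an integral direction, so its length is at most 1.01 d. *)
Lemma chord_transfer C X Y1 Y2 (e1 e2 : int) v v' w w' d s :
  convex_set C -> C v -> C v' -> C w -> C w' -> 0 < d ->
  ev v' X = ev v X + d -> ev v' Y1 = ev v Y1 -> ev v' Y2 = ev v Y2 ->
  ev w' Y1 = ev w Y1 + s * e1%:~R -> ev w' Y2 = ev w Y2 + s * e2%:~R ->
  (forall (k : int) t t' q, C t -> C t' -> ev t' X = ev t X + q * k%:~R ->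
     ev t' Y1 = ev t Y1 + q * e1%:~R -> ev t' Y2 = ev t Y2 + q * e2%:~R ->
     q <= 101 / 100 * d) ->
  s <= 21 / 10 * d.
Proof.
move=> hC Cv Cv' Cw Cw' d0 vX vY1 vY2 wY1 wY2 bound.
have [s0|s0] := leP s 0; first by lra.
(* the integer nearest to the X-slope of w w' *)
pose k := Num.floor ((ev w' X - ev w X) / s + 2^-1).
have kP : - (s / 2) <= ev w' X - ev w X - s * k%:~R <= s / 2.
  have := floor_itv ((ev w' X - ev w X) / s + 2^-1); rewrite -/k rmorphD /=.
  set q := (_ / s) => /andP[h1 h2].
  have -> : ev w' X - ev w X = q * s by rewrite /q divfK ?gt_eqF.
  nra.
pose S := d + s / 2.
have S0 : 0 < S by rewrite /S; lra.
(* sliding along v v' by th corrects the slope to k *)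
pose th := (s * k%:~R - (ev w' X - ev w X)) / s.
have thP : - 2^-1 <= th <= 2^-1.
  by rewrite /th ler_pdivlMr // ler_pdivrMr //; lra.
pose p := (2^-1 + th) *: v + (2^-1 - th) *: v'.
pose p' := (2^-1 - th) *: v + (2^-1 + th) *: v'.
have Cp : C p by apply: (hC) => //; lra.
have Cp' : C p' by apply: (hC) => //; lra.
pose a := d / S; pose b := (s / 2) / S.
have a0 : 0 <= a by rewrite divr_ge0 //; lra.
have b0 : 0 <= b by rewrite divr_ge0 //; lra.
have ab : a + b = 1 by rewrite -mulrDl divff ?gt_eqF.
have sN0 : s != 0 by rewrite gt_eqF.
have SN0 : S != 0 by rewrite gt_eqF.
have := bound k (a *: w + b *: p) (a *: w' + b *: p') (a * s).
have h : a * s <= 101 / 100 * d -> s <= 21 / 10 * d.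
  rewrite /a mulrAC ler_pdivrMr // => h.
  have : 0 <= d * (101 / 100 * S - s) by lra.
  by rewrite pmulr_rge0 // /S; lra.
move=> H; apply: h; apply: H; rewrite ?/p ?/p' ?evE.
- exact: hC.
- exact: hC.
- rewrite vX /a /b /th; field; exact/andP.
- rewrite vY1 wY1; ring.
- rewrite vY2 wY2; ring.
Qed.

Definition hollow_row (C : 'rV[R]_5 -> Prop) z x :=
  forall t, C t -> positive t -> ev t z \is a Num.int -> ev t x \is a Num.int ->
  False.

Definition is_chord (C : 'rV[R]_5 -> Prop) z x (m : R) := 0 < m /\
  exists v v', [/\ C v, C v', ev v' z = ev v z + m & ev v' x = ev v x].

(** A positive point w of integral x and a point l at distance e to one side
    of its lattice line bound the z-chords on the other side: far from the line
    [covering2] applies; near the line the chord, shrunk towards l until it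
    lies on the line, would still be longer than 1, and a point of it mixed
    with w would be an interior lattice point. *)
Lemma half_row_chord C z x w l v v' m e :
  convex_set C -> nonneg_set C -> hollow_row C z x ->
  C w -> positive w -> ev w x \is a Num.int ->
  0 < e -> C l -> ev l x <= ev w x - e ->
  C v -> C v' -> 0 < m -> ev v' z = ev v z + m -> ev v' x = ev v x ->
  ev w x <= ev v x -> m * e <= 1 + e.
Proof.
move=> hC hn hh Cw wp wx e0 CL wL Cv Cv' m0 vz vx xi.
rewrite leNgt; apply/negP => me.
have [far|near] := leP (ev w x + 1) (ev v x).
  have [|//||t [Ct tp tz tx]] := covering2 (J := ev v x - ev l x) hC hn Cw wp
    Cv Cv' CL Cv m0 vz vx.
  - lra.
  - lra.
  - have : 1 < (m - 1) * (ev v x - ev l x - 1) by nra.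
    lra.
  - exact: hh t Ct tp tz tx.
pose e' := ev w x - ev l x; pose D := ev v x - ev w x + e'.
have e'e : e <= e' by rewrite /e'; lra.
have D0 : 0 < D by rewrite /D; lra.
have DN0 : D != 0 by rewrite gt_eqF.
pose a := e' / D; pose b := (ev v x - ev w x) / D.
have a0 : 0 <= a by rewrite divr_ge0 //; lra.
have b0 : 0 <= b by rewrite divr_ge0 //; lra.
have ab : a + b = 1 by rewrite -mulrDl addrC divff.
have am : 1 < a * m.
  rewrite /a mulrAC ltr_pdivlMr // mul1r.
  have e'0 : 0 < e' by lra.
  have h : e' * (1 + e) < e' * (m * e) by rewrite ltr_pM2l.
  suff : 1 + e' < e' * m by rewrite /D; lra.
  by rewrite -(ltr_pM2r e0); lra.
have am0 : 0 < a * m by lra.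
(* the largest weight that still leaves a chord of length 1 *)
pose t0 := (a * m)^-1.
have t00 : 0 < t0 by rewrite invr_gt0.
have t01 : t0 < 1 by rewrite invf_lt1.
have tam : t0 * (a * m) = 1 by rewrite mulVf ?gt_eqF.
pose q := a *: v + b *: l; pose q' := a *: v' + b *: l.
have Cq : C q by exact: hC.
have Cq' : C q' by exact: hC.
have [s /andP[s0 s1] zs] := integer_in_segment
  ((1 - t0) * ev w z + t0 * ev q z) (lexx (1 : R)).
pose q0 := (1 - s) *: q + s *: q'.
have Cq0 : C q0 by apply: (hC) => //; lra.
apply: (hh ((1 - t0) *: w + t0 *: q0)).
- by apply: hC => //; lra.
- by apply: positive_mix; rewrite ?ltW ?subr_gt0 // => i; apply: hn.
- move: zs; apply: eq_int.
  transitivity ((1 - t0) * ev w z + t0 * ev q z + s * (t0 * (a * m))).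
    by rewrite tam.
  by rewrite /q0 /q' /q ?evE vz; ring.
- move: wx; apply: eq_int; rewrite /q0 /q' /q ?evE vx /a /b.
  have -> : ev l x = ev w x - e' by rewrite /e'; ring.
  have -> : ev v x = D + ev w x - e' by rewrite /D; ring.
  by field.
Qed.

Lemma ev_opp w g : ev w (fun i => - g i) = - ev w g.
Proof.
by rewrite /ev -sumrN; apply: eq_bigr => i _; rewrite rmorphN /= mulrN.
Qed.

Lemma row_chord C z x w l r m e :
  convex_set C -> nonneg_set C -> hollow_row C z x ->
  C w -> positive w -> ev w x \is a Num.int -> 0 < e ->
  C l -> ev l x <= ev w x - e -> C r -> ev w x + e <= ev r x ->
  is_chord C z x m -> m <= 1 + e^-1.
Proof.
move=> hC hn hh Cw wp wx e0 CL wL CR wR [m0 [v [v' [Cv Cv' vz vx]]]].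
suff h : m * e <= 1 + e.
  by rewrite -(ler_pM2r e0) mulrDl mulVf ?gt_eqF // mul1r addrC.
have [xi|xi] := leP (ev w x) (ev v x).
  exact: (half_row_chord hC hn hh Cw wp wx e0 CL wL Cv Cv' m0 vz vx xi).
apply: (@half_row_chord C z (fun i => - x i) w r v v' m e) => //.
- by move=> t Ct tp tz; rewrite ev_opp rpredN; apply: hh.
- by rewrite ev_opp rpredN.
- by rewrite !ev_opp; lra.
- by rewrite !ev_opp vx.
- by rewrite !ev_opp; lra.
Qed.

Lemma row_covering C z x w v v' m J :
  convex_set C -> nonneg_set C -> hollow_row C z x -> C w -> positive w ->
  is_chord C z x m -> C v -> C v' -> 0 < J -> ev v' x = ev v x + J ->
  m * J <= m + J.
Proof.
move=> hC hn hh Cw wp [m0 [u [u' [Cu Cu' uz ux]]]] Cv Cv' J0 vx.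
rewrite leNgt; apply/negP => mJ.
have [t [Ct tp tz tx]] := covering2 hC hn Cw wp Cu Cu' Cv Cv' m0 uz ux J0 vx mJ.
exact: hh t Ct tp tz tx.
Qed.

Definition cross z x w u v : R :=
  (ev u z - ev w z) * (ev v x - ev w x) - (ev v z - ev w z) * (ev u x - ev w x).

(** The vertical chord through the middle vertex of a triangle, times its
    width, is twice the area. *)
Lemma triangle_chord C z x w u v : convex_set C -> C w -> C u -> C v ->
  ev w x <= ev u x -> ev u x <= ev v x -> cross z x w u v != 0 ->
  exists m, [/\ is_chord C z x m, 0 < ev v x - ev w x &
     `|cross z x w u v| = m * (ev v x - ev w x)].
Proof.
move=> hC Cw Cu Cv wu uv c0.
set J := ev v x - ev w x.
have J0 : 0 < J.
  rewrite lt_neqAle eq_sym {2}/J subr_ge0 (le_trans wu uv) andbT.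
  apply: contra c0; rewrite subr_eq0 => /eqP vw.
  have uw : ev u x = ev w x by apply/le_anti; rewrite wu -vw uv.
  by rewrite /cross uw vw !subrr !mulr0 subr0.
pose p := ((ev v x - ev u x) / J) *: w + ((ev u x - ev w x) / J) *: v.
have Cp : C p.
  apply: hC => //; first by apply: divr_ge0; [lra | exact: ltW].
    by apply: divr_ge0; [lra | exact: ltW].
  rewrite -mulrDl.
  have -> : ev v x - ev u x + (ev u x - ev w x) = J by rewrite /J; ring.
  by rewrite divff ?gt_eqF.
have JN0 : J != 0 by rewrite gt_eqF.
have px : ev p x = ev u x by rewrite /p !evE /J; field.
have pz : (ev u z - ev p z) * J = cross z x w u v.
  by rewrite /p !evE /cross /J; field.
exists `|ev u z - ev p z|; split => //; last first.
  by rewrite -pz normrM (gtr0_norm J0).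
split.
  by rewrite normr_gt0; apply: contra c0 => /eqP h; rewrite -pz h mul0r.
have [h|h] := ger0P (ev u z - ev p z).
  by exists p, u; split => //; ring.
by exists u, p; split => //; ring.
Qed.

(** With M the longer of a given chord of length at least 2 and the middle
    chord of the triangle, twice the area is at most M J with J <= M / (M - 1)
    by covering, and M^2 / (M - 1) increases with M from 2 to B. *)
Lemma triangle_area C z x w u v (B : R) : convex_set C -> 2 <= B ->
  (forall m v v' J, is_chord C z x m -> C v -> C v' -> 0 < J ->
      ev v' x = ev v x + J -> m * J <= m + J) ->
  (exists2 m, is_chord C z x m & 2 <= m) ->
  (forall m, is_chord C z x m -> m <= B) ->
  C w -> C u -> C v -> `|cross z x w u v| * (B - 1) <= B ^+ 2.
Proof.
move=> hC B2 cov [m0 ch0 m02] chB.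
have [->|c0] := eqVneq (cross z x w u v) 0.
  by move=> _ _ _; rewrite normr0 mul0r sqr_ge0.
have main w' u' v' : C w' -> C u' -> C v' ->
    ev w' x <= ev u' x -> ev u' x <= ev v' x ->
    `|cross z x w' u' v'| = `|cross z x w u v| ->
    `|cross z x w u v| * (B - 1) <= B ^+ 2.
  move=> Cw Cu Cv wu uv ceq.
  have c0' : cross z x w' u' v' != 0 by rewrite -normr_eq0 ceq normr_eq0.
  have [m [chm J0 cE]] := triangle_chord (z := z) hC Cw Cu Cv wu uv c0'.
  rewrite -ceq cE; set J := (_ - _) in J0 *.
  have Jv : ev v' x = ev w' x + J by rewrite /J; ring.
  have [M [chM mM M2]] : exists M, [/\ is_chord C z x M, m <= M & 2 <= M].
    have [h|h] := leP m m0; first by exists m0.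
    by exists m; split => //; lra.
  have := cov _ _ _ _ chM Cw Cv J0 Jv.
  have MB := chB _ chM; have := chm.1 => mp.
  move=> hM; have hMJ : J * (M - 1) <= M by lra.
  have : m * J * (B - 1) * (M - 1) <= B ^+ 2 * (M - 1).
    have h1 : m * J * (M - 1) <= M * M by nra.
    have h2 : M * M * (B - 1) <= B ^+ 2 * (M - 1).
      have : 0 <= (B - M) * (B * M - B - M) by apply: mulr_ge0; nra.
      nra.
    nra.
  by rewrite ler_pM2r //; lra.
move=> Cw Cu Cv.
have [h1|h1] := leP (ev w x) (ev u x); have [h2|h2] := leP (ev u x) (ev v x);
  have [h3|h3] := leP (ev w x) (ev v x); try lra.
- exact: (main w u v).
- by apply: (main w v u) => //; [exact: ltW | rewrite -normrN /cross; congr `|_|; ring].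
- by apply: (main v w u) => //; [exact: ltW | rewrite /cross; congr `|_|; ring].
- by apply: (main u w v) => //; [exact: ltW | rewrite -normrN /cross; congr `|_|; ring].
- by apply: (main u v w) => //; [exact: ltW | rewrite /cross; congr `|_|; ring].
- by apply: (main v u w) => //; [exact: ltW | exact: ltW
    | rewrite -normrN /cross; congr `|_|; ring].
Qed.
End Chords.

(** * The determinant of five lattice points and chords of the middle slice *)

Definition o0 := @Ordinal 5 0 isT.
Definition o1 := @Ordinal 5 1 isT.
Definition o2 := @Ordinal 5 2 isT.
Definition o3 := @Ordinal 5 3 isT.
Definition o4 := @Ordinal 5 4 isT.

Lemma sum5 (V : nmodType) (F : 'I_5 -> V) :
  \sum_i F i = F o0 + F o1 + F o2 + F o3 + F o4.
Proof.
rewrite !big_ord_recl big_ord0 addr0 !addrA.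
by do !congr (_ + _); congr F; apply: val_inj.
Qed.

Lemma sum5_perm (V : nmodType) (s : 'S_5) (F : 'I_5 -> V) :
  \sum_i F i = F (s o0) + F (s o1) + F (s o2) + F (s o3) + F (s o4).
Proof. by rewrite (reindex_inj (@perm_inj _ s)) sum5. Qed.

Lemma ord5P (P : 'I_5 -> Prop) : P o0 -> P o1 -> P o2 -> P o3 -> P o4 ->
  forall i, P i.
Proof.
move=> h0 h1 h2 h3 h4 [[|[|[|[|[|n]]]]] lt_n] //.
- by rewrite (_ : Ordinal _ = o0) //; apply: val_inj.
- by rewrite (_ : Ordinal _ = o1) //; apply: val_inj.
- by rewrite (_ : Ordinal _ = o2) //; apply: val_inj.
- by rewrite (_ : Ordinal _ = o3) //; apply: val_inj.
- by rewrite (_ : Ordinal _ = o4) //; apply: val_inj.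
Qed.

Lemma perm5_pair (i j : 'I_5) : i != j -> exists s : 'S_5, s o0 = i /\ s o1 = j.
Proof.
move=> ij.
exists (tperm o1 (tperm o0 i j) * tperm o0 i)%g; rewrite !permM; split.
  have jn : tperm o0 i j != o0.
    by rewrite -[X in _ != X](tpermR o0 i) (inj_eq perm_inj) eq_sym.
  by rewrite (tpermD _ jn) ?tpermL.
by rewrite tpermL tpermK.
Qed.

Lemma det2 (K : comNzRingType) (M : 'M[K]_2) (m : nat -> nat -> K) :
  (forall i j, M i j = m i j) -> \det M = m 0%N 0%N * m 1%N 1%N - m 0%N 1%N * m 1%N 0%N.
Proof.
move=> ME; rewrite (expand_det_row _ 0) !big_ord_recl big_ord0 /cofactor.
by rewrite !det_mx11 !mxE !ME /= /bump /=; ring.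
Qed.

Lemma det3 (K : comNzRingType) (M : 'M[K]_3) (m : nat -> nat -> K) :
  (forall i j, M i j = m i j) ->
  \det M = m 0%N 0%N * (m 1%N 1%N * m 2%N 2%N - m 1%N 2%N * m 2%N 1%N)
         - m 0%N 1%N * (m 1%N 0%N * m 2%N 2%N - m 1%N 2%N * m 2%N 0%N)
         + m 0%N 2%N * (m 1%N 0%N * m 2%N 1%N - m 1%N 1%N * m 2%N 0%N).
Proof.
move=> ME; rewrite (expand_det_row _ 0) !big_ord_recl big_ord0 /cofactor.
have det_minor k : \det (row' 0 (col' k M)) =
   m 1%N (bump k 0) * m 2%N (bump k 1) - m 1%N (bump k 1) * m 2%N (bump k 0).
  by rewrite (det2 (m := fun i j => m (bump 0 i) (bump k j))) // => i j; rewrite !mxE ME.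
by rewrite !det_minor !ME /= /bump /=; ring.
Qed.

(** Because the pivot is on the diagonal, the cofactor has no sign. *)
Lemma det_unit_row (K : comNzRingType) n (M : 'M[K]_n.+1) (k : 'I_n.+1) :
  (forall j, M k j = (j == k)%:R) -> \det M = \det (row' k (col' k M)).
Proof.
move=> Mk; rewrite (expand_det_row _ k) (bigD1 k) //= big1 => [|j jk].
  by rewrite Mk eqxx mul1r addr0 /cofactor -signr_odd oddD addbb mul1r.
by rewrite Mk (negPf jk) mul0r.
Qed.

Lemma minorE (K : Type) n (M : 'M[K]_n.+1) k l i j :
  row' k (col' l M) i j = M (lift k i) (lift l j).
Proof. by rewrite mxE mxE. Qed.

Definition one : 'I_5 -> int := fun=> 1.

(** Twice the signed area of the triangle k l m in the (y, f)-plane. *)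
Definition tdet (y f : 'I_5 -> int) (k l m : 'I_5) : int :=
  (y l - y k) * (f m - f k) - (y m - y k) * (f l - f k).

Lemma ev_delta (R : realType) (k : 'I_5) (g : 'I_5 -> int) :
  ev (delta_mx 0 k : 'rV[R]_5) g = (g k)%:~R.
Proof.
rewrite /ev (bigD1 k) //= big1 => [|i ik].
  by rewrite mxE !eqxx mul1r addr0.
by rewrite mxE (negPf ik) mul0r.
Qed.

Lemma ev_one (R : realType) (w : 'rV[R]_5) : ev w one = \sum_i w 0 i.
Proof. by apply: eq_bigr => i _; rewrite mulr1. Qed.

(** Positive and negative parts have the same sum, and one of them has at
    most two entries. *)
Lemma large_entry (R : realType) (t : 'rV[R]_5) : ev t one = 0 ->
  exists i, \sum_j `|t 0 j| <= 4 * `|t 0 i|.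
Proof.
rewrite /ev sum5 /one !mulr1 => t0.
case: (pselect (exists i, \sum_j `|t 0 j| <= 4 * `|t 0 i|)) => // hN.
have h i : 4 * `|t 0 i| < \sum_j `|t 0 j|.
  by rewrite ltNge; apply/negP => hi; apply: hN; exists i.
move: (h o0) (h o1) (h o2) (h o3) (h o4); rewrite sum5.
case: (ger0P (t 0 o0)) => ?; case: (ger0P (t 0 o1)) => ?;
  case: (ger0P (t 0 o2)) => ?; case: (ger0P (t 0 o3)) => ?;
  case: (ger0P (t 0 o4)) => ?; lra.
Qed.

Lemma one_le_chain (R : realFieldType) (q A d m : R) :
  1 <= q * A -> 0 <= A -> q <= d -> A <= 4 * m -> 1 <= 4 * d * m /\ 0 < d.
Proof.
move=> qA A0 qd Am.
have q0 : 0 < q.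
  rewrite ltNge; apply/negP => q0.
  have : q * A <= 0 by rewrite mulr_le0_ge0.
  lra.
have d0 : 0 < d by lra.
split=> //; apply: (le_trans qA); apply: (le_trans (ler_wpM2r A0 qd)).
by rewrite -mulrA mulrCA ler_pM2l.
Qed.

Lemma rowBE (R : realType) (a b : 'rV[R]_5) k : (a - b) 0 k = a 0 k - b 0 k.
Proof. by rewrite !mxE. Qed.

Lemma rowDE (R : realType) (a b : 'rV[R]_5) k : (a + b) 0 k = a 0 k + b 0 k.
Proof. by rewrite !mxE. Qed.

Lemma rowZE (R : realType) c (a : 'rV[R]_5) k : (c *: a) 0 k = c * a 0 k.
Proof. by rewrite !mxE. Qed.

Lemma rowNE (R : realType) (a : 'rV[R]_5) k : (- a) 0 k = - a 0 k.
Proof. by rewrite !mxE. Qed.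

Definition entriesE := (rowBE, rowDE, rowZE, rowNE).

Section Simplex.
Variable R : realType.
Implicit Types (w u v : 'rV[R]_5) (i j k l m : 'I_5).
Variables z x y f : 'I_5 -> int.

Definition coordmx : 'M[R]_5 :=
  \matrix_(i, j) (nth 0 [:: z i; x i; y i; f i; 1] j)%:~R.

Definition vol5 : R := `|\det coordmx|.

(** In barycentric coordinates, mu changes z by 1 and keeps x, y and f; nu does
    the same for x. *)
Definition mu := row o0 (invmx coordmx).
Definition nu := row o1 (invmx coordmx).
Definition wedge i j : R := mu 0 i * nu 0 j - mu 0 j * nu 0 i.

Hypothesis vol5_gt0 : 0 < vol5.

Let coord_unit : coordmx \in unitmx.
Proof. by rewrite unitmxE unitfE -normr_gt0. Qed.

Lemma mul_coordmx w : w *m coordmx =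
  \row_j nth 0 [:: ev w z; ev w x; ev w y; ev w f; ev w one] j.
Proof.
apply/rowP => j; rewrite !mxE.
by elim/ord5P: j => /=; apply: eq_bigr => i _; rewrite mxE.
Qed.

Let muE : mu *m coordmx = delta_mx 0 o0.
Proof. by rewrite -row_mul mulVmx // row1. Qed.

Let nuE : nu *m coordmx = delta_mx 0 o1.
Proof. by rewrite -row_mul mulVmx // row1. Qed.

Lemma ev_mu : [/\ ev mu z = 1, ev mu x = 0, ev mu y = 0, ev mu f = 0 &
  ev mu one = 0].
Proof.
have := muE; rewrite mul_coordmx => /rowP h.
by split; [have := h o0|have := h o1|have := h o2|have := h o3|have := h o4];
  rewrite !mxE.
Qed.

Lemma ev_nu : [/\ ev nu z = 0, ev nu x = 1, ev nu y = 0, ev nu f = 0 &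
  ev nu one = 0].
Proof.
have := nuE; rewrite mul_coordmx => /rowP h.
by split; [have := h o0|have := h o1|have := h o2|have := h o3|have := h o4];
  rewrite !mxE.
Qed.

Lemma y_direction : exists t : 'rV[R]_5,
  [/\ ev t y = 1, ev t f = 0 & ev t one = 0].
Proof.
exists (row o2 (invmx coordmx)).
have : row o2 (invmx coordmx) *m coordmx = delta_mx 0 o2.
  by rewrite -row_mul mulVmx // row1.
rewrite mul_coordmx => /rowP h.
by split; [have := h o2|have := h o3|have := h o4]; rewrite !mxE.
Qed.

Lemma kernel_span w : ev w y = 0 -> ev w f = 0 -> ev w one = 0 ->
  w = ev w z *: mu + ev w x *: nu.
Proof.
move=> wy wf w1; apply: (row_free_inj _ (A := coordmx)).
  by rewrite row_free_unit.
rewrite mulmxDl -!scalemxAl muE nuE mul_coordmx wy wf w1.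
by apply/rowP => j; elim/ord5P: j; rewrite !mxE /= ?(mulr0, mulr1, addr0, add0r).
Qed.

(** Jacobi's identity between a minor of a matrix and the complementary minor
    of its inverse. The product of coordmx with the matrix G of rows mu, nu and
    three unit vectors is block triangular, with tdet as its determinant, while
    det G is the 2 x 2 minor of mu and nu. *)
Lemma vol5_wedge (s : 'S_5) : vol5 * `|wedge (s o0) (s o1)| =
  `|tdet y f (s o2) (s o3) (s o4)|%:~R.
Proof.
pose G : 'M[R]_5 := \matrix_(i, j)
  nth 0 [:: mu 0 j; nu 0 j; (j == s o2)%:R; (j == s o3)%:R; (j == s o4)%:R] i.
have evd (k : 'I_5) g : ev (\row_j (j == k)%:R : 'rV[R]_5) g = (g k)%:~R.
  rewrite /ev (bigD1 k) //= big1 => [|i ik].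
    by rewrite mxE eqxx mul1r addr0.
  by rewrite mxE (negPf ik) mul0r.
have [muz mux muy muf mu1] := ev_mu; have [nuz nux nuy nuf nu1] := ev_nu.
have rowG : [/\ row o0 G = mu, row o1 G = nu, row o2 G = \row_j (j == s o2)%:R,
    row o3 G = \row_j (j == s o3)%:R & row o4 G = \row_j (j == s o4)%:R].
  by split; apply/rowP => j; rewrite !mxE //= !mxE.
case: rowG => G0 G1 G2 G3 G4.
pose e k : seq R := [:: (z k)%:~R; (x k)%:~R; (y k)%:~R; (f k)%:~R; 1].
pose GH (a b : nat) := nth 0 (nth [::] [:: [:: 1; 0; 0; 0; 0];
  [:: 0; 1; 0; 0; 0]; e (s o2); e (s o3); e (s o4)] a) b.
have GHE i j : (G *m coordmx) i j = GH i j.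
  have -> : (G *m coordmx) i j = (row i G *m coordmx) 0 j.
    by rewrite -row_mul [RHS]mxE.
  rewrite mul_coordmx mxE; move: i; apply: ord5P.
  - by rewrite G0 muz mux muy muf mu1; move: j; apply: ord5P.
  - by rewrite G1 nuz nux nuy nuf nu1; move: j; apply: ord5P.
  - by rewrite G2 !evd; move: j; apply: ord5P.
  - by rewrite G3 !evd; move: j; apply: ord5P.
  - by rewrite G4 !evd; move: j; apply: ord5P.
have detGH : `|\det (G *m coordmx)| = `|tdet y f (s o2) (s o3) (s o4)|%:~R.
  rewrite (det_unit_row (k := o0)); last first.
    by move=> j; rewrite GHE; move: j; apply: ord5P.
  rewrite (det_unit_row (k := 0)); last first.
    by move=> j; rewrite !minorE GHE; case: j => [[|[|[|[|j]]]] lt_j].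
  rewrite (det3 (m := fun i j : nat => GH i.+2 j.+2)); last first.
    by move=> i j; rewrite !minorE GHE.
  rewrite /GH /= intr_norm /tdet; congr `|_|; rewrite !(rmorphB, rmorphM) /=; ring.
pose g (a b : nat) := nth 0 (nth [::] [::
  [:: mu 0 (s o0); mu 0 (s o1); mu 0 (s o2); mu 0 (s o3); mu 0 (s o4)];
  [:: nu 0 (s o0); nu 0 (s o1); nu 0 (s o2); nu 0 (s o3); nu 0 (s o4)];
  [:: 0; 0; 1; 0; 0]; [:: 0; 0; 0; 1; 0]; [:: 0; 0; 0; 0; 1]] a) b.
have gE i j : col_perm s G i j = g i j.
  have -> : col_perm s G i j = row i G 0 (s j) by rewrite [LHS]mxE [RHS]mxE.
  move: i; apply: ord5P.
  - by rewrite G0; move: j; apply: ord5P.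
  - by rewrite G1; move: j; apply: ord5P.
  - by rewrite G2 mxE (inj_eq perm_inj); move: j; apply: ord5P.
  - by rewrite G3 mxE (inj_eq perm_inj); move: j; apply: ord5P.
  - by rewrite G4 mxE (inj_eq perm_inj); move: j; apply: ord5P.
have detG : `|\det G| = `|wedge (s o0) (s o1)|.
  have <- : `|\det (col_perm s G)| = `|\det G|.
    by rewrite col_permE det_mulmx det_perm normrM normr_sign mulr1.
  rewrite (det_unit_row (k := o4)); last by move=> j; rewrite gE; move: j; apply: ord5P.
  rewrite (det_unit_row (k := @Ordinal 4 3 isT)); last first.
    by move=> j; rewrite !minorE gE; case: j => [[|[|[|[|j]]]] lt_j].
  rewrite (det_unit_row (k := @Ordinal 3 2 isT)); last first.
    by move=> j; rewrite !minorE gE; case: j => [[|[|[|j]]] lt_j].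
  rewrite (det2 (m := g)); last first.
    by move=> i j; rewrite !minorE gE; case: i => [[|[|i]] ?]; case: j => [[|[|j]] ?].
  by rewrite /g /= /wedge; congr `|_|; ring.
by rewrite -detGH det_mulmx normrM detG mulrC.
Qed.

(** The middle slice. *)
Definition inQ w := [/\ forall i, 0 <= w 0 i, ev w one = 1 & ev w f = 0].

Lemma inQ_convex : convex_set inQ.
Proof.
move=> a b w v a0 b0 ab [w0 w1 wf] [v0 v1 vf]; split.
- by move=> i; rewrite !mxE addr_ge0 ?mulr_ge0.
- by rewrite !evE w1 v1 !mulr1.
- by rewrite !evE wf vf !mulr0 addr0.
Qed.

(** The normalised negative and positive parts of t are points of the simplex
    joined by a vector 2 t / sum |t|. They lie at the same level phi of f, which
    is between -1 and 1; mixing both with a vertex on the other side of f = 0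
    brings them into Q and shortens the chord by a factor 1 + |phi| <= 2. *)
Lemma kernel_chord (t : 'rV[R]_5) (a b : 'I_5) : (forall i, -1 <= f i <= 1) ->
  f a = 1 -> f b = -1 -> ev t one = 0 -> ev t f = 0 -> t != 0 ->
  exists q w w', [/\ inQ w, inQ w', w' = w + q *: t & 1 <= q * \sum_i `|t 0 i|].
Proof.
move=> fb fa fb' t1 tf tN0.
pose A := \sum_i `|t 0 i|.
have A0 : 0 < A.
  rewrite lt_def sumr_ge0 ?andbT // psumr_eq0 //.
  apply: contra tN0 => /allP h; apply/eqP/rowP => i; rewrite mxE.
  by apply/eqP; rewrite -normr_eq0; apply: h; rewrite mem_index_enum.
(* twice the negative part of t, of total weight 1 *)
pose p := \row_i ((`|t 0 i| - t 0 i) / A).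
have p1 : ev p one = 1.
  rewrite ev_one (eq_bigr (fun i => `|t 0 i| / A - t 0 i / A)).
    by rewrite sumrB -!mulr_suml -ev_one t1 mul0r subr0 divff ?gt_eqF.
  by move=> i _; rewrite mxE mulrBl.
have p0 i : 0 <= p 0 i by rewrite mxE divr_ge0 ?subr_ge0 ?ler_norm // ltW.
pose phi := ev p f.
have phib : -1 <= phi <= 1.
  rewrite -p1 /phi /ev; apply/andP; split.
    rewrite -sumrN ler_sum // => i _; rewrite /one mulr1 -mulrN1.
    apply: ler_wpM2l; first exact: p0.
    by rewrite -[-1]/((-1)%:~R) ler_int; case/andP: (fb i).
  rewrite ler_sum // => i _; apply: ler_wpM2l; first exact: p0.
  by rewrite ler_int; case/andP: (fb i).
have main k (e : int) : f k = - e -> 0 <= e%:~R * phi -> `|e%:~R : R| = 1 ->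
    exists q w w', [/\ inQ w, inQ w', w' = w + q *: t & 1 <= q * A].
  move=> fk ephi e1; set r := e%:~R * phi in ephi.
  have r1 : r <= 1.
    rewrite (le_trans (ler_norm _)) // /r normrM e1 mul1r ler_norml.
    by case/andP: phib => -> ->.
  have r0 : 0 < 1 + r by lra.
  have r0' := ltW r0; have A0' := ltW A0.
  pose w := (1 + r)^-1 *: (p + r *: delta_mx 0 k).
  pose q := 2 / (A * (1 + r)).
  have ee : e%:~R * e%:~R = 1 :> R by rewrite -expr2 -real_normK ?num_real // e1 expr1n.
  have A' : A != 0 by rewrite gt_eqF.
  have r' : 1 + r != 0 by rewrite gt_eqF.
  have Qw : inQ w.
    split.
    - move=> i; have := p0 i; rewrite !mxE => p0i.
      apply: mulr_ge0; first by rewrite invr_ge0.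
      by apply: addr_ge0 => //; apply: mulr_ge0; rewrite ?ler0n.
    - by rewrite !evE ev_delta p1 /one mulr1 mulVf.
    - rewrite !evE ev_delta -/phi fk rmorphN /= /r mulrAC mulrN ee mulN1r subrr.
      by rewrite mulr0.
  exists q, w, (w + q *: t); split => //; last first.
    have -> : q * A = 2 / (1 + r) by rewrite /q; field; rewrite A' r'.
    by rewrite ler_pdivlMr //; lra.
  case: Qw => w0 w1 wf; split.
  - move=> i; rewrite !mxE /q.
    have -> : (1 + r)^-1 * ((`|t 0 i| - t 0 i) / A + r * ((0 == 0 :> 'I_1) && (i == k))%:R)
       + 2 / (A * (1 + r)) * t 0 i =
       (1 + r)^-1 * ((`|t 0 i| + t 0 i) / A + r * ((0 == 0 :> 'I_1) && (i == k))%:R).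
      by field; rewrite A' r'.
    apply: mulr_ge0; first by rewrite invr_ge0.
    apply: addr_ge0; last by apply: mulr_ge0; rewrite ?ler0n.
    apply: mulr_ge0; rewrite ?invr_ge0 //.
    by have := lerNnormlW (lexx `|t 0 i|); lra.
  - by rewrite evD w1 evZ t1 mulr0 addr0.
  - by rewrite evD wf evZ tf mulr0 addr0.
have [h|h] := leP 0 phi.
  by apply: (main b 1); rewrite ?mul1r ?normr1.
apply: (main a (-1)); rewrite ?opprK //.
  by rewrite rmorphN /= mulN1r oppr_ge0 ltW.
by rewrite rmorphN /= normrN normr1.
Qed.

(** The chords of Q in direction mu have length at most d, so by
    [kernel_chord] and [large_entry] some entry of mu is at least 1 / (4 d). The
    same holds for the combination t of nu and mu that vanishes at this entry,
    with D. The product of the two entries is a 2 x 2 minor of mu and nu. *)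
Lemma vol5_crude (a b : 'I_5) (d D T : R) :
  (forall i, -1 <= f i <= 1) -> f a = 1 -> f b = -1 ->
  (forall w w' q, inQ w -> inQ w' -> ev w' z = ev w z + q ->
     ev w' x = ev w x -> ev w' y = ev w y -> q <= d) ->
  (forall w w' q, inQ w -> inQ w' -> ev w' x = ev w x + q ->
     ev w' y = ev w y -> q <= D) ->
  (forall k l m, `|tdet y f k l m|%:~R <= T) -> vol5 <= 16 * d * D * T.
Proof.
move=> fb fa fb' hd hD hT.
have [muz mux muy muf mu1] := ev_mu; have [nuz nux nuy nuf nu1] := ev_nu.
have evN0 (t : 'rV[R]_5) (g : 'I_5 -> int) : ev t g = 1 -> t != 0.
  apply: contra_eq_neq => ->; rewrite /ev big1 ?oner_neq0 1?eq_sym ?oner_neq0 //.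
  by move=> i _; rewrite mxE mul0r.
have [q [w [w' [Qw Qw' ww' qA]]]] := kernel_chord fb fa fb' mu1 muf (evN0 _ _ muz).
have qd : q <= d.
  by apply: (hd w w') => //; rewrite ww' !evE ?muz ?mux ?muy ?mulr0 ?mulr1 ?addr0.
have [i hi] := large_entry mu1.
have A0 : 0 <= \sum_j `|mu 0 j| by apply: sumr_ge0.
have [hmu d0] := one_le_chain qA A0 qd hi.
have muiN0 : mu 0 i != 0.
  by apply: contraTneq hmu => ->; rewrite normr0 mulr0 -ltNge ltr01.
pose t := nu - (nu 0 i / mu 0 i) *: mu.
have tx : ev t x = 1 by rewrite !evE nux mux mulr0 subr0.
have ty : ev t y = 0 by rewrite !evE nuy muy mulr0 subr0.
have tf : ev t f = 0 by rewrite !evE nuf muf mulr0 subr0.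
have t1 : ev t one = 0 by rewrite !evE nu1 mu1 mulr0 subr0.
have [q' [v [v' [Qv Qv' vv' qA']]]] := kernel_chord fb fa fb' t1 tf (evN0 _ _ tx).
have qD : q' <= D.
  by apply: (hD v v') => //; rewrite vv' [in LHS]evE ?evZ ?tx ?ty ?mulr0 ?mulr1 ?addr0.
have [j hj] := large_entry t1.
have B0 : 0 <= \sum_j `|t 0 j| by apply: sumr_ge0.
have [ht D0] := one_le_chain qA' B0 qD hj.
have ij : i != j.
  apply: contraTneq ht => <-.
  by rewrite !entriesE divfK // subrr normr0 mulr0 -ltNge ltr01.
have [s [si sj]] := perm5_pair ij.
have wE : `|wedge i j| = `|mu 0 i| * `|t 0 j|.
  by rewrite -normrM; congr `|_|; rewrite !entriesE /wedge; field.
have := vol5_wedge s; rewrite si sj wE => hV.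
have := hT (s o2) (s o3) (s o4); rewrite -hV => hVT.
have h1 : 1 <= (4 * d * `|mu 0 i|) * (4 * D * `|t 0 j|).
  exact: mulr_ege1.
have dD0 : 0 <= d * D by rewrite mulr_ge0 ?ltW.
have V0 : 0 <= vol5 by apply: normr_ge0.
have h2 : d * D * (vol5 * (`|mu 0 i| * `|t 0 j|)) <= d * D * T by apply: ler_wpM2l.
have h3 : vol5 * 1 <= vol5 * ((4 * d * `|mu 0 i|) * (4 * D * `|t 0 j|)).
  by apply: ler_wpM2l.
lra.
Qed.

(** Ratio test of the simplex method. *)
Lemma move_to_facet w (t : 'rV[R]_5) i0 : (forall i, 0 <= w 0 i) -> t 0 i0 < 0 ->
  exists c i, [/\ 0 <= c, t 0 i < 0, (w + c *: t) 0 i = 0,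
    forall j, 0 <= (w + c *: t) 0 j & (positive w -> 0 < c)].
Proof.
move=> w0 ti0.
have [i ti hi] : exists2 i, t 0 i < 0 &
    forall j, t 0 j < 0 -> w 0 i / - t 0 i <= w 0 j / - t 0 j.
  case: (@arg_minP _ _ _ i0 (fun i => t 0 i < 0) (fun i => w 0 i / - t 0 i) ti0) => i ti hi.
  by exists i.
have ti' : 0 < - t 0 i by rewrite oppr_gt0.
have c0 : 0 <= w 0 i / - t 0 i by rewrite divr_ge0 // ltW.
exists (w 0 i / - t 0 i), i; split=> //.
- by rewrite !entriesE invrN mulrN mulNr divfK ?subrr // lt_eqF.
- move=> j; rewrite !entriesE.
  have [tj|tj] := leP 0 (t 0 j); first by apply: addr_ge0 => //; apply: mulr_ge0.
  have tj' : 0 < - t 0 j by rewrite oppr_gt0.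
  have := hi j tj; rewrite ler_pdivlMr //; lra.
- by move=> wp; rewrite divr_gt0.
Qed.

(** Within a row, first decrease x until some coordinate i vanishes, then move
    in the direction that keeps coordinate i and does not increase x. The end
    point is a vertex of the row, with two vanishing coordinates. *)
Lemma vertex_move w : inQ w -> positive w -> exists w' (s : 'S_5),
  [/\ inQ w', ev w' y = ev w y, ev w' x < ev w x,
      w' 0 (s o0) = 0 /\ w' 0 (s o1) = 0 & wedge (s o0) (s o1) != 0].
Proof.
move=> [w0 w1 wf] wp.
have [muz mux muy muf mu1] := ev_mu; have [nuz nux nuy nuf nu1] := ev_nu.
have neg t : ev t one = 0 -> t != 0 -> exists i, t 0 i < 0.
  move=> t1 tN0; have [/existsP//|/existsPn h] := boolP [exists i, t 0 i < 0].
  case/eqP: tN0; apply/rowP => i; rewrite mxE.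
  have h0 j : 0 <= t 0 j by rewrite leNgt; exact: h.
  move/eqP: t1; rewrite ev_one psumr_eq0 // => /allP /(_ i).
  by rewrite mem_index_enum => /(_ isT) /eqP.
have [i0 hi0] : exists i, (- nu : 'rV[R]_5) 0 i < 0.
  apply: neg; first by rewrite -scaleN1r evZ nu1 mulr0.
  rewrite oppr_eq0; apply/eqP => n0; move: nux; rewrite n0 /ev big1 => [/eqP|i _].
    by rewrite eq_sym oner_eq0.
  by rewrite mxE mul0r.
have [c [i [c0 ti wi wc cp]]] := move_to_facet w0 hi0.
set v := w + c *: - nu in wi wc.
have nui : 0 < nu 0 i by move: ti; rewrite entriesE oppr_lt0.
have vE g : ev v g = ev w g - c * ev nu g by rewrite !evE -scaleN1r evZ; ring.
pose th := mu 0 i *: nu - nu 0 i *: mu.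
have thi : th 0 i = 0 by rewrite !entriesE mulrC subrr.
have [e [e0 ex]] : exists e : R, e != 0 /\ e * ev th x <= 0.
  have [h|h] := leP (ev th x) 0; first by exists 1; rewrite oner_eq0 mul1r.
  by exists (-1); rewrite oppr_eq0 oner_eq0 mulN1r oppr_le0 ltW.
have thN0 : e *: th != 0.
  rewrite scaler_eq0 negb_or e0; apply/eqP => th0.
  have : ev th z = 0 by rewrite th0 /ev big1 // => j _; rewrite mxE mul0r.
  by rewrite /th !evE nuz muz mulr0 mulr1 sub0r => /eqP; rewrite oppr_eq0 gt_eqF.
have [j0 hj0] : exists j, (e *: th) 0 j < 0.
  by apply: neg => //; rewrite /th !evE nu1 mu1; ring.
have [c' [j [c'0 tj wj wc' _]]] := move_to_facet wc hj0.
set v' := v + c' *: (e *: th) in wj wc'.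
have v'E g : ev v' g = ev v g + c' * (e * ev th g) by rewrite !evE.
have ij : i != j.
  by apply: contraTneq tj => <-; rewrite entriesE thi mulr0 ltxx.
have [s [si sj]] := perm5_pair ij.
exists v', s; rewrite si sj; split.
- split=> //.
    by rewrite v'E vE nu1 w1 /th !evE nu1 mu1; ring.
  by rewrite v'E vE nuf wf /th !evE nuf muf; ring.
- by rewrite v'E vE nuy /th !evE nuy muy; ring.
- rewrite v'E vE nux; have := cp wp => cp'.
  have : c' * (e * ev th x) <= 0 by rewrite mulr_ge0_le0.
  lra.
- by split=> //; rewrite /v' rowDE wi !rowZE thi !mulr0 addr0.
- apply: contraTneq tj; rewrite /wedge => h.
  by rewrite rowZE /th rowBE !rowZE (mulrC (nu 0 i)) h mulr0 ltxx.
Qed.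

(** Cramer's rule for the point with y = r and f = 0 of a triangle. *)
Lemma support_integrality w (s : 'S_5) (r : int) : inQ w -> ev w y = r%:~R ->
  w 0 (s o0) = 0 -> w 0 (s o1) = 0 ->
  ev w x * (tdet y f (s o2) (s o3) (s o4))%:~R \is a Num.int.
Proof.
move=> [w0 w1 wf] wy wi wj.
have E g : ev w g = w 0 (s o2) * (g (s o2))%:~R + w 0 (s o3) * (g (s o3))%:~R
    + w 0 (s o4) * (g (s o4))%:~R.
  by rewrite /ev (sum5_perm s) wi wj !mul0r !add0r.
move: w1 wf wy; rewrite !E /one !mulr1.
set k := s o2; set l := s o3; set m := s o4.
move=> w1 wf wy.
have wk : w 0 k = 1 - w 0 l - w 0 m by lra.
have -> : (w 0 k * (x k)%:~R + w 0 l * (x l)%:~R + w 0 m * (x m)%:~R) *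
    (tdet y f k l m)%:~R =
    (x k * ((y l - r) * f m - (y m - r) * f l)
   + x l * ((y m - r) * f k - (y k - r) * f m)
   + x m * ((y k - r) * f l - (y l - r) * f k))%:~R.
  rewrite /tdet !(rmorphB, rmorphD, rmorphM) /= -wy.
  (* f vanishes at w, so it may be added to make the identity polynomial *)
  have fm : forall A B : R, A * (f m)%:~R - B * (f l)%:~R = A * ((f m)%:~R -
     (w 0 k * (f k)%:~R + w 0 l * (f l)%:~R + w 0 m * (f m)%:~R)) - B * ((f l)%:~R -
     (w 0 k * (f k)%:~R + w 0 l * (f l)%:~R + w 0 m * (f m)%:~R)).
    by move=> A B; rewrite wf !subr0.
  have fk : forall A B : R, A * (f k)%:~R - B * (f m)%:~R = A * ((f k)%:~R -
     (w 0 k * (f k)%:~R + w 0 l * (f l)%:~R + w 0 m * (f m)%:~R)) - B * ((f m)%:~R -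
     (w 0 k * (f k)%:~R + w 0 l * (f l)%:~R + w 0 m * (f m)%:~R)).
    by move=> A B; rewrite wf !subr0.
  have fl : forall A B : R, A * (f l)%:~R - B * (f k)%:~R = A * ((f l)%:~R -
     (w 0 k * (f k)%:~R + w 0 l * (f l)%:~R + w 0 m * (f m)%:~R)) - B * ((f k)%:~R -
     (w 0 k * (f k)%:~R + w 0 l * (f l)%:~R + w 0 m * (f m)%:~R)).
    by move=> A B; rewrite wf !subr0.
  rewrite fm fk fl wk; ring.
exact: intr_int.
Qed.

(** The vertex of the row found by [vertex_move] has x-coordinate in
    Z / D with |D| <= T. *)
Lemma row_gap w (r : int) (T : R) : (forall k l m, `|tdet y f k l m|%:~R <= T) ->
  inQ w -> positive w -> ev w x \is a Num.int -> ev w y = r%:~R -> 0 < T ->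
  exists w', [/\ inQ w', ev w' y = r%:~R & ev w' x <= ev w x - T^-1].
Proof.
move=> hT Qw wp wx wy T0.
have [w' [s [Qw' w'y w'x [wi wj] wN0]]] := vertex_move Qw wp.
exists w'; split=> //; first by rewrite w'y.
have w'r : ev w' y = r%:~R by rewrite w'y.
have := support_integrality Qw' w'r wi wj.
set D := tdet _ _ _ _ _ => hD.
have DT : `|D|%:~R <= T by apply: hT.
have D0 : (0 : R) < `|D|%:~R.
  by rewrite /D -vol5_wedge; apply: mulr_gt0 => //; rewrite normr_gt0.
have hI : (ev w x - ev w' x) * D%:~R \is a Num.int.
  by rewrite mulrBl rpredB // rpredM // intr_int.
have : 1 <= `|(ev w x - ev w' x) * D%:~R|.
  rewrite norm_intr_ge1 // mulf_neq0 //; first by rewrite subr_eq0 gt_eqF.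
  by move: D0; rewrite intr_norm normr_gt0.
rewrite normrM gtr0_norm ?subr_gt0 // -intr_norm => h.
have : 1 <= (ev w x - ev w' x) * T.
  by apply: (le_trans h); rewrite ler_pM2l ?subr_gt0.
rewrite -ler_pdivrMr // div1r; lra.
Qed.

(** In the frame (mu, nu) of the row plane the edges u - w and v - w have
    coordinates given by z and x, and their barycentric coordinates at s o0 and
    s o1 are explicit; [vol5_wedge] compares the two determinants. *)
Lemma vol5_cross (s : 'S_5) (w u v : 'rV[R]_5) (r : R) :
  inQ w -> inQ u -> inQ v -> ev w y = r -> ev u y = r -> ev v y = r ->
  w 0 (s o0) = 0 -> w 0 (s o1) = 0 -> u 0 (s o1) = 0 -> v 0 (s o0) = 0 ->
  vol5 * (u 0 (s o0) * v 0 (s o1)) =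
  `|tdet y f (s o2) (s o3) (s o4)|%:~R * `|cross z x w u v|.
Proof.
move=> [w0 w1 wf] [u0 u1 uf] [v0 v1 vf] wy uy vy wi wj uj vi.
have hu : u - w = ev (u - w) z *: mu + ev (u - w) x *: nu.
  by apply: kernel_span; rewrite evB ?uy ?uf ?u1 ?wy ?wf ?w1 subrr.
have hv : v - w = ev (v - w) z *: mu + ev (v - w) x *: nu.
  by apply: kernel_span; rewrite evB ?vy ?vf ?v1 ?wy ?wf ?w1 subrr.
have ui : u 0 (s o0) = ev (u - w) z * mu 0 (s o0) + ev (u - w) x * nu 0 (s o0).
  by have /rowP/(_ (s o0)) := hu; rewrite !entriesE wi subr0.
have uj' : 0 = ev (u - w) z * mu 0 (s o1) + ev (u - w) x * nu 0 (s o1).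
  by have /rowP/(_ (s o1)) := hu; rewrite !entriesE wj uj subr0.
have vi' : 0 = ev (v - w) z * mu 0 (s o0) + ev (v - w) x * nu 0 (s o0).
  by have /rowP/(_ (s o0)) := hv; rewrite !entriesE wi vi subr0.
have vj : v 0 (s o1) = ev (v - w) z * mu 0 (s o1) + ev (v - w) x * nu 0 (s o1).
  by have /rowP/(_ (s o1)) := hv; rewrite !entriesE wj subr0.
have <- : `|u 0 (s o0) * v 0 (s o1)| = u 0 (s o0) * v 0 (s o1).
  by rewrite ger0_norm // mulr_ge0.
rewrite -vol5_wedge -mulrA; congr (_ * _); rewrite -normrM; congr `|_|.
have -> : u 0 (s o0) * v 0 (s o1) = u 0 (s o0) * v 0 (s o1) - 0 * 0 by ring.
rewrite {1}uj' vi' ui vj /wedge /cross !evB; ring.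
Qed.

End Simplex.

(** * The finite check of vertex configurations *)

Section IntegerCheck.
Local Open Scope Z_scope.

(** The check is done with Z and its boolean tests, which evaluate much faster
    than int; a point is a pair (y, f). *)
Definition zpt := (Z * Z)%type.

Definition ztd (a b c : zpt) : Z :=
  (b.1 - a.1) * (c.2 - a.2) - (c.1 - a.1) * (b.2 - a.2).

(** Fractions n / e; those with e <= 0 stand for infinity. *)
Definition ratio_min (a b : Z * Z) : Z * Z :=
  if b.2 <=? 0 then a else if a.2 <=? 0 then b
  else if a.1 * b.2 <=? b.1 * a.2 then a else b.

Definition step_ok (Nk Nl Nm Ek El Em : Z) (ne : Z * Z) : bool :=
  if 0 <? ne.2 then
  if ne.1 * Ek <=? Nk * ne.2 then
  if ne.1 * El <=? Nl * ne.2 then ne.1 * Em <=? Nm * ne.2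
  else false else false else false.

(** A fraction that bounds the chords of row r when row j contains an interior
    point of integral x; a and b are twice the ends of the range of y, so that
    1 + 2 (b - a) is 1 + 4 W. *)
Definition growth (a b j r : Z) : Z * Z :=
  if j <=? r then ((1 + 2 * (b - a)) * (2 * r - a), 2 * j - a)
  else ((1 + 2 * (b - a)) * (b - 2 * r), b - 2 * j).

(** The point (r, 0) has coordinates N / D in the triangle k l m, and i, i'
    have coordinates E / D, E' / D. Replacing part of the triangle by the vertex
    i is possible up to the weight n / e, the least ratio N / E, and similarly
    for i'. The last test says |tdet| B^2 / (B - 1) <= 5184 (n / e) (n' / e')
    with B = B.1 / B.2 and denominators cleared. *)
Definition cert (a b j r : Z) (i i' k l m : zpt) : bool :=
  let p := (r, 0) in
  let D0 := ztd k l m in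
  if D0 =? 0 then false else
  let g := Z.sgn D0 in
  let D := g * D0 in
  let Nk := g * ztd p l m in
  let Nl := g * ztd k p m in
  let Nm := g * ztd k l p in
  if Nk <? 0 then false else if Nl <? 0 then false else
  if Nm <? 0 then false else
  let Ek := g * ztd i l m in let El := g * ztd k i m in
  let Em := g * ztd k l i in
  let Ek' := g * ztd i' l m in let El' := g * ztd k i' m in
  let Em' := g * ztd k l i' in
  let ne := ratio_min (Nk, Ek) (ratio_min (Nl, El) (Nm, Em)) in
  let ne' := ratio_min (Nk, Ek') (ratio_min (Nl, El') (Nm, Em')) in
  if step_ok Nk Nl Nm Ek El Em ne then
  if step_ok Nk Nl Nm Ek' El' Em' ne' then
  let B := growth a b j r in
  if 0 <? ne.1 then if 0 <? ne'.1 then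
  D * B.1 * B.1 * ne.2 * ne'.2 <=?
    5184 * (B.1 - B.2) * B.2 * ne.1 * ne'.1
  else false else false else false else false.

(** Variants of has and all that stop early under call by value, where both
    arguments of a boolean connective are evaluated. *)
Fixpoint zhas (T : Type) (p : T -> bool) (s : seq T) : bool :=
  if s is x :: s' then if p x then true else zhas p s' else false.
Fixpoint zall (T : Type) (p : T -> bool) (s : seq T) : bool :=
  if s is x :: s' then if p x then zall p s' else false else true.

(** The ten ways to choose the two vertices outside the triangle. *)
Definition splits : seq ('I_5 * 'I_5 * 'I_5 * 'I_5 * 'I_5) :=
  [:: (o0, o1, o2, o3, o4); (o0, o2, o1, o3, o4); (o0, o3, o1, o2, o4);
      (o0, o4, o1, o2, o3); (o1, o2, o0, o3, o4); (o1, o3, o0, o2, o4);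
      (o1, o4, o0, o2, o3); (o2, o3, o0, o1, o4); (o2, o4, o0, o1, o3);
      (o3, o4, o0, o1, o2)].

Definition interior_rows (b : Z) : seq Z := [seq r <- [:: 0; 1; 2] | 2 * r <? b].

Definition check_rows (a b : Z) (c : 'I_5 -> zpt) : bool :=
  zall (fun j => zhas (fun r => zhas (fun q : 'I_5 * 'I_5 * 'I_5 * 'I_5 * 'I_5 =>
    let: (i, i', k, l, m) := q in cert a b j r (c i) (c i') (c k) (c l) (c m))
    splits) (interior_rows b)) (interior_rows b).

(** Twice the y-coordinates of the vertices of the slice f = 0 of the planar
    point set. *)
Definition doubled_row (s : seq zpt) : seq Z :=
  [seq 2 * p.1 | p <- s & p.2 =? 0] ++
  [seq p.1 + q.1 | p <- [seq p <- s | p.2 =? 1], q <- [seq q <- s | q.2 =? -1]].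

(** The configurations that violate the normalisation (minimum a of the
    doubled row, lowest point with f = 1 at height 0) or have b - a > 6 are
    accepted without a test. *)
Definition check5 (a : Z) (s : seq zpt) : bool :=
  let d := doubled_row s in
  if zhas (fun p => (p.2 =? 1) && (p.1 =? 0)) s then
  if zhas (fun p => p.2 =? -1) s then
  if zhas (Z.eqb a) d then
  if zall (Z.leb a) d then
  let b := foldr Z.max a d in
  if 6 <? b - a then true else check_rows a b (fun i => nth (0, 0) s i)
  else true else true else true else true.

(** Prunes the enumeration: the doubled row range is within a and a + 6. *)
Definition compatible (a : Z) (p q : zpt) : bool :=
  if p.2 + q.2 =? 0 then
    (a <=? p.1 + q.1) && (p.1 + q.1 <=? a + 6) else true.

(** Enumerates the five points in the order of the list, each point being
    allowed to repeat. *)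
Fixpoint all_multisets (a : Z) (k : nat) (l : seq zpt) (acc : seq zpt) : bool :=
  match k with
  | O => check5 a acc
  | S k' => (fix aux l := match l with
      | [::] => true
      | p :: l' => if (if zall (compatible a p) acc
                       then all_multisets a k' l (p :: acc) else true)
                   then aux l' else false
      end) l
  end.

(** The possible positions at each level once the row range lies between a / 2
    and a / 2 + 3 and the lowest point at level 1 is at height 0. *)
Definition points (a : Z) : seq zpt :=
  [seq (y, 1) | y <- [:: 0; 1; 2; 3; 4; 5; 6]] ++
  [seq (a + y, -1) | y <- [:: 0; 1; 2; 3; 4; 5; 6]] ++
  [seq (y, 0) | y <- [:: -1; 0; 1; 2; 3]].

Lemma configurations_checked :
  all_multisets (-1) 5 (points (-1)) [::] && all_multisets (-2) 5 (points (-2)) [::].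
Proof. by vm_compute. Qed.

End IntegerCheck.

Section Soundness.
Variable R : realType.

Definition ZR (n : Z) : R := (int_of_Z n)%:~R.

Lemma ZR_sub m n : ZR (Z.sub m n) = ZR m - ZR n.
Proof. by rewrite /ZR -rmorphB; congr (_%:~R); exact: (rmorphB int_of_Z). Qed.

Lemma ZR_mul m n : ZR (Z.mul m n) = ZR m * ZR n.
Proof. by rewrite /ZR -rmorphM; congr (_%:~R); exact: (rmorphM int_of_Z). Qed.

Lemma ZR_int (n : int) : ZR (Z_of_int n) = n%:~R.
Proof. by rewrite /ZR Z_of_intK. Qed.

Lemma ZR_le m n : Z.le m n -> ZR m <= ZR n.
Proof. by move=> mn; rewrite /ZR ler_int; lia. Qed.

Lemma ZR_lt m n : Z.lt m n -> ZR m < ZR n.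
Proof. by move=> mn; rewrite /ZR ltr_int; lia. Qed.

(** Barycentric coordinates listed in the order s o0, ..., s o4. *)
Definition place (s : 'S_5) (v : seq R) : 'rV[R]_5 := \row_i nth 0 v (s^-1 i)%g.

Lemma placeE s v k : place s v 0 (s k) = nth 0 v k.
Proof. by rewrite mxE permK. Qed.

Lemma ev_place s v (g : 'I_5 -> int) : ev (place s v) g =
  nth 0 v 0 * (g (s o0))%:~R + nth 0 v 1 * (g (s o1))%:~R +
  nth 0 v 2 * (g (s o2))%:~R + nth 0 v 3 * (g (s o3))%:~R +
  nth 0 v 4 * (g (s o4))%:~R.
Proof. by rewrite /ev (sum5_perm s) !placeE. Qed.

Lemma place_ge0 s v : (forall k : 'I_5, 0 <= nth 0 v k) ->
  forall i, 0 <= place s v 0 i.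
Proof. by move=> h i; rewrite mxE. Qed.

(** The affine function is unchanged when weight n / e is given to the new
    vertex and taken from the triangle in proportion to its coordinates E / D. *)
Lemma barycentric_step (D e n Nk Nl Nm Ek El Em q v vk vl vm : R) :
  D != 0 -> e != 0 -> Nk * vk + Nl * vl + Nm * vm = q * D ->
  Ek * vk + El * vl + Em * vm = v * D ->
  n / e * v + (Nk * e - n * Ek) / (D * e) * vk
  + (Nl * e - n * El) / (D * e) * vl + (Nm * e - n * Em) / (D * e) * vm = q.
Proof.
move=> D0 e0 hN hE.
transitivity (n / e * v + ((Nk * vk + Nl * vl + Nm * vm) * e
    - n * (Ek * vk + El * vl + Em * vm)) / (D * e)).
  by field; rewrite D0 e0.
by rewrite hN hE; field; rewrite D0 e0.
Qed.

(** The points w, u, v of row r are the point of the triangle over (r, 0) and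
    its two displacements towards the vertices s o0 and s o1. *)
Lemma cert_sound (y f : 'I_5 -> int) (a b j r : Z) (s : 'S_5) :
  let c i := (Z_of_int (y i), Z_of_int (f i)) in
  cert a b j r (c (s o0)) (c (s o1)) (c (s o2)) (c (s o3)) (c (s o4)) ->
  exists w u v : 'rV[R]_5,
  [/\ [/\ inQ f w, inQ f u & inQ f v],
      [/\ ev w y = ZR r, ev u y = ZR r & ev v y = ZR r],
      [/\ w 0 (s o0) = 0, w 0 (s o1) = 0, u 0 (s o1) = 0 & v 0 (s o0) = 0],
      0 < u 0 (s o0) /\ 0 < v 0 (s o1) &
      `|tdet y f (s o2) (s o3) (s o4)|%:~R * ZR (growth a b j r).1 ^+ 2 <=
      5184 * (ZR (growth a b j r).1 - ZR (growth a b j r).2) *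
        ZR (growth a b j r).2 * (u 0 (s o0) * v 0 (s o1))].
Proof.
move=> c; rewrite /cert; cbv zeta.
set i := s o0; set i' := s o1; set k := s o2; set l := s o3; set m := s o4.
case: ifP => // D0; set g := Z.sgn _.
set D := Z.mul g (ztd (c k) (c l) (c m)).
set Nk := Z.mul g (ztd (r, Z0) (c l) (c m)).
set Nl := Z.mul g (ztd (c k) (r, Z0) (c m)).
set Nm := Z.mul g (ztd (c k) (c l) (r, Z0)).
case: ifP => // Nk0; case: ifP => // Nl0; case: ifP => // Nm0.
set Ek := Z.mul g (ztd (c i) (c l) (c m)).
set El := Z.mul g (ztd (c k) (c i) (c m)).
set Em := Z.mul g (ztd (c k) (c l) (c i)).
set Ek' := Z.mul g (ztd (c i') (c l) (c m)).
set El' := Z.mul g (ztd (c k) (c i') (c m)).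
set Em' := Z.mul g (ztd (c k) (c l) (c i')).
case: (ratio_min _ _) => n e; case: (ratio_min _ _) => n' e'.
rewrite /step_ok [(n, e).1]/= [(n, e).2]/= [(n', e').1]/= [(n', e').2]/=.
case: ifP => // ok; case: ifP => // ok'.
case: (growth a b j r) => B1 B2; rewrite [(B1, B2).1]/= [(B1, B2).2]/=.
case: ifP => // n0; case: ifP => // n'0 fin.
move: ok ok'; case: ifP => // e0; case: ifP => // h1; case: ifP => // h2 h3.
case: ifP => // e'0; case: ifP => // h1'; case: ifP => // h2' h3'.
have gg : ZR g * ZR g = 1.
  rewrite -ZR_mul; have -> : Z.mul g g = Z.pos xH by rewrite /g; lia.
  by rewrite /ZR /=.
have Dpos : 0 < ZR D by apply: (@ZR_lt 0); rewrite /D /g; lia.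
have DE : ZR D = `|tdet y f k l m|%:~R.
  have : ZR D = ZR g * (tdet y f k l m)%:~R.
    rewrite /D ZR_mul; congr (_ * _); rewrite /ztd /tdet !(ZR_sub, ZR_mul) /=.
    by rewrite !ZR_int !(intrB, intrM).
  move=> hD; rewrite intr_norm -(gtr0_norm Dpos) hD normrM.
  have -> : `|ZR g| = 1.
    by apply/eqP; rewrite -sqrp_eq1 ?normr_ge0 // real_normK ?num_real // expr2 gg.
  by rewrite mul1r.
have le0 := fun n h => @ZR_le 0 n h.
have lt0 := fun n h => @ZR_lt 0 n h.
have hNk : 0 <= ZR Nk by apply: le0; lia.
have hNl : 0 <= ZR Nl by apply: le0; lia.
have hNm : 0 <= ZR Nm by apply: le0; lia.
have he : 0 < ZR e by apply: lt0; lia.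
have he' : 0 < ZR e' by apply: lt0; lia.
have hn : 0 < ZR n by apply: lt0; lia.
have hn' : 0 < ZR n' by apply: lt0; lia.
have hk : 0 <= ZR Nk * ZR e - ZR n * ZR Ek.
  by rewrite -!ZR_mul -ZR_sub; apply: le0; clear -h1; lia.
have hl : 0 <= ZR Nl * ZR e - ZR n * ZR El.
  by rewrite -!ZR_mul -ZR_sub; apply: le0; clear -h2; lia.
have hm : 0 <= ZR Nm * ZR e - ZR n * ZR Em.
  by rewrite -!ZR_mul -ZR_sub; apply: le0; clear -h3; lia.
have hk' : 0 <= ZR Nk * ZR e' - ZR n' * ZR Ek'.
  by rewrite -!ZR_mul -ZR_sub; apply: le0; clear -h1'; lia.
have hl' : 0 <= ZR Nl * ZR e' - ZR n' * ZR El'.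
  by rewrite -!ZR_mul -ZR_sub; apply: le0; clear -h2'; lia.
have hm' : 0 <= ZR Nm * ZR e' - ZR n' * ZR Em'.
  by rewrite -!ZR_mul -ZR_sub; apply: le0; clear -h3'; lia.
have hfin : ZR D * ZR B1 * ZR B1 * ZR e * ZR e' <=
    5184 * (ZR B1 - ZR B2) * ZR B2 * ZR n * ZR n'.
  have /ZR_le := proj1 (Z.leb_le _ _) fin.
  by rewrite !ZR_mul ZR_sub.
have tE (p q t : zpt) : ZR (ztd p q t) = (ZR q.1 - ZR p.1) * (ZR t.2 - ZR p.2)
    - (ZR t.1 - ZR p.1) * (ZR q.2 - ZR p.2).
  by rewrite /ztd !(ZR_sub, ZR_mul).
have Z0E : ZR Z0 = 0 by [].
have [hN1 hNy hNf] : [/\ ZR Nk * 1 + ZR Nl * 1 + ZR Nm * 1 = 1 * ZR D,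
    ZR Nk * (y k)%:~R + ZR Nl * (y l)%:~R + ZR Nm * (y m)%:~R = ZR r * ZR D &
    ZR Nk * (f k)%:~R + ZR Nl * (f l)%:~R + ZR Nm * (f m)%:~R = 0 * ZR D].
  by split; rewrite /Nk /Nl /Nm /D !ZR_mul !tE /= !ZR_int Z0E; ring.
have [hE1 hEy hEf] : [/\ ZR Ek * 1 + ZR El * 1 + ZR Em * 1 = 1 * ZR D,
    ZR Ek * (y k)%:~R + ZR El * (y l)%:~R + ZR Em * (y m)%:~R =
      (y i)%:~R * ZR D &
    ZR Ek * (f k)%:~R + ZR El * (f l)%:~R + ZR Em * (f m)%:~R =
      (f i)%:~R * ZR D].
  by split; rewrite /Ek /El /Em /D !ZR_mul !tE /= !ZR_int; ring.
have [hE1' hEy' hEf'] : [/\ ZR Ek' * 1 + ZR El' * 1 + ZR Em' * 1 = 1 * ZR D,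
    ZR Ek' * (y k)%:~R + ZR El' * (y l)%:~R + ZR Em' * (y m)%:~R =
      (y i')%:~R * ZR D &
    ZR Ek' * (f k)%:~R + ZR El' * (f l)%:~R + ZR Em' * (f m)%:~R =
      (f i')%:~R * ZR D].
  by split; rewrite /Ek' /El' /Em' /D !ZR_mul !tE /= !ZR_int; ring.
have D0' : ZR D != 0 by rewrite gt_eqF.
have e0' : ZR e != 0 by rewrite gt_eqF.
have e0'' : ZR e' != 0 by rewrite gt_eqF.
have DD := ltW Dpos.
pose w := place s [:: 0; 0; ZR Nk / ZR D; ZR Nl / ZR D; ZR Nm / ZR D].
pose u := place s [:: ZR n / ZR e; 0;
  (ZR Nk * ZR e - ZR n * ZR Ek) / (ZR D * ZR e);
  (ZR Nl * ZR e - ZR n * ZR El) / (ZR D * ZR e);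
  (ZR Nm * ZR e - ZR n * ZR Em) / (ZR D * ZR e)].
pose v := place s [:: 0; ZR n' / ZR e';
  (ZR Nk * ZR e' - ZR n' * ZR Ek') / (ZR D * ZR e');
  (ZR Nl * ZR e' - ZR n' * ZR El') / (ZR D * ZR e');
  (ZR Nm * ZR e' - ZR n' * ZR Em') / (ZR D * ZR e')].
have wE (g' : 'I_5 -> int) q : ZR Nk * (g' k)%:~R + ZR Nl * (g' l)%:~R +
    ZR Nm * (g' m)%:~R = q * ZR D -> ev w g' = q.
  move=> h; rewrite ev_place /=.
  transitivity ((ZR Nk * (g' k)%:~R + ZR Nl * (g' l)%:~R + ZR Nm * (g' m)%:~R)
    / ZR D); first by rewrite /k /l /m; ring.
  by rewrite h mulfK.
have uE (g' : 'I_5 -> int) q : ZR Nk * (g' k)%:~R + ZR Nl * (g' l)%:~R +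
    ZR Nm * (g' m)%:~R = q * ZR D -> ZR Ek * (g' k)%:~R + ZR El * (g' l)%:~R +
    ZR Em * (g' m)%:~R = (g' i)%:~R * ZR D -> ev u g' = q.
  move=> h h'; rewrite ev_place /= mul0r addr0.
  exact: barycentric_step.
have vE (g' : 'I_5 -> int) q : ZR Nk * (g' k)%:~R + ZR Nl * (g' l)%:~R +
    ZR Nm * (g' m)%:~R = q * ZR D -> ZR Ek' * (g' k)%:~R + ZR El' * (g' l)%:~R +
    ZR Em' * (g' m)%:~R = (g' i')%:~R * ZR D -> ev v g' = q.
  move=> h h'; rewrite ev_place /= mul0r add0r.
  exact: barycentric_step.
have De : 0 <= ZR D * ZR e by rewrite mulr_ge0 // ltW.
have De' : 0 <= ZR D * ZR e' by rewrite mulr_ge0 // ltW.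
exists w, u, v; split.
- split; split.
  + by apply: place_ge0; apply: ord5P => //=; apply: divr_ge0.
  + exact: wE.
  + exact: wE.
  + by apply: place_ge0; apply: ord5P => //=; apply: divr_ge0; rewrite // ltW.
  + exact: uE.
  + exact: uE.
  + by apply: place_ge0; apply: ord5P => //=; apply: divr_ge0; rewrite // ltW.
  + exact: vE.
  + exact: vE.
- by split; [apply: wE | apply: uE | apply: vE].
- by split; rewrite placeE.
- by split; rewrite placeE divr_gt0.
- rewrite !placeE /= -DE expr2.
  have ee : 0 < ZR e * ZR e' by rewrite mulr_gt0.
  rewrite -(ler_pM2r ee).
  have -> : 5184 * (ZR B1 - ZR B2) * ZR B2 * (ZR n / ZR e * (ZR n' / ZR e')) *
     (ZR e * ZR e') = 5184 * (ZR B1 - ZR B2) * ZR B2 * ZR n * ZR n'.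
    by field; rewrite e0' e0''.
  by rewrite !mulrA.
Qed.
End Soundness.

Local Arguments Z.mul : simpl never.
Local Arguments Z.add : simpl never.
Local Arguments Z.sub : simpl never.

Lemma zhasE (T : Type) (p : T -> bool) s : zhas p s = has p s.
Proof. by elim: s => //= x s ->; case: (p x). Qed.

Lemma zallE (T : Type) (p : T -> bool) s : zall p s = all p s.
Proof. by elim: s => //= x s ->; case: (p x). Qed.

(** The list q of indices is nondecreasing, and the fixpoint inserts points at
    the head of acc, hence the reversal. *)
Lemma all_multisetsP (a : Z) k l acc (q : seq nat) :
  all_multisets a k l acc -> size q = k -> sorted leq q ->
  all (fun n => n < size l)%N q ->
  let full := [seq nth (Z0, Z0) l n | n <- q] ++ acc in
  {in full &, forall x y, compatible a x y} ->
  check5 a (rev [seq nth (Z0, Z0) l n | n <- q] ++ acc).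
Proof.
elim: k l acc q => [|k IHk] l acc q; first by case: q.
elim: l q => [|p l IHl] [|n q] //.
rewrite -/(all_multisets _ _ _ _) => hall [sq] srt hsz full hcomp.
have {hall} [h1 h2] : (zall (compatible a p) acc ->
    all_multisets a k (p :: l) (p :: acc)) /\ all_multisets a k.+1 l acc.
  move: hall; rewrite /=; case: ifP => // h1 h2; split => // hc.
  by move: h1; rewrite hc.
case: n => [|n] in srt hsz full hcomp *.
  rewrite /= rev_cons cat_rcons; apply: IHk => //.
  - apply: h1; rewrite zallE; apply/allP => x xacc.
    by apply: hcomp; rewrite /full /= inE ?eqxx // mem_cat xacc !orbT.
  - exact: path_sorted srt.
  - move=> x y hx hy; apply: hcomp; rewrite /full /=.
      by move: hx; rewrite !(mem_cat, inE); case/or3P => ->; rewrite ?orbT.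
    by move: hy; rewrite !(mem_cat, inE); case/or3P => ->; rewrite ?orbT.
have pos : all (leq 1) (n.+1 :: q).
  apply/allP => m; rewrite inE => /orP[/eqP -> //|mq].
  have := order_path_min leq_trans srt => /allP /(_ _ mq).
  by apply: leq_trans.
have shift : [seq nth (Z0, Z0) (p :: l) m | m <- n.+1 :: q] =
    [seq nth (Z0, Z0) l m | m <- [seq m.-1 | m <- n.+1 :: q]].
  rewrite -map_comp; apply/eq_in_map => m mq.
  by have /allP /(_ _ mq) := pos; case: m mq.
rewrite shift; apply: IHl => //.
- by rewrite /= size_map sq.
- apply: (homo_sorted (e := leq)) srt.
  by move=> x y; lia.
- rewrite all_map; apply/allP => m mq /=.
  have /allP /(_ _ mq) := hsz; have /allP /(_ _ mq) := pos.
  by case: m mq.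
- by rewrite -shift.
Qed.

Lemma sorted_perm (idx : 'I_5 -> nat) : exists p : 'S_5,
  sorted geq [seq idx (p i) | i <- [:: o0; o1; o2; o3; o4]].
Proof.
pose t := [tuple idx i | i < 5].
have /tuple_permP[p hp] : perm_eq (sort geq t) t by rewrite perm_sort.
exists p.
have -> : [seq idx (p i) | i <- [:: o0; o1; o2; o3; o4]] = sort geq t.
  rewrite hp /= -[RHS]/(map _ (enum 'I_5)).
  have -> : enum 'I_5 = [:: o0; o1; o2; o3; o4].
    apply: (inj_map val_inj); by rewrite val_enum_ord.
  by rewrite /= !tnth_mktuple.
by apply: sort_sorted => x y; rewrite /geq /=; lia.
Qed.

Lemma foldr_maxP (b a : Z) s : b \in s -> all (fun x => Z.leb x b) s ->
  Z.le a b -> foldr Z.max a s = b.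
Proof.
have ub : forall s, all (fun x => Z.leb x b) s -> Z.le a b -> Z.le (foldr Z.max a s) b.
  by elim=> //= x s' IH /andP[/Z.leb_le xb h] ab; have := IH h ab; lia.
elim: s => //= x s IH; rewrite inE => /orP[/eqP <-|bs] /andP[/Z.leb_le xb h] ab.
  by have := ub _ h ab; lia.
by rewrite IH //; lia.
Qed.

Section Configurations.
Variables (y f : 'I_5 -> int).

(** The slice f = 0 of the convex hull in the (y, f)-plane has as vertices the
    points at level 0 and midpoints of points at levels 1 and -1, so a is twice
    the least value of y on it; [row_max] is the greatest. *)
Definition row_min (a : int) :=
  [/\ forall i, f i = 0 -> a <= 2 * y i,
      forall i j, f i = 1 -> f j = -1 -> a <= y i + y j &
      (exists2 i, f i = 0 & a = 2 * y i) \/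
      exists i j, [/\ f i = 1, f j = -1 & a = y i + y j]].

Definition row_max (b : int) :=
  [/\ forall i, f i = 0 -> 2 * y i <= b,
      forall i j, f i = 1 -> f j = -1 -> y i + y j <= b &
      (exists2 i, f i = 0 & b = 2 * y i) \/
      exists i j, [/\ f i = 1, f j = -1 & b = y i + y j]].

Definition zconfig (p : 'S_5) : seq zpt :=
  [seq (Z_of_int (y (p i)), Z_of_int (f (p i))) | i <- [:: o0; o1; o2; o3; o4]].

Lemma mem_zconfig p i : (Z_of_int (y i), Z_of_int (f i)) \in zconfig p.
Proof.
apply/mapP; exists (p^-1 i)%g; rewrite ?permKV //.
by move: (p^-1 i)%g; apply: ord5P.
Qed.

Lemma doubled_rowP p (x : Z) : x \in doubled_row (zconfig p) <->
  (exists2 i, f i = 0 & x = Z_of_int (2 * y i)) \/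
  exists i j, [/\ f i = 1, f j = -1 & x = Z_of_int (y i + y j)].
Proof.
rewrite /doubled_row mem_cat; split.
  case/orP => [/mapP[q]|/allpairsP[[q q']]].
    rewrite mem_filter => /andP[/Z.eqb_eq fq /mapP[i _ qE]] ->.
    by left; exists (p i); move: fq; rewrite qE /=; lia.
  rewrite !mem_filter /= => -[/andP[/Z.eqb_eq fq /mapP[i _ qE]]].
  move=> /andP[/Z.eqb_eq fq' /mapP[i' _ qE']] ->.
  by right; exists (p i), (p i'); split; move: fq fq'; rewrite qE qE' /=; lia.
case=> [[i fi ->]|[i [j [fi fj ->]]]]; apply/orP.
  left; apply/mapP; exists (Z_of_int (y i), Z_of_int (f i)); last by rewrite /=; lia.
  by rewrite mem_filter mem_zconfig andbT /= fi.
right; apply/allpairsP.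
exists ((Z_of_int (y i), Z_of_int (f i)), (Z_of_int (y j), Z_of_int (f j))).
split; last by rewrite /=; lia.
  by rewrite mem_filter; apply/andP; split; [rewrite /= fi | exact: mem_zconfig].
by rewrite mem_filter; apply/andP; split; [rewrite /= fj | exact: mem_zconfig].
Qed.
End Configurations.

(** * From the check to the volume bound *)


(** [growth] over int, as numerator and denominator. *)
Definition grow_num (a b j r : int) : int :=
  (1 + 2 * (b - a)) * (if j <= r then 2 * r - a else b - 2 * r).
Definition grow_den (a b j r : int) : int :=
  if j <= r then 2 * j - a else b - 2 * j.

Section Fine.
Variable R : realType.

(** The volume inequality V s s' <= |tdet| B^2 / (B - 1) with denominators
    cleared, for every pair of displacements in an interior row r. *)
Definition row_bound (V : R) (y f : 'I_5 -> int) (a b j : int) :=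
  forall (s : 'S_5) (r : int) (w u v : 'rV[R]_5), a < 2 * r -> 2 * r < b ->
  inQ f w -> inQ f u -> inQ f v ->
  ev w y = r%:~R -> ev u y = r%:~R -> ev v y = r%:~R ->
  w 0 (s o0) = 0 -> w 0 (s o1) = 0 -> u 0 (s o1) = 0 -> v 0 (s o0) = 0 ->
  V * (u 0 (s o0) * v 0 (s o1)) *
    (((grow_num a b j r)%:~R - (grow_den a b j r)%:~R) * (grow_den a b j r)%:~R)
  <= `|tdet y f (s o2) (s o3) (s o4)|%:~R * (grow_num a b j r)%:~R ^+ 2.

Lemma growthE (a b j r : int) :
  growth (Z_of_int a) (Z_of_int b) (Z_of_int j) (Z_of_int r) =
  (Z_of_int (grow_num a b j r), Z_of_int (grow_den a b j r)).
Proof.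
rewrite /growth /grow_num /grow_den; case: (leP j r) => jr.
  have -> : Z.leb (Z_of_int j) (Z_of_int r) = true by lia.
  by congr pair; lia.
have -> : Z.leb (Z_of_int j) (Z_of_int r) = false by lia.
by congr pair; lia.
Qed.

Lemma perm_of_split q : q \in splits -> exists s : 'S_5,
  q = (s o0, s o1, s o2, s o3, s o4).
Proof.
have /allP h : all (fun q : 'I_5 * 'I_5 * 'I_5 * 'I_5 * 'I_5 =>
    let: (i, j, k, l, m) := q in uniq [:: i; j; k; l; m]) splits by [].
move/h; case: q => [[[[i j] k] l] m] u.
have inj : injective (fun n : 'I_5 => nth i [:: i; j; k; l; m] n).
  move=> n n' /eqP; rewrite nth_uniq ?ltn_ord // => /eqP nn'.
  exact: val_inj.
by exists (perm inj); rewrite !permE.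
Qed.

(** idx is the position of a vertex in the list [points]; sorting the vertices
    by it yields an entry of the enumeration, whose certificate is combined with
    the inequality of [row_bound]. *)
Lemma normalised_bound (V : R) (y f : 'I_5 -> int) (a b j : int) p m :
  (forall i, [\/ f i = 0, f i = 1 | f i = -1]) ->
  a = -1 \/ a = -2 -> f p = 1 -> y p = 0 -> (forall i, f i = 1 -> 0 <= y i) ->
  f m = -1 -> row_min y f a -> row_max y f b -> b - a <= 6 ->
  a < 2 * j -> 2 * j < b -> row_bound V y f a b j -> V <= 5184.
Proof.
move=> ft a12 fp yp ypos fm [hmin0 hmin1 amin] [hmax0 hmax1 bmax] ba aj jb hV.
have ym := hmin1 _ _ fp fm; rewrite yp in ym.
have bm := hmax1 _ _ fp fm; rewrite yp in bm.
(* [points] lists 7 points at level 1, then 7 at level -1, then 5 at level 0 *)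
pose idx i : nat := if f i == 1 then `|y i|%N else
  if f i == -1 then (7 + `|(y i - a)%R|)%N else (14 + `|(y i + 1)%R|)%N.
have idxP i : (idx i < 19)%N /\
    nth (Z0, Z0) (points (Z_of_int a)) (idx i) = (Z_of_int (y i), Z_of_int (f i)).
  rewrite /idx; case: (ft i) => fi; rewrite fi /=.
  - have := hmin0 _ fi; have := hmax0 _ fi => h1 h2.
    have [k [kE k5]] : exists k : nat, y i = k%:Z - 1 /\ (k < 5)%N.
      by exists `|(y i + 1)%R|%N; lia.
    have -> : `|(y i + 1)%R|%N = k by lia.
    rewrite kE; split; first by lia.
    by move: k k5 {kE}; do 5?[case=> //].
  - have h1 := ypos _ fi; have h2 := hmax1 _ _ fi fm.
    have [k [kE k5]] : exists k : nat, y i = k%:Z /\ (k < 7)%N.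
      by exists `|y i|%N; lia.
    have -> : `|y i|%N = k by lia.
    rewrite kE; split; first by lia.
    by move: k k5 {kE}; do 7?[case=> //].
  - have h1 := hmin1 _ _ fp fi; have h2 := hmax1 _ _ fp fi; rewrite yp in h1 h2.
    have [k [kE k5]] : exists k : nat, y i = a + k%:Z /\ (k < 7)%N.
      by exists `|(y i - a)%R|%N; lia.
    have -> : `|(y i - a)%R|%N = k by lia.
    rewrite kE; split; first by lia.
    case: a12 => ->; move: k k5 {kE}; do 7?[case=> //].
have [s0 sorted_s0] := sorted_perm idx.
pose q := rev [seq idx (s0 i) | i <- [:: o0; o1; o2; o3; o4]].
have checked : all_multisets (Z_of_int a) 5 (points (Z_of_int a)) [::].
  by case/andP: configurations_checked => c1 c2; case: a12 => ->.
have pq : rev [seq nth (Z0, Z0) (points (Z_of_int a)) n | n <- q] = zconfig y f s0.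
  rewrite /q map_rev revK -map_comp; apply: eq_map => i /=.
  by have [_ ->] := idxP (s0 i).
have compat : {in zconfig y f s0 &, forall x x', compatible (Z_of_int a) x x'}.
  move=> x x' /mapP[i _ ->] /mapP[i' _ ->]; rewrite /compatible /=.
  case: ifP => // ff.
  have {ff} : [\/ (f (s0 i) = 0) /\ (f (s0 i') = 0),
     (f (s0 i) = 1) /\ (f (s0 i') = -1) | (f (s0 i') = 1) /\ (f (s0 i) = -1)].
    move: ff; case: (ft (s0 i)) => ->; case: (ft (s0 i')) => -> //= _;
    by [apply: Or31|apply: Or32|apply: Or33].
  case=> [[fi fi']|[fi fi']|[fi fi']].
  - have := hmin0 _ fi; have := hmax0 _ fi; have := hmin0 _ fi'; have := hmax0 _ fi'.
    lia.
  - by have := hmin1 _ _ fi fi'; have := hmax1 _ _ fi fi'; lia.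
  - by have := hmin1 _ _ fi fi'; have := hmax1 _ _ fi fi'; lia.
have : check5 (Z_of_int a) (zconfig y f s0).
  have h : [seq nth (Z0, Z0) (points (Z_of_int a)) n | n <- q] =
      rev (zconfig y f s0) by rewrite -pq revK.
  have := all_multisetsP (q := q) checked; rewrite cats0 (cats0 (rev _)) pq; apply => //.
  - by rewrite /q rev_sorted.
  - by rewrite /q all_rev; apply/allP => n /mapP[i _ ->]; case: (idxP (s0 i)).
  - by rewrite h => x x' xs x's; apply: compat; rewrite -mem_rev.
rewrite /check5 !zhasE !zallE.
case: ifP => [_|/hasPn /(_ _ (mem_zconfig y f s0 p))]; last by rewrite fp yp.
case: ifP => [_|/hasPn /(_ _ (mem_zconfig y f s0 m))]; last by rewrite fm.
have da : Z_of_int a \in doubled_row (zconfig y f s0).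
  apply/doubled_rowP; case: amin => [[i fi ->]|[i [i' [fi fi' ->]]]].
    by left; exists i.
  by right; exists i, i'.
have db : Z_of_int b \in doubled_row (zconfig y f s0).
  apply/doubled_rowP; case: bmax => [[i fi ->]|[i [i' [fi fi' ->]]]].
    by left; exists i.
  by right; exists i, i'.
have dbound x : x \in doubled_row (zconfig y f s0) ->
    Z.leb (Z_of_int a) x && Z.leb x (Z_of_int b).
  case/doubled_rowP => [[i fi ->]|[i [i' [fi fi' ->]]]].
    by have := hmin0 _ fi; have := hmax0 _ fi; lia.
  by have := hmin1 _ _ fi fi'; have := hmax1 _ _ fi fi'; lia.
case: ifP => [_|/hasPn /(_ _ da)]; last by rewrite Z.eqb_refl.
case: ifP => [_|/allPn[x /dbound/andP[-> _]] //].
rewrite (@foldr_maxP (Z_of_int b)) //; first last.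
- by lia.
- by apply/allP => x /dbound/andP[].
case: ifP => [|_]; first by clear -ba; lia.
rewrite /check_rows zallE => /allP /(_ (Z_of_int j)).
have rowP (r : int) : (Z_of_int r \in interior_rows (Z_of_int b)) ->
   0 <= r /\ 2 * r < b.
  by rewrite mem_filter !inE; lia.
rewrite mem_filter !inE => /(_ _)/wrap[]; first by lia.
rewrite zhasE => /hasP[r].
have -> : r = Z_of_int (int_of_Z r) by rewrite int_of_ZK.
set r' := int_of_Z r; move/rowP => [r0 rb]; rewrite zhasE.
case/hasP => q' /perm_of_split[s ->].
have cE (k : 'I_5) : nth (Z0, Z0) (zconfig y f s0) (nat_of_ord k) =
  (Z_of_int (y (s0 k)), Z_of_int (f (s0 k))).
  by move: k; apply: ord5P.
rewrite !cE => hc.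
pose t := (s * s0)%g.
have [|w [u [v]]] := @cert_sound R y f (Z_of_int a) (Z_of_int b) (Z_of_int j)
  (Z_of_int r') t; first by rewrite /t !permM.
rewrite growthE !ZR_int => -[[Qw Qu Qv] [wy uy vy] [wi wj uj vi] [ui vj]].
move=> hcert.
have ar : a < 2 * r' by clear - r0 a12; lia.
have hVt := hV t r' w u v ar rb Qw Qu Qv wy uy vy wi wj uj vi.
pose N : R := (grow_num a b j r')%:~R; pose D : R := (grow_den a b j r')%:~R.
have D0 : 0 < D.
  by rewrite /D ltr0z /grow_den; case: ifP => _; clear - aj jb; lia.
have ND : D < N.
  rewrite /N /D ltr_int /grow_den /grow_num; clear - aj jb ar rb.
  by case: ifP => jr; nia.
have uv : 0 < u 0 (t o0) * v 0 (t o1) by rewrite mulr_gt0.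
have P : 0 < u 0 (t o0) * v 0 (t o1) * ((N - D) * D).
  by rewrite !mulr_gt0 // subr_gt0.
rewrite -(ler_pM2r P) [leLHS]mulrA; apply: (le_trans hVt); apply: (le_trans hcert).
rewrite le_eqVlt; apply/orP; left; apply/eqP; ring.
Qed.
End Fine.

(** * The range of y on the middle slice and normalisation *)

Section RowRange.
Variables (R : realType) (y f : 'I_5 -> int).
Implicit Types (w t v : 'rV[R]_5).
Hypothesis f3 : forall i, [\/ f i = 0, f i = 1 | f i = -1].

Lemma arg_min_int (P : pred 'I_5) (g : 'I_5 -> int) i0 : P i0 ->
  exists2 i, P i & forall j, P j -> g i <= g j.
Proof. by move=> Pi0; case: (@arg_minP _ _ _ i0 P g Pi0) => i Pi h; exists i. Qed.

Lemma row_min_exists p m : f p = 1 -> f m = -1 -> exists a, row_min y f a.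
Proof.
move=> fp fm.
have [i /eqP fi hi] := @arg_min_int (fun i => f i == 1) y p (introT eqP fp).
have [j /eqP fj hj] := @arg_min_int (fun i => f i == -1) y m (introT eqP fm).
have pairs i' j' : f i' = 1 -> f j' = -1 -> y i + y j <= y i' + y j'.
  by move=> fi' fj'; apply: lerD; [apply: hi | apply: hj]; apply/eqP.
have [/existsP[k0 k0f]|/existsPn nok] := boolP [exists k, f k == 0].
  have [k /eqP fk hk] := @arg_min_int (fun i => f i == 0) y k0 k0f.
  have zeros i' : f i' = 0 -> y k <= y i' by move=> fi'; apply: hk; apply/eqP.
  have [h|h] := leP (2 * y k) (y i + y j).
    exists (2 * y k); split.
    - by move=> i' /zeros; lia.
    - by move=> i' j' fi' /(pairs _ _ fi'); lia.
    - by left; exists k.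
  exists (y i + y j); split.
  - by move=> i' /zeros; lia.
  - by move=> i' j' fi' /(pairs _ _ fi'); lia.
  - by right; exists i, j.
exists (y i + y j); split.
- by move=> i' fi'; have := nok i'; rewrite fi' eqxx.
- by move=> i' j' fi' /(pairs _ _ fi').
- by right; exists i, j.
Qed.

Lemma row_min_attained a : row_min y f a ->
  exists w : 'rV[R]_5, inQ f w /\ ev w y = a%:~R / 2.
Proof.
have d0 (k i : 'I_5) : (0 : R) <= (delta_mx 0 k : 'rV[R]_5) 0 i.
  by rewrite mxE ler0n.
case=> _ _ [[i fi ->]|[i [j [fi fj ->]]]].
  exists (delta_mx 0 i); rewrite ev_delta intrM mulrAC divff ?mul1r ?pnatr_eq0 //.
  by split=> //; split; rewrite ?ev_delta ?fi.
exists (2^-1 *: delta_mx 0 i + 2^-1 *: delta_mx 0 j); split.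
  split.
  - by move=> k; rewrite !entriesE addr_ge0 ?mulr_ge0 ?invr_ge0 ?ler0n.
  - by rewrite !evE !ev_delta /one; lra.
  - by rewrite !evE !ev_delta fi fj; lra.
by rewrite !evE !ev_delta intrD; lra.
Qed.

(** The lower boundary of the planar hull near f = 0 is supported by a line.
    Passing it through the lowest vertex at level 1 works. *)
Lemma row_min_shear a p m : f p = 1 -> f m = -1 -> row_min y f a ->
  exists c : R, forall i, a%:~R / 2 + c * (f i)%:~R <= (y i)%:~R.
Proof.
move=> fp fm [h0 h1 _].
have [i /eqP fi hi] := @arg_min_int (fun i => f i == 1) y p (introT eqP fp).
exists ((y i)%:~R - a%:~R / 2) => k; case: (f3 k) => fk; rewrite fk.
- by have := h0 _ fk; rewrite -(ler_int R) intrM; lra.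
- by have := hi k; rewrite fk eqxx -(ler_int R) => /(_ isT); lra.
- by have := h1 _ _ fi fk; rewrite -(ler_int R) intrD; lra.
Qed.

Lemma row_min_le a p m w : f p = 1 -> f m = -1 -> row_min y f a ->
  inQ f w -> a%:~R / 2 <= ev w y :> R.
Proof.
move=> fp fm hmin [w0 w1 wf]; have [c hc] := row_min_shear fp fm hmin.
have -> : a%:~R / 2 = \sum_i w 0 i * (a%:~R / 2 + c * (f i)%:~R) :> R.
  have : \sum_i w 0 i * (a%:~R / 2 + c * (f i)%:~R) =
      (a%:~R / 2) * ev w one + c * ev w f.
    rewrite ev_one /ev !mulr_sumr -big_split; apply: eq_bigr => i _ /=; ring.
  by rewrite w1 wf mulr1 mulr0 addr0.
by apply: ler_sum => i _; apply: ler_wpM2l.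
Qed.

(** Equality at a positive point would put all vertices on the supporting
    line, but y is not an affine function of f. *)
Lemma row_min_lt a p m w t : f p = 1 -> f m = -1 -> row_min y f a ->
  inQ f w -> positive w -> ev t y = 1 -> ev t f = 0 -> ev t one = 0 ->
  a%:~R / 2 < ev w y :> R.
Proof.
move=> fp fm hmin Qw wp ty tf t1; rewrite lt_neqAle (row_min_le fp fm hmin Qw) andbT.
have [c hc] := row_min_shear fp fm hmin; case: Qw => w0 w1 wf.
apply/eqP => h.
pose g i : R := (y i)%:~R - (a%:~R / 2 + c * (f i)%:~R).
have evg (v : 'rV[R]_5) : \sum_i v 0 i * g i = ev v y - a%:~R / 2 * ev v one - c * ev v f.
  rewrite ev_one /ev !mulr_sumr -!sumrB; apply: eq_bigr => i _; rewrite /g; ring.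
have : \sum_i w 0 i * g i = 0 by rewrite evg -h w1 wf; ring.
have g0 i : 0 <= w 0 i * g i by rewrite mulr_ge0 ?subr_ge0.
move/eqP; rewrite psumr_eq0 // => /allP hz.
have gz i : g i = 0.
  have := hz i (mem_index_enum _); rewrite mulf_eq0 gt_eqF ?wp //= => /eqP //.
have := evg t; rewrite ty tf t1 big1 => [|i _]; last by rewrite gz mulr0.
by move/eqP; rewrite !mulr0 !subr0 eq_sym oner_eq0.
Qed.

(** Two vertices at level 1 differ by at most b - a, because their midpoints
    with m lie in the row range; similarly at the other levels. *)
Lemma tdet_bound a b p m k l n : f p = 1 -> f m = -1 ->
  row_min y f a -> row_max y f b -> `|tdet y f k l n| <= 2 * (b - a).
Proof.
move=> fp fm [h0 h1 _] [g0 g1 _]; rewrite /tdet ler_norml.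
have bnd i : (f i = 0 -> a <= 2 * y i <= b) /\
   (f i = 1 -> a <= y i + y m <= b) /\ (f i = -1 -> a <= y p + y i <= b).
  split; first by move=> fi; rewrite h0 // g0.
  by split=> fi; rewrite ?h1 ?g1.
have bnd2 i j : f i = 1 -> f j = -1 -> a <= y i + y j <= b.
  by move=> fi fj; rewrite h1 // g1.
have [k0 [k1 k2]] := bnd k; have [l0 [l1 l2]] := bnd l; have [n0 [n1 n2]] := bnd n.
have kl := bnd2 k l; have lk := bnd2 l k; have kn := bnd2 k n.
have nk := bnd2 n k; have ln := bnd2 l n; have nl := bnd2 n l.
clear - f3 k0 k1 k2 l0 l1 l2 n0 n1 n2 kl lk kn nk ln nl.
move: (f3 k) (f3 l) (f3 n) => [] fk [] fl [] fn;
  rewrite ?fk ?fl ?fn in k0 k1 k2 l0 l1 l2 n0 n1 n2 kl lk kn nk ln nl *;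
  clear f3 fk fl fn.
all: lia.
Qed.
End RowRange.

Lemma row_max_opp y f b : row_max y f b <-> row_min (fun i => - y i) f (- b).
Proof.
split=> -[h0 h1 h2]; split.
- by move=> i /h0; lia.
- by move=> i j fi /(h1 _ _ fi); lia.
- case: h2 => [[i fi ->]|[i [j [fi fj ->]]]]; [left | right].
    by exists i => //; lia.
  by exists i, j; split=> //; lia.
- by move=> i /h0; lia.
- by move=> i j fi /(h1 _ _ fi); lia.
- case: h2 => [[i fi hb]|[i [j [fi fj hb]]]]; [left | right].
    by exists i => //; lia.
  by exists i, j; split=> //; lia.
Qed.

(** The substitution y - t - c f, with t a translation and c a shear, changes
    neither areas nor the rows and reaches the normalisation. *)
Lemma configuration_bound (R : realType) (V : R) (y f : 'I_5 -> int) a b j p m :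
  (forall i, [\/ f i = 0, f i = 1 | f i = -1]) -> f p = 1 -> f m = -1 ->
  row_min y f a -> row_max y f b -> b - a <= 6 -> a < 2 * j -> 2 * j < b ->
  row_bound V y f a b j -> V <= 5184.
Proof.
move=> f3 fp fm hmin hmax ba aj jb hV.
have [t ht] : exists t : int, a - 2 * t = -1 \/ a - 2 * t = -2.
  exists ((a + 2) %/ 2)%Z; have := divz_eq (a + 2) 2.
  have := modz_ge0 (a + 2) (isT : (2 : int) != 0).
  have := ltz_pmod (a + 2) (isT : (0 : int) < 2).
  lia.
have [i /eqP fi hi] := @arg_min_int (fun i => f i == 1) y p (introT eqP fp).
pose c := y i - t.
pose y' k := y k - t - c * f k.
have evy' (w : 'rV[R]_5) : inQ f w -> ev w y' = ev w y - t%:~R.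
  case=> _ w1 wf.
  have -> : ev w y' = ev w y - t%:~R * ev w one - c%:~R * ev w f.
    rewrite ev_one /ev !mulr_sumr -!sumrB; apply: eq_bigr => k _.
    by rewrite /y' !(intrB, intrM); ring.
  by rewrite w1 wf mulr1 mulr0 subr0.
have tE k l n : tdet y' f k l n = tdet y f k l n by rewrite /tdet /y'; ring.
apply: (@normalised_bound _ V y' f (a - 2 * t) (b - 2 * t) (j - t) i m) => //.
- by rewrite /y' /c fi; ring.
- by move=> k fk; have := hi k; rewrite fk eqxx /y' /c fk => /(_ isT); lia.
- case: hmin => h0 h1 h2; rewrite /y'; split.
  + by move=> k fk; have := h0 _ fk; rewrite fk; lia.
  + by move=> k l fk fl; have := h1 _ _ fk fl; rewrite fk fl; lia.
  + case: h2 => [[k fk ->]|[k [l [fk fl ->]]]].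
      by left; exists k => //; rewrite fk; lia.
    by right; exists k, l; rewrite fk fl; split => //; lia.
- case: hmax => h0 h1 h2; rewrite /y'; split.
  + by move=> k fk; have := h0 _ fk; rewrite fk; lia.
  + by move=> k l fk fl; have := h1 _ _ fk fl; rewrite fk fl; lia.
  + case: h2 => [[k fk ->]|[k [l [fk fl ->]]]].
      by left; exists k => //; rewrite fk; lia.
    by right; exists k, l; rewrite fk fl; split => //; lia.
- lia.
- lia.
- lia.
move=> s r w u v ar rb Qw Qu Qv wy uy vy wi wj uj vi.
have gn : grow_num (a - 2 * t) (b - 2 * t) (j - t) r = grow_num a b j (r + t).
  rewrite /grow_num; have -> : (j - t <= r) = (j <= r + t) by lia.
  by case: ifP => _; ring.
have gd : grow_den (a - 2 * t) (b - 2 * t) (j - t) r = grow_den a b j (r + t).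
  rewrite /grow_den; have -> : (j - t <= r) = (j <= r + t) by lia.
  by case: ifP => _; ring.
rewrite gn gd tE; apply: (hV s (r + t) w u v) => //.
- lia.
- lia.
- by rewrite intrD -wy evy' // subrK.
- by rewrite intrD -uy evy' // subrK.
- by rewrite intrD -vy evy' // subrK.
Qed.

(** * Numerical consequences of the covering and transfer inequalities *)

(** From d (D W - W - D) <= D W it suffices to show
    (D W)^2 <= 79 (D W - W - D). For fixed W this is a concave condition on D,
    hence follows from the ends of the range
    W / 2.1 <= D <= (25 / 8) W / (W - 1), which also forces W <= 7.51. *)
Lemma wide_bound (R : realFieldType) (d D W : R) : 0 < d -> 0 < D -> 7 / 2 <= W ->
  D <= 21 / 10 * d -> W <= 21 / 10 * D ->
  d * D * W <= D * W + d * W + d * D -> d * D * W <= 79.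
Proof.
move=> d0 D0 W7 Dd WD cov.
have cov' : d * (D * W - W - D) <= D * W by lra.
have W0 : 0 < W by lra.
have DW : 0 < D * W by rewrite mulr_gt0.
have q2 : D * (W - 1) <= 31 / 10 * W.
  have [k0|k0] := leP (D * W - W - D) 0; first by lra.
  have : D * (D * W - W - D) <= D * (21 / 10 * W) by nra.
  by rewrite ler_pM2l; lra.
have W75 : W <= 751 / 100.
  have : W * (W - 1) <= W * (651 / 100) by nra.
  by rewrite ler_pM2l; lra.
have k0 : 0 < D * W - W - D.
  have : W * (W - 1) <= 21 / 10 * (D * (W - 1)) by nra.
  have : 0 < W * (W - 31 / 10) by apply: mulr_gt0; lra.
  lra.
have s0 : 0 <= (W - 7 / 2) * (W - 7 / 2) by apply: mulr_ge0; lra.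
have s1 : 0 <= (W - 7 / 2) * (751 / 100 - W) by apply: mulr_ge0; lra.
have h1 : 0 <= 1659 / 10 * (W - 31 / 10) - W ^+ 3.
  have : 0 <= (W - 7 / 2) * (751 / 100 - W) * (W + 11) by do ?apply: mulr_ge0; lra.
  rewrite !exprS expr0; lra.
have h2 : 0 <= 1343 / 8 * (W - 1) ^+ 2 - 625 / 64 * W ^+ 3.
  have : 0 <= (W - 7 / 2) * (751 / 100 - W) * W by do ?apply: mulr_ge0; lra.
  rewrite !exprS expr0; lra.
have p1 : 0 <= 21 / 10 * D - W by lra.
have p2 : 0 <= 25 / 8 * W - D * (W - 1) by lra.
have S0 : 0 < W * (121 / 16 - W) by apply: mulr_gt0; lra.
have W1 : 0 < W - 1 by lra.
(* G is concave in D; the identity below interpolates it between the ends of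
   the range of D, with weights p1 and p2 *)
pose G := 79 * (D * W - W - D) - (D * W) ^+ 2.
have G0 : 0 <= G.
  suff : 0 <= (21 / 10 * (W - 1) * G) * (W * (121 / 16 - W)).
rewrite (pmulr_lge0 _ S0) pmulr_rge0; [by []|lra].
  have -> : (21 / 10 * (W - 1) * G) * (W * (121 / 16 - W)) =
     W ^+ 2 * (21 / 10 * D - W) * (25 / 8 * W - D * (W - 1)) * (W * (121 / 16 - W))
     + (21 / 10 * D - W) * (21 / 10 * W
        * (1343 / 8 * (W - 1) ^+ 2 - 625 / 64 * W ^+ 3))
     + (25 / 8 * W - D * (W - 1)) * (W - 1) * W
        * (1659 / 10 * (W - 31 / 10) - W ^+ 3).
    by rewrite /G; field.
  apply: addr_ge0; first apply: addr_ge0.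
  - by do ?[apply: mulr_ge0|apply: exprn_ge0]; (assumption || lra).
  - by do ?apply: mulr_ge0; (assumption || lra).
  - by do ?apply: mulr_ge0; (assumption || lra).
have : d * D * W * (D * W - W - D) <= 79 * (D * W - W - D).
  have -> : d * D * W * (D * W - W - D) = D * W * (d * (D * W - W - D)) by ring.
  apply: (@le_trans _ _ ((D * W) ^+ 2)); last by rewrite /G in G0; lra.
  by rewrite expr2 ler_pM2l.
by rewrite ler_pM2r.
Qed.

(** For each of the five values of W: either d is below a threshold c and
    D <= 2.1 d suffices, or d is in [c, 4 W] and the covering inequality bounds
    d D by e d^2 / (k d - e), a convex function of d. *)
Lemma narrow_bound (R : realFieldType) (d D W : R) (n : int) : 0 < d -> 0 < D ->
  2 * W = n%:~R -> 2 <= n <= 6 -> d <= 4 * W ->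
  D <= 21 / 10 * d ->
  d * D * W <= D * W + d * W + d * D -> d * D * W <= 79.
Proof.
move=> d0 D0 Wn n26 dW Dd cov.
have dD0 : 0 < d * D by rewrite mulr_gt0.
have split_at (c q : R) : 0 < c -> d <= c -> 21 / 10 * c * c <= q -> d * D <= q.
  move=> c0 dc; apply: le_trans.
  have : D <= 21 / 10 * c by lra.
  nra.
have large (c e k q : R) : 0 < c -> 0 < e -> (d * D) * k <= e * (d + D) -> e < k * c -> c <= d ->
    e * d * d <= q * (k * d - e) -> d * D <= q.
  move=> c0 e0 h kc cd hq.
  have kd : 0 < k * d - e.
    have k0 : 0 < k by rewrite -(pmulr_lgt0 _ c0); lra.
    have : k * c <= k * d by rewrite ler_pM2l.
    lra.
  have h' : D * (k * d - e) <= e * d by lra.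
  rewrite -(ler_pM2r kd); apply: le_trans hq.
  have : d * (D * (k * d - e)) <= d * (e * d) by rewrite ler_pM2l.
  lra.
have cases (c e k q : R) : 0 < e -> e < k * c -> 0 < c -> (d * D) * k <= e * (d + D) ->
    21 / 10 * c * c <= q -> (c <= d -> e * d * d <= q * (k * d - e)) -> d * D <= q.
  move=> e0 kc c0 h h1 h2; have [dc|cd] := leP d c; first exact: split_at c0 dc h1.
  by apply: (large c e k q c0 e0 h kc); [exact: ltW | apply: h2; exact: ltW].
have Wval : W = n%:~R / 2 by lra.
have {n26} [n2|[n3|[n4|[n5|n6]]]] : n = 2 \/ n = 3 \/ n = 4 \/ n = 5 \/ n = 6 by lia.
- have {Wval} W1 : W = 1 by rewrite Wval n2; lra.
  rewrite W1 mulr1; apply: (split_at 4); lra.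
- have {Wval} W1 : W = 3 / 2 by rewrite Wval n3; lra.
  suff : d * D <= 52 by rewrite W1; lra.
  apply: (cases (9 / 2) 3 1); rewrite W1 in cov; try lra.
  move=> h; have : 0 <= (d - 9 / 2) * (6 - d) by apply: mulr_ge0; lra.
  lra.
- have {Wval} W1 : W = 2 by rewrite Wval n4; lra.
  suff : d * D <= 39 by rewrite W1; lra.
  apply: (cases 4 2 1); rewrite W1 in cov; try lra.
  move=> h; have : 0 <= (d - 4) * (8 - d) by apply: mulr_ge0; lra.
  lra.
- have {Wval} W1 : W = 5 / 2 by rewrite Wval n5; lra.
  suff : d * D <= 31 by rewrite W1; lra.
  apply: (cases (7 / 2) 5 3); rewrite W1 in cov; try lra.
  move=> h; have : 0 <= (d - 7 / 2) * (10 - d) by apply: mulr_ge0; lra.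
  lra.
- have {Wval} W1 : W = 3 by rewrite Wval n6; lra.
  suff : d * D <= 26 by rewrite W1; lra.
  apply: (cases (7 / 2) 3 2); rewrite W1 in cov; try lra.
  move=> h; have : 0 <= (d - 7 / 2) * (12 - d) by apply: mulr_ge0; lra.
  lra.
Qed.

(** * Rows of the slice in an adapted basis *)

Lemma vol5_opp_x (R : realType) z x y f :
  vol5 R z (fun i => - x i) y f = vol5 R z x y f.
Proof.
pose s (j : 'I_5) : R := (-1) ^+ (j == o1).
have -> : vol5 R z (fun i => - x i) y f =
   `|\det (coordmx R z x y f *m diag_mx (\row_j s j))|.
  congr `|\det _|; apply/matrixP => i j; rewrite mul_mx_diag !mxE.
  by move: j; apply: ord5P; rewrite /s /= ?expr0 ?mulr1 // expr1 mulrN1 rmorphN.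
rewrite det_mulmx normrM det_diag normr_prod big1 ?mulr1 // => j _.
by rewrite mxE normr_sign.
Qed.

Section Slice.
Variables (R : realType) (z x y f : 'I_5 -> int).
Implicit Types (w u v : 'rV[R]_5).

Definition inRow (r : int) w := inQ f w /\ ev w y = r%:~R.

Lemma inRow_convex r : convex_set (inRow r).
Proof.
move=> a b w v a0 b0 ab [Qw wr] [Qv vr]; split; first exact: inQ_convex.
by rewrite !evE wr vr -mulrDl ab mul1r.
Qed.

Lemma inQ_nonneg : nonneg_set (@inQ R f).
Proof. by move=> w i []. Qed.

Lemma inRow_nonneg r : nonneg_set (inRow r).
Proof. by move=> w i [[]]. Qed.

Hypothesis f3 : forall i, [\/ f i = 0, f i = 1 | f i = -1].
Variables (p m : 'I_5) (a b j : int).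
Hypotheses (fp : f p = 1) (fm : f m = -1).
Hypotheses (hmin : row_min y f a) (hmax : row_max y f b).
Hypothesis V0 : 0 < vol5 R z x y f.
Hypothesis hollow : forall w, inQ f w -> positive w -> ev w z \is a Num.int ->
  ev w x \is a Num.int -> ev w y \is a Num.int -> False.
Variable w0 : 'rV[R]_5.
Hypotheses (Qw0 : inQ f w0) (pw0 : positive w0).
Hypotheses (xw0 : ev w0 x \is a Num.int) (yw0 : ev w0 y = j%:~R).
Hypotheses (aj : a < 2 * j) (jb : 2 * j < b).

Let A : R := (2 * (b - a))%:~R.

Let A_gt0 : 0 < A. Proof. by rewrite /A ltr0z; lia. Qed.

Let tdetA k l n : `|tdet y f k l n|%:~R <= A.
Proof. by rewrite /A ler_int; exact: (tdet_bound f3 _ _ _ fp fm hmin hmax). Qed.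

Let hollow_inRow r : hollow_row (inRow r) z x.
Proof.
move=> t [Qt tr] pt tz tx; apply: (hollow Qt pt tz tx).
by rewrite tr intr_int.
Qed.

(** Both ends of row j are at distance at least 1 / A from the lattice line
    through w0; for the right end the argument is applied to - x. *)
Lemma lattice_row_chord c : is_chord (inRow j) z x c -> c <= 1 + A.
Proof.
have [l [Ql ly lx]] := row_gap V0 tdetA Qw0 pw0 xw0 yw0 A_gt0.
have V0' : 0 < vol5 R z (fun i => - x i) y f by rewrite vol5_opp_x.
have xw0' : ev w0 (fun i => - x i) \is a Num.int by rewrite ev_opp rpredN.
have [r [Qr ry rx]] := row_gap V0' tdetA Qw0 pw0 xw0' yw0 A_gt0.
move=> /(@row_chord _ (inRow j) z x w0 l r c A^-1) h.
rewrite -[A]invrK; apply: h => //.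
- exact: inRow_convex.
- exact: inRow_nonneg.
- by rewrite invr_gt0.
- by move: rx; rewrite !ev_opp; lra.
Qed.

Let attained_min : exists wa : 'rV[R]_5, inQ f wa /\ ev wa y = a%:~R / 2.
Proof. exact: row_min_attained hmin. Qed.

Let attained_max : exists wb : 'rV[R]_5, inQ f wb /\ ev wb y = b%:~R / 2.
Proof.
have [w [Qw wy]] := row_min_attained R ((row_max_opp _ _ _).1 hmax).
exists w; split=> //; move: wy; rewrite ev_opp intrN; lra.
Qed.

Lemma mix_row (r r' : int) (e : R) (t w : 'rV[R]_5) : 0 <= e <= 1 -> inQ f t ->
  inRow r w -> e * r%:~R + (1 - e) * ev t y = r'%:~R ->
  inRow r' (e *: w + (1 - e) *: t).
Proof.
move=> /andP[e0 e1] Qt [Qw wr] h; split; last by rewrite !evE wr.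
by apply: inQ_convex => //; lra.
Qed.

(** Coning from a point t of the slice maps row r into row r' and scales
    chords by e. *)
Lemma mix_chord (r r' : int) (e : R) (t : 'rV[R]_5) c : 0 < e <= 1 -> inQ f t ->
  e * r%:~R + (1 - e) * ev t y = r'%:~R -> is_chord (inRow r) z x c ->
  is_chord (inRow r') z x (e * c).
Proof.
move=> /andP[e0 e1] Qt h [c0 [v [v' [Rv Rv' vz vx]]]].
split; first exact: mulr_gt0.
exists (e *: v + (1 - e) *: t), (e *: v' + (1 - e) *: t); split.
- by apply: mix_row h => //; rewrite e1 ltW.
- by apply: mix_row h => //; rewrite e1 ltW.
- by rewrite !evE vz; ring.
- by rewrite !evE vx.
Qed.

Let ratio (c d : int) : R := c%:~R / d%:~R.

(** Coning a chord of row r towards the end of the range of y beyond row j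
    gives a chord of row j. *)
Lemma row_chord_bound r c : a < 2 * r -> 2 * r < b -> is_chord (inRow r) z x c ->
  c * (grow_den a b j r)%:~R <= (grow_num a b j r)%:~R.
Proof.
move=> ar rb hc; rewrite /grow_den /grow_num.
have AE : (1 + 2 * (b - a))%:~R = 1 + A by rewrite intrD.
case: ifP => jr.
  have [wa [Qa ya]] := attained_min.
  have r0 : (0 : R) < (2 * r - a)%:~R by rewrite ltr0z; lia.
  have e0 : (0 : R) < (2 * j - a)%:~R by rewrite ltr0z; lia.
  have je : (2 * j - a)%:~R <= (2 * r - a)%:~R :> R by rewrite ler_int; lia.
  have hm : 0 < ratio (2 * j - a) (2 * r - a) <= 1.
    by rewrite /ratio divr_gt0 // ler_pdivrMr // mul1r.
  have := @mix_chord r j _ wa c hm Qa _ hc; rewrite ya /ratio => /(_ _)/wrap[].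
    move: r0; rewrite !(intrB, intrM) => r0; field; rewrite gt_eqF //; lra.
  move=> /lattice_row_chord; rewrite mulrAC ler_pdivrMr // intrM AE; lra.
have [wb [Qb yb]] := attained_max.
have r0 : (0 : R) < (b - 2 * r)%:~R by rewrite ltr0z; lia.
have e0 : (0 : R) < (b - 2 * j)%:~R by rewrite ltr0z; lia.
have je : (b - 2 * j)%:~R <= (b - 2 * r)%:~R :> R by rewrite ler_int; lia.
have hm : 0 < ratio (b - 2 * j) (b - 2 * r) <= 1.
  by rewrite /ratio divr_gt0 // ler_pdivrMr // mul1r.
have := @mix_chord r j _ wb c hm Qb _ hc; rewrite yb /ratio => /(_ _)/wrap[].
  move: r0; rewrite !(intrB, intrM) => r0; field; rewrite gt_eqF //; lra.
move=> /lattice_row_chord; rewrite mulrAC ler_pdivrMr // intrM AE; lra.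
Qed.

Lemma row_positive r : a < 2 * r -> 2 * r < b ->
  exists w : 'rV[R]_5, inRow r w /\ positive w.
Proof.
move=> ar rb.
have R0 : inRow j w0 by split.
have [jr|rj] := leP j r.
  have [wb [Qb yb]] := attained_max.
  have r0 : (0 : R) < (b - 2 * r)%:~R by rewrite ltr0z; lia.
  have e0 : (0 : R) < (b - 2 * j)%:~R by rewrite ltr0z; lia.
  have je : (b - 2 * r)%:~R <= (b - 2 * j)%:~R :> R by rewrite ler_int; lia.
  pose e := ratio (b - 2 * r) (b - 2 * j).
  have e01 : 0 < e <= 1 by rewrite /e /ratio divr_gt0 // ler_pdivrMr // mul1r.
  case/andP: (e01) => ep e1.
  exists (e *: w0 + (1 - e) *: wb); split.
    apply: (mix_row (r := j)) => //; first by rewrite e1 ltW.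
    by rewrite yb /e /ratio; move: e0; rewrite !(intrB, intrM) => e0; field; rewrite gt_eqF //; lra.
  by apply: positive_mix => //; [case: Qb | lra].
have [wa [Qa ya]] := attained_min.
have r0 : (0 : R) < (2 * r - a)%:~R by rewrite ltr0z; lia.
have e0 : (0 : R) < (2 * j - a)%:~R by rewrite ltr0z; lia.
have je : (2 * r - a)%:~R <= (2 * j - a)%:~R :> R by rewrite ler_int; lia.
pose e := ratio (2 * r - a) (2 * j - a).
have e01 : 0 < e <= 1 by rewrite /e /ratio divr_gt0 // ler_pdivrMr // mul1r.
case/andP: (e01) => ep e1.
exists (e *: w0 + (1 - e) *: wa); split.
  apply: (mix_row (r := j)) => //; first by rewrite e1 ltW.
  by rewrite ya /e /ratio; move: e0; rewrite !(intrB, intrM) => e0; field; rewrite gt_eqF //; lra.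
by apply: positive_mix => //; [case: Qa | lra].
Qed.

(** Coning the longest chord of Q towards an end of the range of y. *)
Lemma row_long_chord r v v' d : a < 2 * r -> 2 * r < b -> inQ f v -> inQ f v' ->
  ev v' z = ev v z + d -> ev v' x = ev v x -> ev v' y = ev v y ->
  2 * (b - a)%:~R <= d -> exists2 c, is_chord (inRow r) z x c & 2 <= c.
Proof.
move=> ar rb Qv Qv' vz vx vy bd.
have ab : (0 : R) < (b - a)%:~R by rewrite ltr0z; lia.
have va := row_min_le f3 fp fm hmin Qv.
have vb : ev v y <= b%:~R / 2.
  have := row_min_le f3 fp fm ((row_max_opp _ _ _).1 hmax) Qv.
  by rewrite ev_opp intrN; lra.
have main (t : 'rV[R]_5) (e : R) : inQ f t -> (b - a)%:~R^-1 <= e <= 1 ->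
    e * ev v y + (1 - e) * ev t y = r%:~R ->
    exists2 c, is_chord (inRow r) z x c & 2 <= c.
  move=> Qt /andP[eb e1] h.
  have i0 : 0 < (b - a)%:~R^-1 :> R by rewrite invr_gt0.
  have ep : 0 < e by lra.
  have ce : 2 <= e * d.
    have : (b - a)%:~R^-1 * (2 * (b - a)%:~R) <= e * d.
      by apply: ler_pM => //; rewrite ?ltW // mulr_gt0.
    by rewrite mulrCA mulVf ?mulr1 // gt_eqF.
  exists (e * d) => //; split; first by lra.
  exists (e *: v + (1 - e) *: t), (e *: v' + (1 - e) *: t); split.
  - by split; [apply: inQ_convex => //; lra | rewrite !evE].
  - by split; [apply: inQ_convex => //; lra | rewrite !evE vy].
  - by rewrite !evE vz; ring.
  - by rewrite !evE vx.
have ra : 1 <= (2 * r - a)%:~R :> R by rewrite ler1z; lia.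
have rb' : 1 <= (b - 2 * r)%:~R :> R by rewrite ler1z; lia.
rewrite !(intrB, intrM) in ra rb' ab main.
have abN : b%:~R - a%:~R != 0 :> R by rewrite gt_eqF.
have [h|h] := leP r%:~R (ev v y).
  have [wa [Qa ya]] := attained_min.
  have d0 : 0 < 2 * ev v y - a%:~R by lra.
  have dN : 2 * ev v y - a%:~R != 0 by rewrite gt_eqF.
  apply: (main wa ((2 * r%:~R - a%:~R) / (2 * ev v y - a%:~R)) Qa).
    rewrite ler_pdivrMr // ler_pdivlMr // mulrC ler_pdivrMr //; apply/andP; split.
      by nra.
    by lra.
  by rewrite ya; field.
have [wb [Qb yb]] := attained_max.
have d0 : 0 < b%:~R - 2 * ev v y by lra.
have dN : b%:~R - 2 * ev v y != 0 by rewrite gt_eqF.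
apply: (main wb ((b%:~R - 2 * r%:~R) / (b%:~R - 2 * ev v y)) Qb).
  rewrite ler_pdivrMr // ler_pdivlMr // mulrC ler_pdivrMr //; apply/andP; split.
    by nra.
  by lra.
by rewrite yb; field.
Qed.

Lemma slice_row_bound v v' d : inQ f v -> inQ f v' ->
  ev v' z = ev v z + d -> ev v' x = ev v x -> ev v' y = ev v y ->
  2 * (b - a)%:~R <= d -> row_bound (vol5 R z x y f) y f a b j.
Proof.
move=> Qv Qv' vz vx vy bd s r w u t ar rb Qw Qu Qt wy uy ty wi wj uj ti.
have E := vol5_cross V0 Qw Qu Qt wy uy ty wi wj uj ti.
have [q [Rq pq]] := row_positive ar rb.
have long := row_long_chord ar rb Qv Qv' vz vx vy bd.
pose N : R := (grow_num a b j r)%:~R; pose D : R := (grow_den a b j r)%:~R.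
have D0 : 0 < D.
  by rewrite /D ltr0z /grow_den; case: ifP => _; clear - aj jb; lia.
have chB c : is_chord (inRow r) z x c -> c <= N / D.
  by move=> hc; rewrite ler_pdivlMr //; apply: row_chord_bound.
have B2 : 2 <= N / D.
  by have [c hc c2] := long; apply: le_trans (chB _ hc).
have := @triangle_area _ (inRow r) z x w u t (N / D) (inRow_convex (r := r)) B2 _
  long chB (conj Qw wy) (conj Qu uy) (conj Qt ty).
move=> /(_ _)/wrap[].
  move=> c q1 q2 J hc Rq1 Rq2 J0 qx.
  exact: (row_covering (inRow_convex (r := r)) (inRow_nonneg (r := r))
    (@hollow_inRow r) Rq pq hc Rq1 Rq2 J0 qx).
move=> hT; rewrite E -mulrA; apply: ler_wpM2l; first by rewrite ler0z.
rewrite -/N -/D.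
have -> : `|cross z x w u t| * ((N - D) * D) =
   `|cross z x w u t| * (N / D - 1) * D ^+ 2.
  by field; rewrite gt_eqF.
have -> : N ^+ 2 = (N / D) ^+ 2 * D ^+ 2 by field; rewrite gt_eqF.
by apply: ler_wpM2r hT; rewrite exprn_ge0 // ltW.
Qed.
End Slice.

(** * The bound in an adapted basis *)

(** The constants: V > 5184 and the crude bound give d D W > 79, since
    64 * 1.01^2 * 79 < 5184. *)
Lemma adapted_bound (R : realType) (z x y f : 'I_5 -> int) (p m : 'I_5)
    (v v' u u' w : 'rV[R]_5) (d D : R) :
  (forall i, [\/ f i = 0, f i = 1 | f i = -1]) -> f p = 1 -> f m = -1 ->
  (forall t : 'rV[R]_5, inQ f t -> positive t -> ev t z \is a Num.int ->
     ev t x \is a Num.int -> ev t y \is a Num.int -> False) ->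
  inQ f w -> positive w -> ev w x \is a Num.int -> ev w y \is a Num.int ->
  inQ f v -> inQ f v' -> 0 < d ->
  ev v' z = ev v z + d -> ev v' x = ev v x -> ev v' y = ev v y ->
  inQ f u -> inQ f u' -> 0 < D -> ev u' x = ev u x + D -> ev u' y = ev u y ->
  (forall (t t' : 'rV[R]_5) q (k1 k2 k3 : int), inQ f t -> inQ f t' ->
     ~~ [&& k1 == 0, k2 == 0 & k3 == 0] ->
     ev t' z = ev t z + q * k1%:~R -> ev t' x = ev t x + q * k2%:~R ->
     ev t' y = ev t y + q * k3%:~R -> q <= 101 / 100 * d) ->
  (forall (t t' : 'rV[R]_5) q (k2 k3 : int), inQ f t -> inQ f t' ->
     ~~ ((k2 == 0) && (k3 == 0)) -> ev t' x = ev t x + q * k2%:~R ->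
     ev t' y = ev t y + q * k3%:~R -> q <= 101 / 100 * D) ->
  vol5 R z x y f <= 5184.
Proof.
move=> f3 fp fm hollow Qw pw xw yw Qv Qv' d0 vz vx vy Qu Qu' D0 ux uy hd hD.
rewrite leNgt; apply/negP => big.
have V0 : 0 < vol5 R z x y f by lra.
have [a hmin] := row_min_exists y fp fm.
have [b hmax] : exists b, row_max y f b.
  have [b hb] := row_min_exists (fun i => - y i) fp fm.
  by exists (- b); apply/row_max_opp; rewrite opprK.
have [j yj] : exists j : int, ev w y = j%:~R by apply/intrP.
have [t [ty tf t1]] : exists t : 'rV[R]_5, [/\ ev t y = 1, ev t f = 0 & ev t one = 0].
  exact: y_direction V0.
have aj : a < 2 * j.
  have := row_min_lt f3 fp fm hmin Qw pw ty tf t1.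
  by rewrite yj -(ltr_int R) intrM; lra.
have jb : 2 * j < b.
  have ty' : ev (- t) (fun i => - y i) = 1.
    by rewrite ev_opp -(scaleN1r t) evZ ty; ring.
  have := row_min_lt f3 fp fm ((row_max_opp _ _ _).1 hmax) Qw pw ty'.
  rewrite -(scaleN1r t) !evZ tf t1 mulr0 ev_opp intrN yj => /(_ erefl erefl).
  by rewrite -(ltr_int R) intrM; lra.
have [wa [Qa ya]] := row_min_attained R hmin.
have [wb [Qb yb']] := row_min_attained R ((row_max_opp _ _ _).1 hmax).
have yb : ev wb y = b%:~R / 2 by move: yb'; rewrite ev_opp intrN; lra.
pose W : R := (b - a)%:~R / 2.
have W2 : 2 * W = (b - a)%:~R by rewrite /W; field.
have yba : ev wb y = ev wa y + W by rewrite yb ya /W intrB; field.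
have W0 : 0 < W by rewrite /W divr_gt0 // ltr0z; clear -aj jb; lia.
have Dd : D <= 21 / 10 * d.
  apply: (@chord_transfer _ (inQ f) z x y 1 0 v v' u u' d D) => //.
  - exact: inQ_convex.
  - by rewrite mulr1.
  - by rewrite mulr0 addr0.
  - move=> k q q' e Qq Qq' h1 h2 h3.
    by apply: (hd q q' e k 1 0) => //; rewrite andbF.
have WD : W <= 21 / 10 * D.
  apply: (@chord_transfer _ (inQ f) x y y 1 1 u u' wa wb D W) => //.
  - exact: inQ_convex.
  - by rewrite mulr1.
  - by rewrite mulr1.
  - move=> k q q' e Qq Qq' h1 h2 h3.
    by apply: (hD q q' e k 1) => //; rewrite andbF.
have cov : d * D * W <= D * W + d * W + d * D.
  rewrite leNgt; apply/negP => h.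
  have [q [Qq pq qz qx qy]] := covering3 (@inQ_convex R f) (@inQ_nonneg R f)
     Qw pw Qv Qv' Qu Qu' Qa Qb d0 vz vx vy D0 ux uy W0 yba h.
  exact: hollow q Qq pq qz qx qy.
have crude : vol5 R z x y f <=
    16 * (101 / 100 * d) * (101 / 100 * D) * (2 * (b - a))%:~R.
  apply: (vol5_crude V0 (a := p) (b := m)) => //.
  - by move=> i; case: (f3 i) => ->.
  - move=> q q' e Qq Qq' h1 h2 h3.
    by apply: (hd q q' e 1 0 0) => //; rewrite ?mulr1 ?mulr0 ?addr0.
  - move=> q q' e Qq Qq' h1 h2.
    by apply: (hD q q' e 1 0) => //; rewrite ?mulr1 ?mulr0 ?addr0.
  - by move=> k l n; rewrite ler_int; exact: (tdet_bound f3 _ _ _ fp fm hmin hmax).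
have dDW : 79 < d * D * W.
  move: crude; rewrite intrM -W2 => crude.
  by clear - crude big; lra.
have n2 : 2 <= b - a by clear - aj jb; lia.
have n6 : b - a <= 6.
  rewrite leNgt; apply/negP => n7.
  have W7 : 7 / 2 <= W.
    have : 7 <= (b - a)%:~R :> R by rewrite (ler_int R 7); clear - n7; lia.
    by rewrite -W2; clear; lra.
  have := wide_bound d0 D0 W7 Dd WD cov.
  by clear - dDW; lra.
have dW : 4 * W <= d.
  rewrite leNgt; apply/negP => h.
  have n26 : 2 <= b - a <= 6 by rewrite n2 n6.
  have := narrow_bound d0 D0 W2 n26 (ltW h) Dd cov.
  by clear - dDW; lra.
have bd : 2 * (b - a)%:~R <= d by rewrite -W2; clear - dW; lra.
have rb : row_bound (vol5 R z x y f) y f a b j.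
  exact: (slice_row_bound f3 fp fm hmin hmax V0 hollow Qw pw xw yj aj jb
    Qv Qv' vz vx vy bd).
have := configuration_bound f3 fp fm hmin hmax n6 aj jb rb.
by clear - big; lra.
Qed.

(** * Choice of the adapted basis *)

Notation "q ^R" := (map_mx (intr : int -> _) q) (at level 2, format "q ^R").

(** By Smith normal form, e is a multiple of a row of a unimodular matrix. *)
Lemma unimodular_first_row n (e : 'rV[int]_n.+1) : exists (U : 'M[int]_n.+1) (g : int),
  U \in unitmx /\ e *m U = g *: delta_mx 0 0.
Proof.
have [L uL [S uS [d _ eE]]] := int_Smith_normal_form e.
exists (invmx S), (L 0 0 * d`_0); split; first by rewrite unitmx_inv.
rewrite eE mulmxK //; apply/rowP => j; rewrite !mxE big_ord1 !mxE /=.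
have -> : (0 == nat_of_ord j)%N = (j == 0) by rewrite eq_sym.
by case: (j == 0); rewrite ?mulr1n ?mulr0n ?mulr1 ?mulr0.
Qed.

Section NearMaximalChord.
Variables (R : realType) (f : 'I_5 -> int).
Implicit Types (w v t : 'rV[R]_5).

Lemma mulmx_ev n (q : 'M[int]_(5, n)) w k :
  (w *m (q^R : 'M[R]_(5, n))) 0 k = ev w (fun i => q i k).
Proof. by rewrite mxE; apply: eq_bigr => i _; rewrite mxE. Qed.

Lemma inQ_le1 w i : inQ f w -> w 0 i <= 1.
Proof.
case=> w0 w1 _; rewrite -w1 ev_one (bigD1 i) //= lerDl.
by apply: sumr_ge0.
Qed.

(** A lattice direction e whose chord nearly realises the supremum of chord
    lengths need not be primitive; after the change of basis U it is g times the
    first basis vector, and the chord is even longer when measured by the latter.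
    The supremum is finite since vertices have bounded coordinates, and positive
    since Q has interior points. *)
Lemma near_maximal_chord n (q : 'M[int]_(5, n.+1)) w t :
  inQ f w -> positive w -> ev t f = 0 -> ev t one = 0 ->
  t *m (q^R : 'M[R]_(5, n.+1)) = delta_mx 0 0 ->
  exists (U : 'M[int]_n.+1) (v v' : 'rV[R]_5) (d : R),
  [/\ U \in unitmx, inQ f v, inQ f v', 0 < d &
      (v' - v) *m ((q *m U)^R : 'M[R]_(5, n.+1)) = d *: delta_mx 0 0 /\
      forall v1 v2 s (e : 'rV[int]_n.+1), inQ f v1 -> inQ f v2 -> e != 0 ->
        (v2 - v1) *m ((q *m U)^R : 'M[R]_(5, n.+1)) = s *: e^R ->
        s <= 101 / 100 * d].
Proof.
move=> Qw pw tf t1 tq.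
(* lattice lengths of all chords, over all integral directions *)
pose S : set R := [set s | exists v1 v2 (e : 'rV[int]_n.+1),
  [/\ inQ f v1, inQ f v2, e != 0 &
      (v2 - v1) *m (q^R : 'M[R]_(5, n.+1)) = s *: e^R]]%classic.
have ubS : forall s, S s -> s <= \sum_i \sum_k `|(q i k)%:~R : R|.
  move=> s [v1 [v2 [e [Q1 Q2 eN0 se]]]].
  have [k ek] : exists k, e 0 k != 0.
    have [/existsP//|/existsPn h] := boolP [exists k, e 0 k != 0].
    case/eqP: eN0; apply/rowP => k; rewrite mxE; apply/eqP.
    by have := h k; rewrite negbK.
  have [s0|s0] := leP s 0.
    by apply: (le_trans s0); apply: sumr_ge0 => i _; apply: sumr_ge0.
  have : `|s * (e 0 k)%:~R| <= \sum_i `|(q i k)%:~R : R|.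
    have /rowP /(_ k) := se; rewrite mulmx_ev !mxE => <-.
    apply: (le_trans (ler_norm_sum _ _ _)); apply: ler_sum => i _.
    rewrite normrM ler_piMl // rowBE ler_norml.
    have := inQ_le1 i Q1; have := inQ_le1 i Q2.
    by case: Q1 => /(_ i) a1 _ _; case: Q2 => /(_ i) a2 _ _; lra.
  rewrite normrM (gtr0_norm s0) => hk.
  have e1 : 1 <= `|(e 0 k)%:~R : R|.
    by apply: norm_intr_ge1; rewrite ?intr_int // intr_eq0.
  have : s <= s * `|(e 0 k)%:~R : R| by rewrite ler_peMr // ltW.
  move=> h; apply: (le_trans h); apply: (le_trans hk).
  by apply: ler_sum => i _; rewrite (bigD1 k) //= lerDl; apply: sumr_ge0.
have e0N0 : (delta_mx 0 0 : 'rV[int]_n.+1) != 0.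
  by apply/eqP => /rowP /(_ 0); rewrite !mxE.
have deltaR : ((delta_mx 0 0 : 'rV[int]_n.+1)^R : 'rV[R]_n.+1) = delta_mx 0 0.
  by apply/rowP => k; rewrite !mxE; case: (_ && _).
have [s0 [s0p Ss0]] : exists s0, 0 < s0 /\ S s0.
  have tN0 : t != 0.
    apply: contra_eq_neq tq => ->; rewrite mul0mx eq_sym.
    by apply/eqP => /rowP /(_ 0) /eqP; rewrite !mxE /= oner_eq0.
  have [i0 ti0] : exists i, t 0 i < 0.
    have [/existsP//|/existsPn h] := boolP [exists i, t 0 i < 0].
    case/eqP: tN0; apply/rowP => i; rewrite mxE.
    have h0 j : 0 <= t 0 j by rewrite leNgt; exact: h.
    move/eqP: t1; rewrite ev_one psumr_eq0 // => /allP /(_ i).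
    by rewrite mem_index_enum => /(_ isT) /eqP.
  case: (Qw) => w0 w1 wf.
  have [c [i [_ _ _ wc cp]]] := move_to_facet w0 ti0.
  exists c; split; first exact: cp.
  exists w, (w + c *: t), (delta_mx 0 0); split => //.
    by split=> //; rewrite !evE ?t1 ?tf mulr0 addr0.
  by rewrite deltaR addrC addKr -scalemxAl tq.
have hsS : has_sup S.
  by split; [exists s0 | exists (\sum_i \sum_k `|(q i k)%:~R : R|) => s /ubS].
have sup0 : 0 < sup S by apply: (lt_le_trans s0p); apply: ub_le_sup => //; case: hsS.
have [s1 Ss1 s1P] : exists2 s1, S s1 & sup S - sup S / 101 < s1.
  by apply: sup_adherent => //; rewrite divr_gt0.
have s1p : 0 < s1 by lra.
case: Ss1 => v1 [v2 [e [Q1 Q2 eN0 se]]].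
have [U [g [uU eU]]] := unimodular_first_row e.
have UR (e' : 'rV[int]_n.+1) : ((e' *m U)^R : 'rV[R]_n.+1) = e'^R *m U^R.
  by rewrite map_mxM.
have gN0 : g != 0.
  apply: contra eN0 => /eqP g0; rewrite -(mulmxK uU e) eU g0 scale0r mul0mx.
  exact: eqxx.
have vU : (v2 - v1) *m ((q *m U)^R : 'M[R]_(5, n.+1)) = (s1 * g%:~R) *: delta_mx 0 0.
  rewrite map_mxM mulmxA se -scalemxAl -UR eU -scalerA -deltaR; congr (_ *: _).
  by apply/rowP => k; rewrite !mxE rmorphM.
have g1 : 1 <= `|g%:~R : R|.
  by apply: norm_intr_ge1; rewrite ?intr_int // intr_eq0.
have bound v3 v4 s (e' : 'rV[int]_n.+1) : inQ f v3 -> inQ f v4 -> e' != 0 ->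
    (v4 - v3) *m ((q *m U)^R : 'M[R]_(5, n.+1)) = s *: e'^R -> s <= 101 / 100 * s1.
  move=> Q3 Q4 e'N0 se'.
  suff : s <= sup S by lra.
  apply: ub_le_sup; first by case: hsS.
  exists v3, v4, (e' *m invmx U); split => //.
    by apply: contra e'N0 => /eqP h; rewrite -(mulmxKV uU e') h mul0mx.
  have : (v4 - v3) *m ((q *m U)^R : 'M[R]_(5, n.+1)) *m (invmx U)^R
       = s *: e'^R *m (invmx U)^R by rewrite se'.
  by rewrite -mulmxA -map_mxM mulmxK // -scalemxAl -map_mxM.
have sg : s1 <= s1 * `|g%:~R : R| by rewrite ler_peMr // ltW.
have final v3 v4 s (e' : 'rV[int]_n.+1) : inQ f v3 -> inQ f v4 -> e' != 0 ->
    (v4 - v3) *m ((q *m U)^R : 'M[R]_(5, n.+1)) = s *: e'^R ->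
    s <= 101 / 100 * (s1 * `|g%:~R|).
  by move=> Q3 Q4 e'0 h; have := bound _ _ _ _ Q3 Q4 e'0 h; lra.
have [gp|gn] := leP 0 (g%:~R : R).
  exists U, v1, v2, (s1 * `|g%:~R|); split => //; first by lra.
  by split => //; rewrite ger0_norm.
exists U, v2, v1, (s1 * `|g%:~R|); split => //; first by lra.
split => //; rewrite ltr0_norm // mulrN scaleNr -vU -mulNmx opprB //.
Qed.
End NearMaximalChord.

Lemma ord3P (P : 'I_3 -> Prop) : P 0 -> P 1 -> P 2 -> forall i, P i.
Proof.
move=> h0 h1 h2 [[|[|[|n]]] lt_n] //.
- by rewrite (_ : Ordinal _ = 0) //; apply: val_inj.
- by rewrite (_ : Ordinal _ = 1) //; apply: val_inj.
- by rewrite (_ : Ordinal _ = 2) //; apply: val_inj.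
Qed.

Section SliceBound.
Variables (R : realType) (f : 'I_5 -> int).
Implicit Types (w v t : 'rV[R]_5) (q : 'M[int]_(5, 3)).

Definition mxvol q : R := vol5 R (fun i => q i 0) (fun i => q i 1) (fun i => q i 2) f.

Lemma mxvolE q : mxvol q =
  `|\det (row_mx q (\matrix_(i < 5, j < 2) nth 0 [:: f i; 1] j) : 'M[int]_(3 + 2))|%:~R.
Proof.
rewrite /mxvol /vol5 intr_norm -det_map_mx; congr `|\det _|.
set F := \matrix_(_, _) _.
have qE i (k : 'I_3) : row_mx q F i (lshift 2 k) = q i k by rewrite row_mxEl.
have FE i (k : 'I_2) : row_mx q F i (rshift 3 k) = nth 0 [:: f i; 1] k.
  by rewrite row_mxEr mxE.
apply/matrixP => i j; rewrite [LHS]mxE [RHS]mxE; congr (_%:~R).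
move: j; apply: ord5P => /=.
- by rewrite -qE; congr (row_mx _ _ i _); apply: val_inj.
- by rewrite -qE; congr (row_mx _ _ i _); apply: val_inj.
- by rewrite -qE; congr (row_mx _ _ i _); apply: val_inj.
- by rewrite -[LHS](FE i 0); congr (row_mx _ _ i _); apply: val_inj.
- by rewrite -[LHS](FE i 1); congr (row_mx _ _ i _); apply: val_inj.
Qed.

Lemma mxvol_unimodular q (U : 'M[int]_3) : U \in unitmx -> mxvol (q *m U) = mxvol q.
Proof.
move=> uU; rewrite !mxvolE.
set F := \matrix_(_, _) _.
have -> : row_mx (q *m U) F = row_mx q F *m block_mx U 0 0 1%:M.
  by rewrite mul_row_block !mulmx0 mulmx1 addr0 add0r.
rewrite det_mulmx normrM det_ublock det1 mulr1.
have : `|\det U| = 1 by move: uU; rewrite unitmxE => /orP[] /eqP ->.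
by move=> ->; rewrite mulr1.
Qed.

(** The direction z is chosen first, then x in the projection along z; the
    second change of basis does not involve the first coordinate, and the
    hypothesis on shadows is used for the final basis. *)
Lemma slice_bound q (p m : 'I_5) :
  (forall i, [\/ f i = 0, f i = 1 | f i = -1]) -> f p = 1 -> f m = -1 ->
  (forall w, inQ f w -> positive w ->
     (forall k, (w *m (q^R : 'M[R]_(5, 3))) 0 k \is a Num.int) -> False) ->
  (forall U : 'M[int]_3, U \in unitmx -> exists w, [/\ inQ f w, positive w &
     forall k, k != 0 -> (w *m ((q *m U)^R : 'M[R]_(5, 3))) 0 k \is a Num.int]) ->
  mxvol q <= 5184.
Proof.
move=> f3 fp fm hollow shadow.
have [V0|V0] := leP (mxvol q) 0; first exact: (le_trans V0 (ler0n _ _)).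
have [w [Qw pw _]] := shadow _ (unitmx1 _ _).
have [muz mux muy muf mu1] := ev_mu V0.
have tq : mu R (fun i => q i 0) (fun i => q i 1) (fun i => q i 2) f *m q^R
    = delta_mx 0 0.
  apply/rowP => k; rewrite mulmx_ev mxE eqxx /=; move: k; apply: ord3P.
  - by rewrite muz.
  - by rewrite mux.
  - by rewrite muy.
have [U1 [v [v' [d [uU1 Qv Qv' d0 [vd hd]]]]]] :=
  near_maximal_chord Qw pw muf mu1 tq.
pose q1 := q *m U1.
have V1 : 0 < mxvol q1 by rewrite mxvol_unimodular.
pose q2 : 'M[int]_(5, 2) := rsubmx (q1 : 'M[int]_(5, 1 + 2)).
have q2E i k : q2 i k = q1 i (rshift 1 k) by rewrite [LHS]mxE.
have [nuz nux nuy nuf nu1] := ev_nu V1.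
have tq2 : nu R (fun i => q1 i 0) (fun i => q1 i 1) (fun i => q1 i 2) f *m q2^R
    = delta_mx 0 0.
  apply/rowP => k; rewrite mulmx_ev mxE eqxx /=.
  have -> : ev (nu R (fun i => q1 i 0) (fun i => q1 i 1) (fun i => q1 i 2) f)
      (fun i => q2 i k) = ev (nu R (fun i => q1 i 0) (fun i => q1 i 1)
       (fun i => q1 i 2) f) (fun i => q1 i (rshift 1 k)).
    by apply: eq_bigr => i _; rewrite q2E.
  case: k => [[|[|k]] lt_k] //=.
    rewrite (_ : rshift 1 _ = 1) ?nux //; exact: val_inj.
  rewrite (_ : rshift 1 _ = 2) ?nuy //; exact: val_inj.
have [U2 [u [u' [D [uU2 Qu Qu' D0 [uD hD]]]]]] :=
  near_maximal_chord Qw pw nuf nu1 tq2.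
pose B : 'M[int]_3 := block_mx (1%:M : 'M[int]_1) 0 0 U2.
have uB : B \in unitmx by rewrite unitmxE (det_lblock (1%:M : 'M[int]_1) 0 U2) det1 mul1r -unitmxE.
pose Q := q1 *m B.
have QE : Q = row_mx (lsubmx (q1 : 'M[int]_(5, 1 + 2))) (q2 *m U2).
  have := mul_row_block (lsubmx (q1 : 'M[int]_(5, 1 + 2))) q2 (1%:M : 'M[int]_1) 0 0 U2.
  by rewrite hsubmxK !mulmx0 mulmx1 addr0 add0r.
have Q0 i : Q i 0 = q1 i 0.
  rewrite QE; transitivity (lsubmx (q1 : 'M[int]_(5, 1 + 2)) i 0).
    by rewrite -[RHS](row_mxEl _ (q2 *m U2) i 0); congr (row_mx _ _ i _); apply: val_inj.
  by rewrite mxE; congr (q1 i _); apply: val_inj.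
have Q1 i : Q i 1 = (q2 *m U2) i 0.
  rewrite QE -[RHS](row_mxEr (lsubmx (q1 : 'M[int]_(5, 1 + 2))) _ i 0).
  by congr (row_mx _ _ i _); apply: val_inj.
have Q2 i : Q i 2 = (q2 *m U2) i 1.
  rewrite QE -[RHS](row_mxEr (lsubmx (q1 : 'M[int]_(5, 1 + 2))) _ i 1).
  by congr (row_mx _ _ i _); apply: val_inj.
have UB : U1 *m B \in unitmx by rewrite unitmx_mul uU1.
have [w' [Qw' pw' w'Z]] := shadow (U1 *m B) UB.
have VQ : mxvol Q = mxvol q.
  by rewrite /Q mxvol_unimodular // mxvol_unimodular.
have diff n (g : 'M[int]_(5, n)) k a b : ev b (fun i => g i k) =
    ev a (fun i => g i k) + ((b - a) *m g^R) 0 k :> R.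
  by rewrite mulmx_ev evB; ring.
have ext0 (g h : 'I_5 -> int) t : (forall i, g i = h i) -> ev t g = ev t h.
  by move=> gh; apply: eq_bigr => i _; rewrite gh.
have vq2 : (v' - v) *m q2^R = 0.
  apply/rowP => k; rewrite mulmx_ev (ext0 _ (fun i => q1 i (rshift 1 k))) //.
  by rewrite -mulmx_ev vd !mxE; case: k => [[|[|k]] lt_k] //=; rewrite mulr0.
have vz k : ((v' - v) *m (q2 *m U2)^R) 0 k = 0.
  by rewrite map_mxM mulmxA vq2 mul0mx mxE.
rewrite -VQ.
apply: (@adapted_bound R _ _ _ f p m v v' u u' w' d D) => //.
- move=> t Qt pt tz tx ty; apply: (hollow t Qt pt) => k.
  have tQ l : (t *m (Q^R : 'M[R]_(5, 3))) 0 l \is a Num.int.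
    by rewrite mulmx_ev; move: l; apply: ord3P.
  have -> : q = Q *m invmx (U1 *m B) by rewrite /Q /q1 -(mulmxA q) mulmxK.
  by rewrite map_mxM mulmxA mxE rpred_sum // => l _; rewrite rpredM // mxE intr_int.
- by have := w'Z 1 isT; rewrite mulmxA mulmx_ev.
- by have := w'Z 2 isT; rewrite mulmxA mulmx_ev.
- rewrite (ext0 _ (fun i => q1 i 0)) // (ext0 _ (fun i => q1 i 0) v) //.
  by rewrite (diff _ _ _ v v') vd !mxE /= mulr1.
- rewrite (ext0 _ (fun i => (q2 *m U2) i 0)) // (ext0 _ _ v (Q1)) //.
  by rewrite (diff _ _ _ v v') vz addr0.
- rewrite (ext0 _ (fun i => (q2 *m U2) i 1)) // (ext0 _ _ v (Q2)) //.
  by rewrite (diff _ _ _ v v') vz addr0.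
- rewrite (ext0 _ (fun i => (q2 *m U2) i 0)) // (ext0 _ _ u (Q1)) //.
  by rewrite (diff _ _ _ u u') uD !mxE /= mulr1.
- rewrite (ext0 _ (fun i => (q2 *m U2) i 1)) // (ext0 _ _ u (Q2)) //.
  by rewrite (diff _ _ _ u u') uD !mxE /= mulr0 addr0.
- move=> t t' e k1 k2 k3 Qt Qt' kN0 tz tx ty.
  pose k : 'rV[int]_3 := \row_j nth 0 [:: k1; k2; k3] j.
  apply: (hd t t' e (k *m invmx B)) => //.
    apply: contra kN0 => /eqP h.
    have : k = 0 by rewrite -(mulmxKV uB k) h mul0mx.
    move=> /rowP kE; have := kE 0; have := kE 1; have := kE 2.
    by rewrite !mxE /= => -> -> ->.
  have h : (t' - t) *m (Q^R : 'M[R]_(5, 3)) = e *: k^R.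
    apply/rowP => l; rewrite mulmx_ev evB !mxE; move: l; apply: ord3P => /=.
    + by rewrite tz; ring.
    + by rewrite tx; ring.
    + by rewrite ty; ring.
  have -> : q *m U1 = Q *m invmx B by rewrite /Q mulmxK.
  by rewrite map_mxM mulmxA h -scalemxAl -map_mxM.
- move=> t t' e k2 k3 Qt Qt' kN0 tx ty.
  pose k : 'rV[int]_2 := \row_j nth 0 [:: k2; k3] j.
  apply: (hD t t' e k) => //.
    apply: contra kN0 => /eqP /rowP kE; have := kE 0; have := kE 1.
    by rewrite !mxE /= => -> ->.
  apply/rowP => l; rewrite mulmx_ev evB [RHS]mxE; case: l => [[|[|l]] lt_l] //.
    rewrite (ext0 _ (fun i => Q i 1)) ?(ext0 _ (fun i => Q i 1) t).
    + by rewrite tx !mxE /=; ring.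
    + by move=> i; rewrite Q1; congr ((q2 *m U2) i _); apply: val_inj.
    + by move=> i; rewrite Q1; congr ((q2 *m U2) i _); apply: val_inj.
  rewrite (ext0 _ (fun i => Q i 2)) ?(ext0 _ (fun i => Q i 2) t).
  + by rewrite ty !mxE /=; ring.
  + by move=> i; rewrite Q2; congr ((q2 *m U2) i _); apply: val_inj.
  + by move=> i; rewrite Q2; congr ((q2 *m U2) i _); apply: val_inj.
Qed.
End SliceBound.

(** * Scaling of Lebesgue measure on products of lines *)

Local Open Scope classical_set_scope.
Local Open Scope ring_scope.

Section SigmaFiniteProduct.
Context d1 d2 (T1 : measurableType d1) (T2 : measurableType d2) (R : realType).
Variable m1 : {sigma_finite_measure set T1 -> \bar R}.
Variable m2 : {sigma_finite_measure set T2 -> \bar R}.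

(** The product measure under a name of its own, which carries the structure of
    a sigma-finite measure and so can be a factor again. *)
Definition product : set (T1 * T2) -> \bar R := (m1 \x m2)%E.

HB.instance Definition _ := Measure.on product.

Let sigma_finite_product : sigma_finite setT product.
Proof.
have /sigma_finiteP[F [FT Fmono Ffin]] := sigma_finiteT m1.
have /sigma_finiteP[G [GT Gmono Gfin]] := sigma_finiteT m2.
exists (fun n => F n `*` G n) => [|n].
  apply/seteqP; split=> // -[x y] _.
  have [i _ Fx] : (\bigcup_i F i) x by rewrite -FT.
  have [j _ Gy] : (\bigcup_j G j) y by rewrite -GT.
  exists (maxn i j) => //; split=> /=.
    by have /subsetPset := Fmono _ _ (leq_maxl i j); apply.
  by have /subsetPset := Gmono _ _ (leq_maxr i j); apply.
have [[mF Foo] [mG Goo]] := (Ffin n, Gfin n).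
split; first exact: measurableX.
by rewrite /product product_measure1E // lte_mul_pinfty // ge0_fin_numE.
Qed.

HB.instance Definition _ :=
  Measure_isSigmaFinite.Build _ _ _ product sigma_finite_product.
End SigmaFiniteProduct.

Section Scaling.
Variable R : realType.
Local Notation L := (measurableTypeR R).
Local Notation mu := (@lebesgue_measure R).

Definition scaling d (T : measurableType d) (m : set T -> \bar R) (g : T -> T)
    (k : R) : Prop :=
  measurable_fun setT g /\
  forall S, measurable S -> (k%:E * m (g @^-1` S) = m S)%E.

(** Checked on half-open intervals, which determine the measure; a negative
    k exchanges the ends. *)
Lemma line_scaling (a k : R) : k != 0 -> scaling mu (fun x => a + k * x) `|k|.
Proof.
move=> k0.
pose g : measurableTypeR R -> measurableTypeR R := fun x => a + k * x.
have mg : measurable_fun setT g.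
  by apply: measurable_funD => //; apply: measurable_funM.
split=> // S mS.
have nk : 0 <= `|k| by [].
suff /(_ mg _ mS) -> : forall S, measurable S ->
  mu S = mscale (NngNum nk) (pushforward mu g) S by [].
move=> mg1; apply: lebesgue_measure_unique => //= _ [[x y] _ <-].
rewrite /mscale /pushforward /=.
have [k1|k1] := ltP 0 k.
  rewrite [X in (_ = _ * mu X)%E](_ : _ = `](x - a) / k, (y - a) / k]%classic); last first.
    apply/seteqP; split=> t /=; rewrite !in_itv /= /g
      ltr_pdivrMr // ler_pdivlMr // => /andP[h1 h2]; apply/andP; split; lra.
  rewrite !lebesgue_measure_itv /= !lte_fin ltr_pM2r ?invr_gt0 // ltrD2r.
  case: ifP => _; last by rewrite mule0.
  by rewrite gtr0_norm // -!EFinB -EFinM; congr EFin; field.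
have {}k1 : k < 0 by rewrite lt_neqAle k0.
rewrite [X in (_ = _ * mu X)%E](_ : _ = `[(y - a) / k, (x - a) / k[%classic); last first.
  apply/seteqP; split=> t /=; rewrite !in_itv /= /g
    ltr_ndivlMr // ler_ndivrMr // => /andP[h1 h2]; apply/andP; split; lra.
rewrite !lebesgue_measure_itv /= !lte_fin ltr_nM2r ?invr_lt0 // ltrD2r.
case: ifP => _; last by rewrite mule0.
by rewrite ltr0_norm // -!EFinB -EFinM; congr EFin; field.
Qed.

Lemma transpose_scaling : scaling (mu \x mu)%E (fun y => (y.2, y.1)) 1.
Proof.
set sw := fun y => _.
have msw : measurable_fun setT sw by exact: measurable_fun_pair.
split=> // S mS; rewrite mul1e [RHS](@product_measure_unique _ _ _ _ _ _ _
  (pushforward (mu \x mu)%E sw)) // => A B mA mB.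
transitivity ((mu \x mu)%E (B `*` A)); last by rewrite product_measure1E // muleC.
by congr (product_measure1 _ _ _); apply/seteqP; split=> -[a b] [].
Qed.

Section Product.
Context d (T : measurableType d) (m : {sigma_finite_measure set T -> \bar R}).

(** Integrate [line_scaling] over the first factor. *)
Lemma fiber_scaling (h : T -> R) (k : R) : measurable_fun setT h -> k != 0 ->
  scaling (m \x mu)%E (fun t => (t.1, h t.1 + k * t.2)) `|k|.
Proof.
move=> mh k0; set g := fun t => _.
have mg : measurable_fun setT g.
  apply: measurable_fun_pair => //; apply: measurable_funD.
    exact: measurableT_comp.
  exact: measurable_funM.
split=> // S mS.
have mgS : measurable (g @^-1` S) by rewrite -[X in measurable X]setTI; apply: mg.
rewrite /product_measure1 -ge0_integralZl ?lee_fin //; last exact: measurable_fun_xsection.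
apply: eq_integral => t _ /=.
have [_ lineE] := line_scaling (h t) k0.
rewrite -(lineE _ (measurable_xsection t mS)).
congr (_ * lebesgue_measure _)%E; apply/seteqP; split=> x /=;
  by rewrite /xsection /= !inE.
Qed.

Lemma lift_scaling (g : T -> T) (k : R) : 0 <= k ->
  scaling m g k -> scaling (m \x mu)%E (fun t => (g t.1, t.2)) k.
Proof.
move=> k0 [mg gE]; set G := fun t => _.
have mG : measurable_fun setT G.
  by apply: measurable_fun_pair => //; apply: measurableT_comp.
split=> // S mS.
suff /(_ mG _ mS) -> : forall S, measurable S ->
  (m \x mu)%E S = mscale (NngNum k0) (pushforward (m \x mu)%E G) S by [].
move=> mG1; apply: product_measure_unique => //= A B mA mB.
have mgA : measurable (g @^-1` A) by rewrite -[X in measurable X]setTI; apply: mg.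
rewrite /mscale /pushforward /=.
rewrite [X in (_ * product_measure1 _ _ X)%E](_ : _ = (g @^-1` A) `*` B) //.
by rewrite product_measure1E // muleA gE.
Qed.

(** By Tonelli the product measure is the integral over the first factor of
    the planar measure of sections, to which [transpose_scaling] applies. *)
Lemma swap_scaling :
  scaling ((m \x mu) \x mu)%E (fun t => ((t.1.1, t.2), t.1.2)) 1.
Proof.
set G := fun t => _.
have mG : measurable_fun setT G.
  apply: measurable_fun_pair; last exact: measurableT_comp.
  by apply: measurable_fun_pair => //; apply: measurableT_comp.
split=> // S mS; rewrite mul1e.
have mGS : measurable (G @^-1` S) by rewrite -[X in measurable X]setTI; apply: mG.
have fubini (A : set (T * L * L)) : measurable A -> ((m \x mu) \x mu)%E A =
    (\int[m]_x ((mu \x mu) [set y | A ((x, y.1), y.2)]))%E.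
  move=> mA; rewrite {1}/product_measure1 fubini_tonelli1 //.
  exact: measurable_fun_xsection.
rewrite (fubini _ mS) (fubini _ mGS); apply: eq_integral => x _.
have mSx : measurable [set y : L * L | S ((x, y.1), y.2)].
  rewrite -[X in measurable X]setTI.
  apply: (_ : measurable_fun setT (fun y : L * L => ((x, y.1), y.2))) => //.
  apply: measurable_fun_pair => //; apply: measurable_fun_pair => //.
by have [_ /(_ _ mSx) <-] := transpose_scaling; rewrite mul1e.
Qed.
End Product.
End Scaling.

(** * Scaling of Lebesgue measure under affine maps of R^4 *)

Section Stretch.
Variable R : realType.
Local Notation L := (measurableTypeR R).
Local Notation mu := (@lebesgue_measure R).
Local Notation plane := (product mu mu).
Local Notation space := (product plane mu).
Implicit Types (x a b : 'rV[R]_4) (A T : 'M[R]_4).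

Definition measurable4 (K : set 'rV[R]_4) :=
  measurable (@row4 R @^-1` K : set (L * L * L * L)).

(** Stated with preimages, so that measurability comes along and composition
    is immediate; k = |det| for affine maps. *)
Definition stretches (g : 'rV[R]_4 -> 'rV[R]_4) (k : R) : Prop :=
  forall K, measurable4 K ->
    measurable4 (g @^-1` K) /\ (k%:E * lebesgue4 (g @^-1` K) = lebesgue4 K)%E.

Lemma stretches_comp g h k l :
  stretches g k -> stretches h l -> stretches (h \o g) (k * l).
Proof.
move=> sg sh K mK; have [mhK hE] := sh K mK; have [mghK gE] := sg _ mhK.
by split=> //; rewrite mulrC EFinM -muleA gE hE.
Qed.

Lemma stretches_ext g h k : g =1 h -> stretches g k -> stretches h k.
Proof. by move=> /funext ->. Qed.

Lemma scaling_stretches (h : L * L * L * L -> L * L * L * L) g k :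
  scaling (product space mu) h k ->
  (forall t, row4 (h t) = g (row4 t)) -> stretches g k.
Proof.
move=> [mh hE] hg K mK; have -> : g @^-1` K = [set x | K (g x)] by [].
have E : @row4 R @^-1` (g @^-1` K) = h @^-1` (@row4 R @^-1` K).
  by apply/seteqP; split=> t /=; rewrite hg.
split; first by rewrite /measurable4 E -[X in measurable X]setTI; apply: mh.
by rewrite /lebesgue4 E hE.
Qed.

Lemma ord4P (P : 'I_4 -> Prop) : P 0 -> P 1 -> P 2 -> P 3 -> forall i, P i.
Proof.
move=> h0 h1 h2 h3 [[|[|[|[|n]]]] lt_n] //.
- by rewrite (_ : Ordinal _ = 0) //; apply: val_inj.
- by rewrite (_ : Ordinal _ = 1) //; apply: val_inj.
- by rewrite (_ : Ordinal _ = 2) //; apply: val_inj.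
- by rewrite (_ : Ordinal _ = 3) //; apply: val_inj.
Qed.

Lemma sum4 (F : 'I_4 -> R) : \sum_i F i = F 0 + F 1 + F 2 + F 3.
Proof.
rewrite !big_ord_recl big_ord0 addr0 !addrA.
by congr (F _ + F _ + F _ + F _); apply: val_inj.
Qed.

Definition replace_coord (j : 'I_4) (c : R) (a : 'cV[R]_4) x : 'rV[R]_4 :=
  \row_i if i == j then c + (x *m a) 0 0 else x 0 i.

Lemma replace_last_stretches c (a : 'cV[R]_4) : a 3 0 != 0 ->
  stretches (replace_coord 3 c a) `|a 3 0|.
Proof.
move=> a0.
pose h (t : L * L * L) : R := c + t.1.1 * a 0 0 + t.1.2 * a 1 0 + t.2 * a 2 0.
have mh : measurable_fun setT h.
  have m1 : measurable_fun setT (fun t : L * L * L => t.1.1 : R).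
    by apply: measurableT_comp => //; apply: measurable_fst.
  have m2 : measurable_fun setT (fun t : L * L * L => t.1.2 : R).
    by apply: measurableT_comp => //; apply: measurable_snd.
  have m3 : measurable_fun setT (fun t : L * L * L => t.2 : R) by apply: measurable_snd.
  by do ![apply: measurable_funD => //]; apply: measurable_funM.
apply: (scaling_stretches (fiber_scaling space mh a0)) => t.
apply/rowP; apply: ord4P; rewrite !mxE //=.
by rewrite sum4 /= !mxE /= /h; ring.
Qed.

(** Exchanges of adjacent factors generate all permutations. *)
Lemma permute_stretches (s : 'S_4) : stretches (col_perm s) 1.
Proof.
have comp s1 s2 : stretches (col_perm s1) 1 -> stretches (col_perm s2) 1 ->
    stretches (col_perm (s2 * s1)%g) 1.
  move=> h1 h2; rewrite -(mulr1 1).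
  by apply: stretches_ext (stretches_comp h1 h2) => x; rewrite /= -col_permM.
have one : stretches (col_perm (1%g : 'S_4)) 1.
  by move=> K mK; rewrite mul1e (_ : _ @^-1` K = K) //; apply/seteqP; split=> x /=;
    rewrite col_perm1.
have s23 : stretches (col_perm (tperm (2 : 'I_4) 3)) 1.
  apply: (scaling_stretches (swap_scaling plane)) => t.
  by apply/rowP; apply: ord4P; rewrite !mxE permE.
have s12 : stretches (col_perm (tperm (1 : 'I_4) 2)) 1.
  apply: (scaling_stretches (@lift_scaling R _ _ space _ _ ler01 (swap_scaling mu))) => t.
  by apply/rowP; apply: ord4P; rewrite !mxE permE.
have s01 : stretches (col_perm (tperm (0 : 'I_4) 1)) 1.
  apply: (scaling_stretches (@lift_scaling R _ _ space _ _ ler01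
    (@lift_scaling R _ _ plane _ _ ler01 (transpose_scaling R)))) => t.
  by apply/rowP; apply: ord4P; rewrite !mxE permE.
have conj s1 s2 : stretches (col_perm s1) 1 -> stretches (col_perm s2) 1 ->
    s2 = s2^-1%g -> stretches (col_perm (s1 ^ s2)%g) 1.
  by move=> h1 h2 s2V; rewrite /conjg -s2V; apply: (comp); first apply: (comp).
have tV (i j : 'I_4) : tperm i j = (tperm i j)^-1%g by rewrite tpermV.
have s02 : stretches (col_perm (tperm (0 : 'I_4) 2)) 1.
  by have := conj _ _ s01 s12 (tV _ _); rewrite tpermJ !permE.
have s13 : stretches (col_perm (tperm (1 : 'I_4) 3)) 1.
  by have := conj _ _ s12 s23 (tV _ _); rewrite tpermJ !permE.
have s03 : stretches (col_perm (tperm (0 : 'I_4) 3)) 1.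
  by have := conj _ _ s02 s23 (tV _ _); rewrite tpermJ !permE.
have st i j : stretches (col_perm (tperm (i : 'I_4) j)) 1.
  wlog lt_ij : i j / (i < j)%N => [IH|].
    have [lt_ij|lt_ji|/val_inj ->] := ltngtP i j; first exact: IH.
      by rewrite tpermC; apply: IH.
    by rewrite tperm1; exact: one.
  move: i j lt_ij; apply: ord4P; apply: ord4P => lt_ij; try discriminate lt_ij;
    [exact: s01|exact: s02|exact: s03|exact: s12|exact: s13|exact: s23].
have [ts -> _] := prod_tpermP s.
elim: ts => [|t ts IH]; first by rewrite big_nil; exact: one.
rewrite big_cons; exact: (comp _ _ IH (st _ _)).
Qed.

Lemma replace_coord_stretches j c (a : 'cV[R]_4) : a j 0 != 0 ->
  stretches (replace_coord j c a) `|a j 0|.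
Proof.
move=> aj; set s := tperm j (3 : 'I_4).
pose a' := row_perm s a.
have a3 : a' 3 0 = a j 0 by rewrite mxE /s tpermR.
have := stretches_comp (stretches_comp (permute_stretches s)
  (@replace_last_stretches c a' _)) (permute_stretches s).
rewrite a3 mul1r mulr1 => /(_ aj); apply: stretches_ext => x.
apply/rowP => i; rewrite !mxE /=.
have -> : (s i == 3) = (i == j).
  by rewrite -(inj_eq (@perm_inj _ s)) /s tpermK tpermR.
rewrite /s tpermK; case: ifP => // _; congr (_ + _).
rewrite [RHS](reindex_inj (@perm_inj _ s)) /=; apply: eq_bigr => l _.
by rewrite !mxE.
Qed.

Lemma translate_stretches b : stretches (fun x => x + b) 1.
Proof.
have unit_nz (j : 'I_4) : (delta_mx j 0 : 'cV[R]_4) j 0 != 0.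
  by rewrite mxE !eqxx oner_neq0.
pose tr j := replace_coord j (b 0 j) (delta_mx j 0).
have st j : stretches (tr j) 1.
  have := @replace_coord_stretches j (b 0 j) _ (unit_nz j).
  by rewrite mxE !eqxx normr1.
have trE j x i : tr j x 0 i = if i == j then x 0 i + b 0 i else x 0 i.
  rewrite mxE; case: eqP => // ->; rewrite addrC; congr (_ + _).
  by rewrite -colE mxE.
have := stretches_comp (stretches_comp (stretches_comp (st 0) (st 1)) (st 2)) (st 3).
rewrite !mulr1; apply: stretches_ext => x; apply/rowP => i /=.
by rewrite [RHS]mxE; move: i; apply: ord4P; rewrite -!/(tr _ _) !trE.
Qed.

Lemma replace_coord0E j (a : 'cV[R]_4) x i :
  replace_coord j 0 a x 0 i = if i == j then \sum_l x 0 l * a l 0 else x 0 i.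
Proof. by rewrite mxE add0r mxE. Qed.

(** A triangular map is a product of maps that each change one coordinate.
    The order matters: coordinate j of x T involves the x l with l >= j, so the
    small j are replaced first. *)
Lemma lower_stretches T : is_trig_mx T -> T \in unitmx ->
  stretches (fun x => x *m T) `|\det T|.
Proof.
move=> trT uT; have detT := det_trig trT.
have Tjj j : T j j != 0.
  move: uT; rewrite unitmxE unitfE detT => /prodf_neq0; exact.
have st j : stretches (replace_coord j 0 (col j T)) `|T j j|.
  by have := @replace_coord_stretches j 0 (col j T); rewrite mxE; apply.
move/is_trig_mxP : trT => T0.
have -> : `|\det T| = `|T 0 0| * `|T 1 1| * `|T 2 2| * `|T 3 3|.
  by rewrite detT !big_ord_recl big_ord0 mulr1 !normrM !mulrA;
    congr (`|T _ _| * `|T _ _| * `|T _ _| * `|T _ _|); apply: val_inj.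
have := stretches_comp (stretches_comp (stretches_comp (st 0) (st 1)) (st 2)) (st 3).
apply: stretches_ext => x; apply/rowP => i /=.
rewrite [RHS]mxE; move: i; apply: ord4P.
- by do !rewrite replace_coord0E ?sum4 /=; rewrite !mxE.
- by do !rewrite replace_coord0E ?sum4 /=; rewrite !mxE (T0 0 1) // !mulr0.
- by do !rewrite replace_coord0E ?sum4 /=; rewrite !mxE (T0 0 2) ?(T0 1 2) // !mulr0.
- by do !rewrite replace_coord0E ?sum4 /=;
    rewrite !mxE (T0 0 3) ?(T0 1 3) ?(T0 2 3) // !mulr0.
Qed.

(** Reversing the coordinates makes T lower triangular. *)
Lemma upper_stretches T : is_trig_mx T^T -> T \in unitmx ->
  stretches (fun x => x *m T) `|\det T|.
Proof.
move=> trT uT.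
pose s : 'S_4 := perm (@rev_ord_inj 4).
pose T' := row_perm s (col_perm s T).
have trT' : is_trig_mx T'.
  apply/is_trig_mxP => i j ij; move/is_trig_mxP : trT => /(_ (rev_ord j) (rev_ord i)).
  rewrite !mxE !permE; apply; rewrite /= ltn_sub2lE //.
have uT' : T' \in unitmx.
  by rewrite /T' row_permE col_permE !unitmx_mul uT !unitmx_perm.
have TE : (fun x => x *m T) =1 col_perm s \o (fun x => x *m T') \o col_perm s.
  move=> x; rewrite /= /T' !col_permE row_permE.
  have sV : s^-1%g = s.
    by apply/permP => i; apply: (@perm_inj _ s); rewrite permKV !permE rev_ordK.
  rewrite sV !mulmxA -(mulmxA x) -perm_mxM.
  have ss : (s * s)%g = 1%g by rewrite -{1}sV mulVg.
  by rewrite ss perm_mx1 mulmx1 -(mulmxA _ (perm_mx s)) -perm_mxM ss perm_mx1 mulmx1.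
have detT' : `|\det T'| = `|\det T|.
  rewrite /T' row_permE col_permE !det_mulmx !det_perm !normrM !normrX normrN1 !expr1n.
  by rewrite mul1r mulr1.
have := stretches_comp (stretches_comp (permute_stretches s) (lower_stretches trT' uT'))
   (permute_stretches s).
by rewrite mul1r mulr1 detT'; apply: stretches_ext => x; rewrite TE.
Qed.

Lemma perm_lower_upper n (A : 'M[R]_n.+1) : exists (s : 'S_n.+1) (T U : 'M[R]_n.+1),
  [/\ perm_mx s *m A = T *m U, is_trig_mx T & is_trig_mx U^T].
Proof.
have /is_perm_mxP[s] := cormen_lup_perm A.
move: (cormen_lup_correct A) (@cormen_lup_lower _ _ A) (@cormen_lup_upper _ _ A).
case: (cormen_lup A) => [[P T] U] /= PA Ttrig Utrig PE.
exists s, T, U; split; first by rewrite -PE.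
  by apply/is_trig_mxP => i j ij; rewrite Ttrig ?(ltnW ij) // -val_eqE ltn_eqF.
by apply/is_trig_mxP => i j ij; rewrite mxE Utrig.
Qed.

Lemma linear_stretches A : A \in unitmx -> stretches (fun x => x *m A) `|\det A|.
Proof.
move=> uA; have [s [L' [U [PA trL trU]]]] := perm_lower_upper A.
have AE : A = perm_mx s^-1%g *m L' *m U.
  by rewrite -mulmxA -PA mulmxA -perm_mxM mulVg perm_mx1 mul1mx.
have [uL uU] : L' \in unitmx /\ U \in unitmx.
  by move: uA; rewrite AE !unitmx_mul => /andP[/andP[_ ->] ->].
have := stretches_comp (stretches_comp (permute_stretches s) (lower_stretches trL uL))
   (upper_stretches trU uU).
have -> : 1 * `|\det L'| * `|\det U| = `|\det A|.
  rewrite AE !det_mulmx det_perm !normrM normrX normrN1 expr1n; ring.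
by apply: stretches_ext => x; rewrite /= AE col_permE !mulmxA.
Qed.

Lemma affine_stretches A b : A \in unitmx ->
  stretches (fun x => x *m A + b) `|\det A|.
Proof.
by move=> uA; have := stretches_comp (linear_stretches uA) (translate_stretches b);
  rewrite mulr1.
Qed.

Definition corner : set 'rV[R]_4 :=
  [set x | (forall i, 0 <= x 0 i) /\ \sum_i x 0 i <= 1].

Lemma corner_measurable : measurable4 corner.
Proof.
pose c i (t : L * L * L * L) : R := row4 t 0 i.
have mc i : measurable_fun setT (c i).
  have m1 : measurable_fun setT (fun t : L * L * L * L => t.1.1.1 : R).
    by apply: measurableT_comp => //; apply: measurableT_comp.
  have m2 : measurable_fun setT (fun t : L * L * L * L => t.1.1.2 : R).
    by apply: measurableT_comp => //; apply: measurableT_comp.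
  have m3 : measurable_fun setT (fun t : L * L * L * L => t.1.2 : R).
    by apply: measurableT_comp => //.
  have m4 : measurable_fun setT (fun t : L * L * L * L => t.2 : R) by exact: measurable_snd.
  have cE : c i = (fun t => [:: t.1.1.1; t.1.1.2; t.1.2; t.2]`_i).
    by apply/funext => t; rewrite /c mxE.
  by rewrite cE; move: i {cE}; apply: ord4P.
rewrite /measurable4; have -> : @row4 R @^-1` corner =
    (\bigcap_(i in [set: 'I_4]) (c i @^-1` `[0, +oo[%classic)) `&`
    ((fun t => c 0 t + c 1 t + c 2 t + c 3 t) @^-1` `]-oo, 1]%classic).
  apply/seteqP; split=> t; rewrite /corner /= in_itv /= sum4.
    by move=> [h0 h1]; split=> // i _; rewrite /= in_itv /= andbT; apply: h0.
  by move=> [h0 h1]; split=> // i; have := h0 i I; rewrite /= in_itv /= andbT.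
apply: measurableI.
  apply: fin_bigcap_measurable => // i _; rewrite -[X in measurable X]setTI.
  by apply: mc => //; apply: measurable_itv.
rewrite -[X in measurable X]setTI.
apply: (_ : measurable_fun setT (fun t => c 0 t + c 1 t + c 2 t + c 3 t)) => //.
by do ![apply: measurable_funD => //].
Qed.

(** The affine map that sends the simplex to the corner of the unit cube has
    linear part inverse to the edges. *)
Lemma lebesgue4_simplex (v : 'M[R]_(5, 4)) : affinely_independent v ->
  (lebesgue4 (simplex v) = `|\det (edges v)|%:E * lebesgue4 corner)%E.
Proof.
move=> fv; set E := edges v.
have uE : E \in unitmx by rewrite -row_free_unit.
pose v0 := row ord0 v.
pose h x := x *m invmx E + (- (v0 *m invmx E)).
have uE' : invmx E \in unitmx by rewrite unitmx_inv.
have sh : stretches h `|\det (invmx E)| by apply: affine_stretches.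
have [_ <-] := sh _ corner_measurable.
have -> : h @^-1` corner = simplex v.
  have rowsE (w : 'rV[R]_5) : \sum_i w 0 i = 1 ->
      w *m v = v0 + (\row_i w 0 (lift ord0 i)) *m E.
    rewrite big_ord_recl => /(canRL (addrK _)) w0; apply/rowP => k.
    rewrite !mxE big_ord_recl w0 mulrBl mul1r -addrA; congr (_ + _).
    rewrite mulr_suml addrC -sumrB; apply: eq_bigr => i _.
    by rewrite !mxE mulrBr.
  have hE c : h (v0 + c *m E) = c.
    by rewrite /h mulmxDl -(mulmxA c) mulmxV // mulmx1 addrC addKr.
  apply/seteqP; split=> x /=.
    move=> [c0 c1]; pose c := h x.
    pose w : 'rV[R]_5 := \row_i (if unlift ord0 i is Some j then c 0 j else 1 - \sum_j c 0 j).
    have wl i : w 0 (lift ord0 i) = c 0 i by rewrite mxE liftK.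
    have w0 : w 0 ord0 = 1 - \sum_j c 0 j by rewrite mxE unlift_none.
    have w1 : \sum_i w 0 i = 1.
      by rewrite big_ord_recl; under eq_bigr do rewrite wl; rewrite w0 subrK.
    exists w; last first.
      rewrite rowsE // (_ : \row_i _ = c); last by apply/rowP => i; rewrite mxE wl.
      by rewrite /c /h mulmxDl mulmxKV // mulNmx mulmxKV // addrC subrK.
    split=> // i; case: (unliftP ord0 i) => [j ->|->]; first by rewrite wl.
    by rewrite w0 subr_ge0.
  move=> [w [w0 w1] <-]; rewrite rowsE // hE; split=> [i|]; first by rewrite mxE.
  rewrite -w1 [leRHS]big_ord_recl; under eq_bigr do rewrite mxE.
  by rewrite lerDr.
rewrite muleA -EFinM -normrM -det_mulmx mulmxV // det1 normr1 mul1e //.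
Qed.
End Stretch.

(** * Interior points and lengths of simplices *)

Section RowBalls.
Variables (R : realType) (m : nat).
Implicit Types (K : set 'rV[R]_m.+1) (x y z : 'rV[R]_m.+1) (e t : R).

Lemma interior_ball K x : interior K x ->
  exists2 e, 0 < e & forall y, (forall k, `|y 0 k - x 0 k| < e) -> K y.
Proof.
move=> /nbhs_ballP[e /= e0 he]; exists e => // y hy; apply: he.
by split=> // i k; rewrite (ord1 i) /ball /= distrC.
Qed.

Lemma ball_interior K x e : 0 < e ->
  (forall y, (forall k, `|y 0 k - x 0 k| < e) -> K y) -> interior K x.
Proof.
move=> e0 he; apply/nbhs_ballP; exists e => //= y [_ hy]; apply: he => k.
by have := hy 0 k; rewrite /ball /= distrC.
Qed.

(** Makes an interior point a mixture of a given point z and a point of K. *)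
Lemma extend_beyond K x z : interior K x ->
  exists2 t, 0 < t & K (x + t *: (x - z)).
Proof.
move=> /interior_ball[e e0 he].
pose s := 1 + \sum_k `|x 0 k - z 0 k|.
have s0 : 0 < s by rewrite ltr_wpDr ?sumr_ge0.
exists (e / s / 2); first by rewrite !divr_gt0.
apply: he => k; rewrite !mxE addrAC subrr add0r normrM gtr0_norm ?divr_gt0 //.
have ks : `|x 0 k - z 0 k| <= s.
  rewrite /s (bigD1 k) //= addrCA lerDl addr_ge0 //.
  by apply: sumr_ge0.
have es : 0 < e / s by rewrite divr_gt0.
have : e / s * s = e by rewrite divfK ?gt_eqF.
by have := normr_ge0 (x 0 k - z 0 k); nra.
Qed.

End RowBalls.

Section Simplex.
Variables (R : realType) (n : nat) (v : 'M[R]_(n.+2, n.+1)).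
Implicit Types (w : 'rV[R]_n.+2).

(** K is a right inverse of the barycentric parametrisation on vectors, so a
    small displacement of the point changes all coordinates by little. *)
Lemma interior_simplex w : affinely_independent v ->
  (forall i, 0 < w 0 i) -> \sum_i w 0 i = 1 -> interior (simplex v) (w *m v).
Proof.
move=> fv w0 w1.
have uE : edges v \in unitmx by rewrite -row_free_unit.
pose D : 'M[R]_(n.+1, n.+2) := \matrix_i (delta_mx 0 (lift ord0 i) - delta_mx 0 ord0).
have Dv : D *m v = edges v.
  by apply/row_matrixP => i; rewrite row_mul !rowK mulmxBl -!rowE.
have D1 c : \sum_j (c *m D) 0 j = 0.
  transitivity ((c *m D *m const_mx 1) 0 (0 : 'I_1)).
    by rewrite mxE; apply: eq_bigr => j _; rewrite [X in _ = _ * X]mxE mulr1.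
  rewrite -mulmxA (_ : D *m const_mx 1 = 0) ?mulmx0 ?mxE //.
  apply/row_matrixP => i; rewrite row_mul rowK mulmxBl -!rowE row0.
  by apply/rowP => j; rewrite !mxE subrr.
pose K := invmx (edges v) *m D.
have Kv : K *m v = 1%:M by rewrite -mulmxA Dv mulVmx.
pose s := 1 + \sum_i \sum_j `|K i j|.
have s0 : 0 < s by rewrite ltr_wpDr // sumr_ge0 // => i _; rewrite sumr_ge0.
have [i0 hi0] : exists i0, forall i, w 0 i0 <= w 0 i.
  by have [i0 _ h] := @arg_minP _ _ _ ord0 xpredT (w 0) isT; exists i0 => i; apply: h.
apply: (ball_interior (e := w 0 i0 / s)); first by rewrite divr_gt0.
move=> y hy; pose d := y - w *m v.
exists (w + d *m K); last first.
  by rewrite mulmxDl -mulmxA Kv mulmx1 /d addrC subrK.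
split; last first.
  under eq_bigr do rewrite mxE.
  by rewrite big_split /= w1 mulmxA D1 addr0.
move=> i; rewrite mxE.
suff : `|(d *m K) 0 i| <= w 0 i0.
  by rewrite ler_norml; have := hi0 i; lra.
have -> : w 0 i0 = w 0 i0 / s * s by rewrite divfK ?gt_eqF.
rewrite mxE (le_trans (ler_norm_sum _ _ _)) //.
apply: (@le_trans _ _ (\sum_j w 0 i0 / s * `|K j i|)).
  apply: ler_sum => j _; rewrite normrM ler_wpM2r //.
  by apply: ltW; have := hy j; rewrite /d !mxE.
have h0 : 0 <= w 0 i0 / s by rewrite ltW // divr_gt0.
rewrite -mulr_sumr ler_wpM2l //.
apply: (@le_trans _ _ (\sum_j \sum_k `|K j k|)); last by rewrite /s lerDr.
apply: ler_sum => j _; rewrite (bigD1 i) //= lerDl; exact: sumr_ge0.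
Qed.

Section Length.
Variable f : {scalar 'rV[R]_n.+1}.

Lemma scalar_combination w : f (w *m v) = \sum_i w 0 i * f (row i v).
Proof.
rewrite mulmx_sum_row linear_sum; apply: eq_bigr => i _.
by rewrite linearZ.
Qed.

Lemma vertex_simplex i : simplex v (row i v).
Proof.
exists (delta_mx 0 i); last by rewrite -rowE.
split=> [j|]; first by rewrite mxE ler0n.
rewrite (bigD1 i) //= mxE !eqxx big1 ?addr0 // => j /negbTE ji.
by rewrite mxE eqxx ji.
Qed.

Lemma scalar_simplex_le (M : R) x : (forall i, f (row i v) <= M) -> simplex v x -> f x <= M.
Proof.
move=> hM [w [w0 w1] <-]; rewrite scalar_combination.
have -> : M = \sum_i w 0 i * M by rewrite -mulr_suml w1 mul1r.
by apply: ler_sum => i _; rewrite ler_wpM2l.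
Qed.

Lemma scalar_simplex_ge (M : R) x : (forall i, M <= f (row i v)) -> simplex v x -> M <= f x.
Proof.
move=> hM [w [w0 w1] <-]; rewrite scalar_combination.
have -> : M = \sum_i w 0 i * M by rewrite -mulr_suml w1 mul1r.
by apply: ler_sum => i _; rewrite ler_wpM2l.
Qed.

Lemma length_alongE p m : (forall i, f (row i v) <= f (row p v)) ->
  (forall i, f (row m v) <= f (row i v)) ->
  length_along f (simplex v) = f (row p v) - f (row m v).
Proof.
move=> hp hm; rewrite /length_along; congr (_ - _); apply/le_anti/andP; split.
- apply: ge_sup; first by exists (f (row p v)), (row p v) => //; apply: vertex_simplex.
  by move=> _ [x Sx <-]; apply: scalar_simplex_le.
- apply: ub_le_sup; last by exists (row p v) => //; apply: vertex_simplex.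
  by exists (f (row p v)) => _ [x Sx <-]; apply: scalar_simplex_le.
- apply: ge_inf; last by exists (row m v) => //; apply: vertex_simplex.
  by exists (f (row m v)) => _ [x Sx <-]; apply: scalar_simplex_ge.
- apply: lb_le_inf; first by exists (f (row m v)), (row m v) => //; apply: vertex_simplex.
  by move=> _ [x Sx <-]; apply: scalar_simplex_ge.
Qed.

Lemma length_along_ends : exists p m,
  [/\ forall i, f (row i v) <= f (row p v), forall i, f (row m v) <= f (row i v) &
      length_along f (simplex v) = f (row p v) - f (row m v)].
Proof.
have [p _ hp] := @arg_maxP _ _ _ ord0 xpredT (fun i => f (row i v)) isT.
have [m _ hm] := @arg_minP _ _ _ ord0 xpredT (fun i => f (row i v)) isT.
exists p, m; split=> [i|i|]; [exact: hp|exact: hm|].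
by apply: length_alongE => i; [apply: hp|apply: hm].
Qed.
End Length.
End Simplex.

(** * From the simplex to its middle slice *)

Section IntegralSimplex.
Variable R : realType.

Lemma edges_mul n (A : 'M[R]_(n.+1, n)) (B : 'M[R]_n) : edges (A *m B) = edges A *m B.
Proof.
by apply/row_matrixP => i; rewrite row_mul !rowK mulmxBl !row_mul.
Qed.

(** Subtract the first row from the others and expand along the column of
    ones. *)
Lemma det_edges (A : 'M[R]_(4 + 1, 4)) :
  `|\det (row_mx A (const_mx 1) : 'M[R]_(4 + 1))| = `|\det (edges (A : 'M[R]_(5, 4)))|.
Proof.
pose D : 'M[R]_5 := \matrix_(i, j) ((i == j)%:R - ((i != 0) && (j == 0))%:R).
have trD : is_trig_mx D.
  apply/is_trig_mxP => i j ij; rewrite mxE.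
  have -> : (i == j) = false by rewrite -val_eqE ltn_eqF.
  have -> : (j == 0) = false by rewrite -val_eqE /= gtn_eqF // (leq_ltn_trans _ ij).
  by rewrite andbF subrr.
have detD : \det D = 1.
  rewrite det_trig // big1 // => i _; rewrite mxE eqxx.
  by case: (i == 0); rewrite ?andbF subr0.
set M := row_mx _ _.
have DME i j : (D *m (M : 'M[R]_5)) i j = M i j - (i != 0)%:R * M 0 j.
  rewrite mxE; under eq_bigr do rewrite mxE mulrBl.
  rewrite sumrB; congr (_ - _).
    rewrite (bigD1 i) //= eqxx mul1r big1 ?addr0 // => k /negbTE ki.
    by rewrite eq_sym ki mul0r.
  rewrite (bigD1 0) //= eqxx andbT big1 ?addr0 // => k /negbTE k0.
  by rewrite k0 andbF mul0r.
have -> : \det M = \det (D *m (M : 'M[R]_5)) by rewrite det_mulmx detD mul1r.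
have Mlast i : M i ord_max = 1.
  have -> : ord_max = rshift 4 (0 : 'I_1) by apply: val_inj.
  by rewrite row_mxEr mxE.
have ME i (j : 'I_4) : M i (lift ord_max j) = A i j.
  have -> : lift ord_max j = lshift 1 j.
    by apply: val_inj; rewrite /= /bump leqNgt ltn_ord.
  by rewrite row_mxEl.
rewrite (expand_det_col _ ord_max) (bigD1 0) //= big1 ?addr0 => [|i /negbTE i0].
  rewrite DME Mlast eqxx mul0r subr0 mul1r /cofactor normrM normrX normrN1 expr1n mul1r.
  congr (`|\det _|); apply/matrixP => i j.
  rewrite 2!mxE DME !ME !mxE.
  have -> : lift 0 i != 0 :> 'I_5 by rewrite eq_sym neq_lift.
  by rewrite mul1r; congr (_ - _); congr (A _ _); apply: val_inj.
by rewrite DME !Mlast i0 mul1r subrr mul0r.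
Qed.

Lemma mxvol_edges (Q : 'M[int]_(5, 3 + 1)) (m : int) (f : 'I_5 -> int) :
  (forall i, f i = Q i (rshift 3 0) - m) ->
  mxvol R f (lsubmx Q) = `|\det (edges (Q^R : 'M[R]_(5, 4)))|.
Proof.
move=> fE.
pose S : 'M[int]_(4 + 1) :=
  block_mx 1%:M 0 (\row_(j < 4) (if j == 3 then - m else 0)) 1%:M.
have detS : \det S = 1 by rewrite det_lblock !det1 mulr1.
rewrite mxvolE -(det_edges Q^R).
have -> : row_mx (Q^R : 'M[R]_(5, 4)) (const_mx 1) =
    (row_mx Q (const_mx 1) : 'M[int]_(4 + 1))^R.
  by rewrite map_row_mx map_const_mx.
rewrite det_map_mx -intr_norm.
set M := row_mx _ _; set N := row_mx _ _.
have -> : M = N *m S; last by rewrite det_mulmx detS mulr1.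
rewrite /N mul_row_block !mulmx0 mulmx1 mulmx1 add0r.
have E (k : 'I_5) (l : 'I_4) : (const_mx 1 *m \row_(j < 4) (if j == 3 then - m else 0)) k l =
   (if l == 3 then - m else 0).
  by rewrite mxE big_ord1 !mxE mul1r.
have ML i (k : 'I_3) : M i (lshift 2 k) = Q i (lshift 1 k) by rewrite row_mxEl mxE.
have MR i (k : 'I_2) : M i (rshift 3 k) = [:: f i; 1]`_k by rewrite row_mxEr mxE.
set X := Q + _; set N' := row_mx _ _.
have NL i (k : 'I_4) : N' i (lshift 1 k) = Q i k + (if k == 3 then - m else 0).
  by rewrite row_mxEl mxE E.
have NR i (k : 'I_1) : N' i (rshift 4 k) = 1 by rewrite row_mxEr mxE.
have pick i (j : 'I_5) (k k' : 'I_5) : val j = val k -> val j = val k' ->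
    M i k = N' i k' -> M i j = N' i j.
  by move=> /val_inj -> /val_inj ->.
apply/matrixP => i; apply: ord5P.
- by apply: (pick _ _ (lshift 2 (0 : 'I_3)) (lshift 1 (0 : 'I_4))) => //; rewrite ML NL addr0;
    congr (Q i _); apply: val_inj.
- by apply: (pick _ _ (lshift 2 (1 : 'I_3)) (lshift 1 (1 : 'I_4))) => //; rewrite ML NL addr0;
    congr (Q i _); apply: val_inj.
- by apply: (pick _ _ (lshift 2 (2 : 'I_3)) (lshift 1 (2 : 'I_4))) => //; rewrite ML NL addr0;
    congr (Q i _); apply: val_inj.
- by apply: (pick _ _ (rshift 3 (0 : 'I_2)) (lshift 1 (3 : 'I_4))) => //; rewrite MR NL /= fE;
    congr (Q i _ - m); apply: val_inj.
- by apply: (pick _ _ (rshift 3 (1 : 'I_2)) (rshift 4 (0 : 'I_1))) => //; rewrite MR NR.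
Qed.

Lemma strict_average (g : 'I_5 -> int) (w : 'rV[R]_5) (a : int) i :
  positive w -> \sum_i w 0 i = 1 -> (forall j, a <= g j) -> a < g i -> (a%:~R < ev w g).
Proof.
move=> w0 w1 ag agi.
have -> : a%:~R = \sum_i w 0 i * a%:~R :> R by rewrite -mulr_suml w1 mul1r.
rewrite /ev (bigD1 i) //= [ltRHS](bigD1 i) //= ltr_leD //.
  by rewrite ltr_pM2l // ltr_int.
by apply: ler_sum => j _; rewrite ler_wpM2l ?ler_int // ltW.
Qed.

Lemma integer_row_mul k n (x : 'rV[R]_k) (A : 'M[int]_(k, n)) :
  (forall i, x 0 i \is a Num.int) -> forall j, (x *m (A^R : 'M[R]_(k, n))) 0 j \is a Num.int.
Proof.
move=> xZ j; rewrite mxE rpred_sum // => i _.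
by rewrite rpredM // mxE intr_int.
Qed.

(** The three first columns of P U are the coordinates z, x, y of the slice
    problem and the last one is f + m. A positive point with integral last
    coordinate is on the level m, because this is the only integer strictly
    between the extreme values m - 1 and m + 1. *)
Lemma integer_bound (P : 'M[int]_(5, 3 + 1)) (U : 'M[int]_(3 + 1)) (p n : 'I_5) (m : int) :
  let h i := (P *m U) i (rshift 3 0) in
  U \in unitmx -> (forall i, m - 1 <= h i <= m + 1) -> h p = m + 1 -> h n = m - 1 ->
  (forall w : 'rV[R]_5, positive w -> \sum_i w 0 i = 1 ->
     (forall k, (w *m (P^R : 'M[R]_(5, 3 + 1))) 0 k \is a Num.int) -> False) ->
  (forall W : 'M[int]_(3 + 1), W \in unitmx ->
     exists w : 'rV[R]_5, [/\ positive w, \sum_i w 0 i = 1 &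
       forall k, k != 0 -> (w *m ((P *m W)^R : 'M[R]_(5, 3 + 1))) 0 k \is a Num.int]) ->
  `|\det (edges (P^R : 'M[R]_(5, 4)))| <= 5184.
Proof.
move=> h uU h_range hp hn hollow shadow.
pose Q := P *m U; pose q := lsubmx Q; pose f i := h i - m.
have evh (w : 'rV[R]_5) : \sum_i w 0 i = 1 -> ev w h = ev w f + m%:~R.
  move=> w1; have -> : m%:~R = \sum_i w 0 i * m%:~R :> R by rewrite -mulr_suml w1 mul1r.
  rewrite /ev -big_split; apply: eq_bigr => i _ /=.
  by rewrite /f intrB mulrBr subrK.
have -> : `|\det (edges (P^R : 'M[R]_(5, 4)))| = mxvol R f q.
  rewrite (mxvol_edges (m := m)) // map_mxM edges_mul det_mulmx normrM det_map_mx.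
  have -> : `|(\det U)%:~R| = 1 :> R.
    by move: uU; rewrite unitmxE -intr_norm => /orP[] /eqP ->.
  by rewrite mulr1.
apply: (slice_bound (p := p) (m := n)).
- move=> i; have /andP[] := h_range i; rewrite /f.
  have [->|h1] := eqVneq (h i) (m + 1); first by move=> _ _; apply: Or32; ring.
  have [->|h2] := eqVneq (h i) (m - 1); first by move=> _ _; apply: Or33; ring.
  move=> a b; apply: Or31; move: h1 h2 a b; move: (h i) => x; clear; lia.
- by rewrite /f hp; ring.
- by rewrite /f hn; ring.
- move=> w [w0 w1 wf] pw wq; apply: (hollow w) => //; first by rewrite -ev_one.
  have Pinv : P = Q *m invmx U by rewrite mulmxK.
  rewrite Pinv map_mxM mulmxA; apply: integer_row_mul => j.
  case: (split_ordP j) => k ->.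
    rewrite mulmx_ev; have := wq k; rewrite mulmx_ev /ev.
    by under eq_bigr do rewrite mxE.
  rewrite mulmx_ev (ord1 k); have := evh w; rewrite -ev_one wf add0r /ev => -> //.
- move=> U3 uU3; pose W : 'M[int]_(3 + 1) := U *m block_mx U3 0 0 1%:M.
  have uW : W \in unitmx.
    by rewrite unitmx_mul uU unitmxE det_lblock det1 mulr1 -unitmxE.
  have PW : P *m W = row_mx (q *m U3) (rsubmx Q).
    by rewrite mulmxA -/Q -[in LHS](hsubmxK Q) mul_row_block !mulmx0 mulmx1 addr0 add0r.
  have [w [pw w1 wZ]] := shadow W uW.
  exists w; split=> //; last first.
    move=> k k0; have := wZ (lshift 1 k).
    rewrite mulmx_ev PW => /(_ _).
    have -> : ev w (fun i => row_mx (q *m U3) (rsubmx Q) i (lshift 1 k)) =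
        ev w (fun i => (q *m U3) i k).
      by apply: eq_bigr => i _; rewrite row_mxEl.
    by rewrite mulmx_ev; apply; apply: contra k0 => /eqP /(congr1 val) /= k0; apply/eqP/val_inj.
  split=> [i||]; [by rewrite ltW|by rewrite ev_one|].
  have /intrP[z zE] : ev w h \is a Num.int.
    have := wZ (rshift 3 0) isT; rewrite mulmx_ev PW /ev.
    under eq_bigr do rewrite row_mxEr mxE.
    by [].
  have lo : (m - 1)%:~R < ev w h.
    apply: (@strict_average _ _ _ p) => // [j|]; first by case/andP: (h_range j).
    by rewrite hp; lia.
  have hi : (- (m + 1))%:~R < ev w (fun i => - h i).
    apply: (@strict_average _ _ _ n) => // [j|]; first by rewrite lerN2; case/andP: (h_range j).
    by rewrite hn; lia.
  rewrite ev_opp intrN ltrN2 zE ltr_int in hi; rewrite zE ltr_int in lo.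
  have zm : z = m by lia.
  by have := evh w w1; rewrite zE zm => /eqP; rewrite eq_sym -subr_eq0 addrK => /eqP.
Qed.
End IntegralSimplex.

(** * Lattice bases and normalised volume *)

Section Lattices.
Variables (R : realType) (n : nat).
Implicit Types (B E : 'M[R]_n) (x y : 'rV[R]_n).

Lemma zspanD B x y : zspan B x -> zspan B y -> zspan B (x + y).
Proof.
by move=> [a _ <-] [b _ <-]; exists (a + b) => //; rewrite map_mxD mulmxDl.
Qed.

Lemma zspanB B x y : zspan B x -> zspan B y -> zspan B (x - y).
Proof.
by move=> [a _ <-] [b _ <-]; exists (a - b) => //; rewrite map_mxB mulmxBl.
Qed.

Lemma zspan_row B i : zspan B (row i B).
Proof. by exists (delta_mx 0 i) => //; rewrite map_delta_mx [RHS]rowE. Qed.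

Lemma zspan_rows m B (A : 'M[R]_(m, n)) : (forall i, zspan B (row i A)) ->
  exists P : 'M[int]_(m, n), A = (P^R : 'M[R]_(m, n)) *m B.
Proof.
move=> zE; exists (\matrix_i xget 0 [set a | map_mx intr a *m B = row i A]).
apply/row_matrixP => i; rewrite row_mul -map_row rowK.
have [a _ aE] := zE i.
by case: xgetP => [b _ <-//|/(_ a)/(_ aE)].
Qed.

Lemma basis_change B E : E \in unitmx -> (forall i, zspan B (row i E)) ->
  (forall i, zspan E (row i B)) -> `|\det E| = `|\det B|.
Proof.
move=> uE /zspan_rows[G EG] /zspan_rows[H BH].
have GH : G *m H = 1%:M.
  have GHR : (G *m H)^R = (1%:M : 'M[int]_n)^R :> 'M[R]_n.
    by rewrite map_mxM map_mx1 -(mulmxK uE (G^R *m H^R)) -(mulmxA (G^R)) -BH -EG mulmxV.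
  apply/matrixP => i j; apply: (@intr_inj R).
  by have /matrixP/(_ i j) := GHR; rewrite mxE [RHS]mxE.
have [uG _] := mulmx1_unit GH.
rewrite EG det_mulmx normrM det_map_mx -intr_norm.
by move: uG; rewrite unitmxE => /orP[] /eqP ->; rewrite mul1r.
Qed.
End Lattices.

Section Unimodular.
Variables (R : realType) (B : 'M[R]_4).
Hypothesis freeB : row_free B.
Let uB : B \in unitmx. Proof. by rewrite -row_free_unit. Qed.

(** The edges of a unimodular simplex form a basis of the lattice. *)
Lemma unimodular_det (u : 'M[R]_(5, 4)) : unimodular (zspan B) u ->
  `|\det (edges u)| = `|\det B|.
Proof.
move=> [fu LE]; apply: basis_change; first by rewrite -row_free_unit.
  move=> i; have -> : row i (edges u) = (row ord0 u + row i (edges u)) - row ord0 u.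
    by rewrite addrC addKr.
  apply: zspanB.
    by rewrite LE; exists (row i (edges u)) => //; apply: zspan_row.
  by rewrite LE; exists 0; rewrite ?addr0 //; exists 0 => //; rewrite map_mx0 mul0mx.
move=> i.
have : zspan B (row ord0 u + row i B).
  apply: zspanD; last exact: zspan_row.
  by rewrite LE; exists 0; rewrite ?addr0 //; exists 0 => //; rewrite map_mx0 mul0mx.
by rewrite LE => -[y Ey /addrI <-].
Qed.

Lemma unimodular_exists : exists u : 'M[R]_(5, 4), unimodular (zspan B) u.
Proof.
pose u : 'M[R]_(1 + 4, 4) := col_mx 0 B; exists u.
have u0 : row ord0 (u : 'M[R]_(5, 4)) = 0.
  have -> : ord0 = lshift 4 (0 : 'I_1) by apply: val_inj.
  by apply/rowP => k; rewrite [LHS]mxE [LHS](col_mxEu (0 : 'M[R]_(1, 4)) B) !mxE.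
have uE : edges (u : 'M[R]_(5, 4)) = B.
  apply/row_matrixP => i; rewrite rowK u0 subr0.
  have -> : lift ord0 i = rshift 1 i by apply: val_inj.
  by apply/rowP => k; rewrite [LHS]mxE [LHS](col_mxEd (0 : 'M[R]_(1, 4)) B) [RHS]mxE.
split; first by rewrite /affinely_independent uE.
rewrite uE u0; apply/seteqP; split=> [x Bx|x [y By <-]]; last by rewrite add0r.
by exists x => //; rewrite add0r.
Qed.

(** The Lebesgue measure of the corner cancels; were it 0 or infinite, the
    normalising factor would make Vol vanish. *)
Lemma Vol_simplex_le (v : 'M[R]_(5, 4)) (P : 'M[int]_(5, 4)) (N : R) :
  0 <= N -> affinely_independent v -> v = P^R *m B ->
  `|\det (edges (P^R : 'M[R]_(5, 4)))| <= N -> (Vol (zspan B) (simplex v) <= N%:E)%E.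
Proof.
move=> N0 fv vE detP.
rewrite /Vol; set u := get _.
have unu : unimodular (zspan B) u by apply: getPex; apply: unimodular_exists.
have [fu _] := unu.
rewrite !lebesgue4_simplex // (unimodular_det unu) vE edges_mul det_mulmx normrM.
have b0 : 0 < `|\det B| by rewrite normr_gt0 -unitfE -unitmxE.
case: (lebesgue4 _) => [c||] /=.
- rewrite -!EFinM lee_fin; have [->|c0] := eqVneq c 0.
    by rewrite mulr0 mul0r.
  by rewrite -[_ * _ * c]mulrA mulfK // mulf_neq0 // gt_eqF.
- by rewrite [X in fine X]gt0_muley ?lte_fin //= invr0 mule0 lee_fin.
- by rewrite [X in fine X]gt0_muleNy ?lte_fin //= invr0 mule0 lee_fin.
Qed.
End Unimodular.

(** * Translation of the hypotheses into integer coordinates *)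

Section ColumnFunctional.
Variables (R : realType) (n : nat) (c : 'cV[R]_n).

Definition column_functional (x : 'rV[R]_n) : R := (x *m c) 0 0.

Let column_functional_is_scalar : scalar column_functional.
Proof. by move=> a x y; rewrite /column_functional mulmxDl -scalemxAl !mxE. Qed.

HB.instance Definition _ := GRing.isLinear.Build R 'rV[R]_n R *%R
  column_functional column_functional_is_scalar.
End ColumnFunctional.

Section Reduction.
Variables (R : realType) (B : 'M[R]_4) (v : 'M[R]_(5, 4)) (P : 'M[int]_(5, 4)).
Hypotheses (freeB : row_free B) (fv : affinely_independent v) (vE : v = P^R *m B).
Let uB : B \in unitmx. Proof. by rewrite -row_free_unit. Qed.

Lemma zspan_integer (x : 'rV[R]_4) : (forall k, x 0 k \is a Num.int) -> zspan B (x *m B).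
Proof.
move=> xZ; exists (\row_k Num.floor (x 0 k)) => //; congr (_ *m _).
by apply/rowP => k; rewrite !mxE; apply/eqP; rewrite -intrEfloor.
Qed.

Lemma hollow_weights : hollow (zspan B) (simplex v) ->
  forall w : 'rV[R]_5, positive w -> \sum_i w 0 i = 1 ->
    (forall k, (w *m (P^R : 'M[R]_(5, 4))) 0 k \is a Num.int) -> False.
Proof.
move=> hollow w pw w1 wZ.
have : (interior (simplex v) `&` zspan B) (w *m v).
  split; first exact: interior_simplex.
  by rewrite vE mulmxA; apply: zspan_integer.
by rewrite [_ `&` _]hollow.
Qed.

(** Project to the last three coordinates in the lattice basis given by W: the
    image of the lattice is Z^3, so the image of the simplex has an interior
    lattice point y. As y lies strictly between the image of the barycentre and
    another point of the image, it is the image of a positive point. *)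
Lemma shadow_weights : ~ projects_to_hollow3 (zspan B) (simplex v) ->
  forall W : 'M[int]_(1 + 3), W \in unitmx ->
  exists w : 'rV[R]_5, [/\ positive w, \sum_i w 0 i = 1 &
    forall k, (w *m ((P *m rsubmx W)^R : 'M[R]_(5, 3))) 0 k \is a Num.int].
Proof.
move=> noproj W uW.
pose M : 'M[R]_(4, 3) := invmx B *m (rsubmx W)^R.
have BM (x : 'rV[R]_4) : x *m B *m M = x *m (rsubmx W)^R by rewrite /M mulmxA mulmxK.
pose p := fun x : 'rV[R]_4 => mulmxr M x + 0.
have pE x : p x = x *m M by rewrite /p addr0.
have uWR : (W^R : 'M[R]_(1 + 3)) \in unitmx by rewrite unitmxE det_map_mx rmorph_unit // -unitmxE.
have onto : range p = [set: 'rV[R]_3].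
  apply/seteqP; split=> // y _.
  exists (row_mx (0 : 'M[R]_(1, 1)) y *m invmx (W^R : 'M[R]_(1 + 3)) *m B) => //.
  by rewrite pE BM map_rsubmx mulmx_rsub mulmxKV // row_mxKr.
have image : p @` zspan B = zspan (1%:M : 'M[R]_3).
  apply/seteqP; split=> [_ [_ [z _ <-] <-]|_ [y _ <-]].
    by exists (z *m rsubmx W) => //; rewrite pE BM mulmx1 map_mxM.
  pose z : 'rV[int]_(1 + 3) := row_mx (0 : 'M[int]_(1, 1)) y *m invmx W.
  exists (z^R *m B); first by exists z.
  by rewrite pE BM mulmx1 -map_mxM mulmx_rsub mulmxKV // row_mxKr.
have : interior (p @` simplex v) `&` (p @` zspan B) != set0.
  apply/eqP => empty; apply: noproj; exists (mulmxr M), 0; split=> //.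
  exists 3%N; exists 1%:M => //.
  by rewrite /row_free mxrank1.
move=> /set0P[y [yint yL]].
pose c : 'rV[R]_5 := const_mx 5^-1.
have c1 : \sum_i c 0 i = 1.
  under eq_bigr do rewrite mxE.
  by rewrite sumr_const card_ord -[LHS]mulr_natl mulfV // pnatr_eq0.
have [t t0 [x [w [w0 w1] <-] px]] := extend_beyond (p (c *m v)) yint.
pose s := (1 + t)^-1.
have s0 : 0 < s by rewrite invr_gt0 addr_gt0.
have st : s * (1 + t) = 1 by rewrite mulVf // gt_eqF // addr_gt0.
pose w' := s *: (w + t *: c).
exists w'; split.
- move=> i; rewrite !mxE mulr_gt0 // ltr_wpDl //.
  by rewrite mulr_gt0 // invr_gt0.
- under eq_bigr do rewrite 3!mxE.
  by rewrite -mulr_sumr big_split -mulr_sumr /= w1 c1 mulr1.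
have pw' : p (w' *m v) = y.
  have -> : y = s *: ((y + t *: (y - p (c *m v))) + t *: p (c *m v)).
    rewrite -addrA -scalerDr subrK -[in X in X + _](scale1r y) -scalerDl scalerA st.
    by rewrite scale1r.
  by rewrite -px !pE /w' -!scalemxAl !mulmxDl -!scalemxAl.
move: yL; rewrite image => -[z _ yE] k.
have -> : w' *m (P *m rsubmx W)^R = y.
  by rewrite -pw' pE vE (mulmxA w' P^R) BM map_mxM mulmxA.
by rewrite -yE mulmx1 mxE intr_int.
Qed.

(** A functional e realising the width is d times a primitive r. The
    functional r has width at most 2 / |d|, hence exactly 2 by minimality, and
    being primitive it is a column of a unimodular matrix, which is moved to the
    last place. *)
Lemma width_direction : has_width (zspan B) (simplex v) 2 ->
  exists (U : 'M[int]_(3 + 1)) (p m : 'I_5) (c : int),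
    let h i := ((P : 'M[int]_(5, 3 + 1)) *m U) i (rshift 3 0) in
    [/\ U \in unitmx, forall i, c - 1 <= h i <= c + 1, h p = c + 1 & h m = c - 1].
Proof.
move=> [[f [fL [x0 fx0] f2]] minimal].
have [e eE] : exists e : 'rV[int]_4, forall k, f (row k B) = (e 0 k)%:~R.
  exists (\row_k Num.floor (f (row k B))) => k; rewrite mxE; apply/esym/eqP.
  by rewrite -intrEfloor fL //; apply: zspan_row.
have fB (x : 'rV[R]_4) : f (x *m B) = \sum_k x 0 k * (e 0 k)%:~R.
  rewrite mulmx_sum_row linear_sum; apply: eq_bigr => k _.
  by rewrite linearZ /= eE.
have [S [d [uS eS]]] := unimodular_first_row e.
pose r := row 0 (invmx S).
have er k : e 0 k = d * r 0 k.
  have -> : e = d *: r by rewrite -(mulmxK uS e) eS -scalemxAl -rowE.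
  by rewrite mxE.
have d0 : d != 0.
  apply: contraNneq fx0 => d0; rewrite -(mulmxKV uB x0) fB big1 // => k _.
  by rewrite er d0 mul0r mulr0.
pose U : 'M[int]_(3 + 1) := col_perm (tperm ord0 ord_max) (invmx S)^T.
pose h i := ((P : 'M[int]_(5, 3 + 1)) *m U) i (rshift 3 0).
have hE i : h i = \sum_k P i k * r 0 k.
  rewrite /h mxE; apply: eq_bigr => k _; rewrite !mxE.
  have -> : rshift 3 0 = ord_max :> 'I_4 by apply: val_inj.
  by rewrite tpermR.
pose c : 'cV[R]_4 := invmx B *m (r^R)^T.
have gB (x : 'rV[R]_4) : column_functional c (x *m B) = \sum_k x 0 k * (r 0 k)%:~R.
  by rewrite /column_functional mulmxA mulmxK // mxE; apply: eq_bigr => k _; rewrite !mxE.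
have rowv i : row i v = (\row_k (P i k)%:~R) *m B.
  by rewrite vE row_mul; congr (_ *m _); apply/rowP => k; rewrite !mxE.
have gv i : column_functional c (row i v) = (h i)%:~R.
  rewrite rowv gB hE rmorph_sum; apply: eq_bigr => k _.
  by rewrite mxE rmorphM.
have fvE i : f (row i v) = (d * h i)%:~R.
  rewrite rowv fB hE mulr_sumr rmorph_sum; apply: eq_bigr => k _.
  by rewrite mxE er !rmorphM mulrCA.
have gL : dual_lattice (zspan B) (column_functional c).
  move=> _ [z _ <-]; rewrite /= gB rpred_sum // => k _.
  by rewrite mxE rpredM // intr_int.
have gN0 : nonzero_functional (column_functional c).
  exists x0; apply: contra fx0 => /eqP g0.
  have -> : f x0 = d%:~R * column_functional c x0.
    rewrite -(mulmxKV uB x0) fB gB mulr_sumr; apply: eq_bigr => k _.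
    by rewrite er intrM mulrCA.
  by rewrite g0 mulr0.
have := minimal (column_functional c) gL gN0.
have [p [m [hp hm ->]]] := length_along_ends v (column_functional c).
have [p0 [m0 [hp0 hm0 f2E]]] := length_along_ends v f.
move: f2; rewrite f2E !fvE /= !gv -!intrB => /eqP f2 g2.
have {}f2 : d * h p0 - d * h m0 = 2.
  by apply/eqP; rewrite -(eqr_int R).
have {}g2 : 2 <= h p - h m by rewrite -(ler_int R).
have {}hp i : h i <= h p by have := hp i; rewrite /= !gv ler_int.
have {}hm i : h m <= h i by have := hm i; rewrite /= !gv ler_int.
have {}hp0 i : d * h i <= d * h p0 by have := hp0 i; rewrite !fvE ler_int.
have {}hm0 i : d * h m0 <= d * h i by have := hm0 i; rewrite !fvE ler_int.
(* the values d * h range over an interval of length 2 *)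
have hpm : h p - h m = 2.
  have := hp0 p; have := hm0 p; have := hp0 m; have := hm0 m.
  clear - f2 g2 d0; move: (h p) (h m) (h p0) (h m0) f2 g2 d0 => a b a0 b0; nia.
exists U, p, m, (h m + 1); split.
- by rewrite /U col_permE unitmx_mul unitmx_perm unitmx_tr unitmx_inv uS.
- by move=> i; have := hp i; have := hm i; rewrite -/(h i); clear - hpm; lia.
- by rewrite -/(h p); clear - hpm; lia.
- by rewrite -/(h m); clear; lia.
Qed.
End Reduction.

Theorem theorem5p1 (R : realType) (L : set 'rV[R]_4)
    (hL : lattice_of_rank 4 L)
    (v : 'M[R]_(5, 4))
    (hv : lattice_simplex L v)
    (hhollow : hollow L (simplex v))
    (hwidth : has_width L (simplex v) 2)
    (hproj : ~ projects_to_hollow3 L (simplex v)) :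
  (Vol L (simplex v) <= 5184%:E)%E.
Proof.
case: hL hv hhollow hwidth hproj => B freeB -> [fv rowsL] hollow width noproj.
have [P vE] := zspan_rows rowsL.
apply: (Vol_simplex_le freeB (ler0n _ 5184) fv vE).
have [U [p [m [c [uU hrange hp hm]]]]] := width_direction freeB vE width.
apply: (integer_bound uU hrange hp hm).
  exact: (hollow_weights fv vE hollow).
move=> W uW.
have [w [pw w1 wZ]] := shadow_weights freeB vE noproj (W := (W : 'M[int]_(1 + 3))) uW.
exists w; split=> // k k0; have [k' ->] : exists k' : 'I_3, k = rshift 1 k'.
  case: (split_ordP (k : 'I_(1 + 3))) k0 => [j ->|k' ->]; last by exists k'.
  by rewrite (ord1 j).
by have := wZ k'; rewrite map_mxM mulmxA map_rsubmx mulmx_rsub mxE -mulmxA -map_mxM.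
Qed.
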